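(* If a regular domain $\Omega$ has the weak Bessel property, then it has the Bessel property; moreover, $C_B(\Omega)\le\sqrt2\,\tilde C_B(\Omega)$.
   Context: $\mathbb D=\{z\in\mathbb C:|z|<1\}$. Regular domain: $\Omega=\mathbb D\setminus\bigcup_j B_j$, where $\{B_j\}$ is a countable (infinite or finite) family of pairwise disjoint compact subsets of $\mathbb D$, called holes, such that each $B_j$ is connected, does not separate the plane, and is the closure of a domain with smooth boundary, and the $B_j$ accumulate only to $\partial\mathbb D$ (every compact subset of $\mathbb D$ meets only finitely many $B_j$). $L^{2,1}_c(\Omega)$ is the Hilbert space of real differential $1$-forms $\omega=\omega_x dx+\omega_y dy$ on $\Omega$ with $\omega_x,\omega_y\in L^2(\Omega)$ that are closed, $d\omega=0$ in the sense of distributions; $\|\omega\|^2=\int_\Omega(\omega_x^2+\omega_y^2)\,d\lambda_2$. For each $j$ let $\gamma_j\subset\Omega$ be a smooth closed curve winding once in the positive direction around $B_j$ and not winding around the other holes; $\mathrm{Per}_j(\omega)=\int_{\gamma_j}\omega$ for smooth closed $L^2$-forms, extended by continuity to a bounded functional on $L^{2,1}_c(\Omega)$. $\mathrm{Per}\,\omega=\{\mathrm{Per}_j\omega\}_j$. Bessel property: $\mathrm{Per}:L^{2,1}_c(\Omega)\to\ell^2$ is bounded; $C_B(\Omega)$ is its norm. Weak Bessel property: $\tilde C_B(\Omega):=\sup_j\|\mathrm{Per}_j\|_{(L^{2,1}_c(\Omega))^*}<+\infty$. *)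

(* Defs.v *)
From mathcomp Require Import all_boot all_order all_algebra.
From mathcomp Require Import all_classical all_reals all_analysis.

Set Implicit Arguments.
Unset Strict Implicit.
Unset Printing Implicit Defensive.
Import Order.TTheory GRing.Theory Num.Theory.
Import numFieldNormedType.Exports.

Local Open Scope classical_set_scope.
Local Open Scope ring_scope.

Notation area := (lebesgue_measure \x lebesgue_measure)%E.

Section Plane.
Context {R : realType}.

(* The complex number z = x + i y is the pair (x, y); the norm that the library
   puts on pairs is the sup norm, which induces the usual topology. *)
Definition unit_disc : set (R * R) := [set p | p.1 ^+ 2 + p.2 ^+ 2 < 1].

Definition dx (f : R * R -> R) : R * R -> R := 'D_(1, 0) f.
Definition dy (f : R * R -> R) : R * R -> R := 'D_(0, 1) f.

(* Iterated partial derivative: [true] stands for d/dx, [false] for d/dy. *)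
Definition partials (s : seq bool) (f : R * R -> R) : R * R -> R :=
  foldr (fun b : bool => if b then dx else dy) f s.

(* C^oo on U (meaningful for U open). *)
Definition smooth_on (U : set (R * R)) (f : R * R -> R) : Prop :=
  forall s p, U p -> differentiable (partials s f) p.

(* U has smooth boundary: near each boundary point it is a sublevel set of a
   smooth function with non-vanishing gradient. *)
Definition smooth_boundary (U : set (R * R)) : Prop :=
  forall p, (closure U `\` interior U) p ->
    exists (V : set (R * R)) (rho : R * R -> R),
      [/\ open V, V p, smooth_on V rho,
          forall q, V q -> (dx rho q, dy rho q) != (0, 0)
        & U `&` V = [set q | rho q < 0] `&` V].

Definition smooth_domain (U : set (R * R)) : Prop :=
  [/\ open U, connected U, U !=set0 & smooth_boundary U].

Record regular_holes (J : Type) (B : J -> set (R * R)) : Prop := RegularHoles {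
  holes_disjoint : trivIset setT B;
  holes_compact : forall j, compact (B j);
  holes_in_disc : forall j, B j `<=` unit_disc;
  holes_connected : forall j, connected (B j);
  holes_nonseparating : forall j, connected (~` B j);
  holes_closure : forall j, exists U, smooth_domain U /\ B j = closure U;
  holes_locally_finite : forall K, compact K -> K `<=` unit_disc ->
    finite_set [set j | B j `&` K !=set0] }.

Definition regular_domain (J : Type) (B : J -> set (R * R)) : set (R * R) :=
  unit_disc `\` \bigcup_j B j.

(* The 1-form w_x dx + w_y dy on Omega is represented by p |-> (w_x p, w_y p);
   the values outside Omega are irrelevant. *)
Definition one_form : Type := R * R -> R * R.

Definition form_norm (Omega : set (R * R)) (w : one_form) : R :=
  Num.sqrt (\int[area]_(p in Omega) ((w p).1 ^+ 2 + (w p).2 ^+ 2)).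

Definition L2_form (Omega : set (R * R)) (w : one_form) : Prop :=
  ((fun p => (w p).1) \_ Omega \in Lfun area 2%:E) /\
  ((fun p => (w p).2) \_ Omega \in Lfun area 2%:E).

Definition test_function (Omega : set (R * R)) (phi : R * R -> R) : Prop :=
  smooth_on setT phi /\
  exists K, [/\ compact K, K `<=` Omega & forall p, ~ K p -> phi p = 0].

(* d w = (d w_y / dx - d w_x / dy) dx /\ dy = 0 as a distribution on Omega. *)
Definition closed_form (Omega : set (R * R)) (w : one_form) : Prop :=
  forall phi, test_function Omega phi ->
    \int[area]_(p in Omega) ((w p).1 * dy phi p - (w p).2 * dx phi p) = 0.

(* L^{2,1}_c(Omega).  Its elements are the classes modulo almost everywhere
   equality of the forms below; [form_norm] and [period] depend on a form only
   through its class. *)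
Definition L2c (Omega : set (R * R)) : set one_form :=
  [set w | L2_form Omega w /\ closed_form Omega w].

Definition smooth_form (Omega : set (R * R)) (w : one_form) : Prop :=
  smooth_on Omega (fun p => (w p).1) /\ smooth_on Omega (fun p => (w p).2).

(* Smooth closed curves, as 1-periodic functions. *)
Definition smooth_loop (g : R -> R * R) : Prop :=
  [/\ forall t, g (t + 1) = g t,
      forall n t, derivable (derive1n n (fun s => (g s).1)) t 1
    & forall n t, derivable (derive1n n (fun s => (g s).2)) t 1].

Definition line_integral (g : R -> R * R) (w : one_form) : R :=
  \int[lebesgue_measure]_(t in `[0, 1]%classic)
    ((w (g t)).1 * derive1 (fun s => (g s).1) t
     + (w (g t)).2 * derive1 (fun s => (g s).2) t).

(* d arg(z - c) *)
Definition darg (c : R * R) : one_form := fun p =>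
  let r2 := (p.1 - c.1) ^+ 2 + (p.2 - c.2) ^+ 2 in
  (- (p.2 - c.2) / r2, (p.1 - c.1) / r2).

Definition winding_number (g : R -> R * R) (c : R * R) : R :=
  line_integral g (darg c) / (2 * pi).

Definition loop_around (J : Type) (B : J -> set (R * R)) (j : J)
    (g : R -> R * R) : Prop :=
  [/\ smooth_loop g, forall t, regular_domain B (g t),
      forall c, B j c -> winding_number g c = 1
    & forall i c, i <> j -> B i c -> winding_number g c = 0].

(* The smooth forms of L^{2,1}_c(Omega) close to w in norm. *)
Definition smooth_near (Omega : set (R * R)) (w : one_form) : set_system one_form :=
  filter_from [set e : R | 0 < e] (fun e =>
    [set s | [/\ L2c Omega s, smooth_form Omega s
                & form_norm Omega (s \- w) < e]]).

(* Extension by continuity of the integral along g from the smooth forms to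
   all of L^{2,1}_c(Omega). *)
Definition period (Omega : set (R * R)) (g : R -> R * R) (w : one_form) : R :=
  lim (line_integral g s @[s --> smooth_near Omega w]).

(* Norm of an operator L from L^{2,1}_c(Omega) to a normed space, given
   N w = || L w ||; it is +oo when L is unbounded. *)
Definition operator_norm (Omega : set (R * R)) (N : one_form -> \bar R) : \bar R :=
  ereal_sup [set N w | w in [set w | L2c Omega w /\ form_norm Omega w <= 1]].

(* The l^2 norm of a family, +oo if it is not square summable. *)
Definition ell2_norm (J : choiceType) (a : J -> R) : \bar R :=
  sqrte (\esum_(j in [set: J]) (a j ^+ 2)%:E).

Section Bessel.
Context (J : choiceType) (Omega : set (R * R)) (g : J -> R -> R * R).

Definition Per (w : one_form) : J -> R := fun j => period Omega (g j) w.

Definition bessel : Prop :=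
  exists C : R, forall w, L2c Omega w ->
    (ell2_norm (Per w) <= (C * form_norm Omega w)%:E)%E.

Definition bessel_const : \bar R :=
  operator_norm Omega (fun w => ell2_norm (Per w)).

(* Supremum in [0, +oo], so that it is 0 if there are no holes. *)
Definition weak_bessel_const : \bar R :=
  ereal_sup ([set 0%E] `|`
    range (fun j => operator_norm Omega (fun w => `|Per w j|%:E))).

Definition weak_bessel : Prop := (weak_bessel_const < +oo)%E.

End Bessel.
End Plane.

(* Main.v *)
(* Let P(w, f) be the integral over Omega of the product of w and d f, namely of
   w_x f_y - w_y f_x; a form w is closed when P(w, f) = 0 for all test functions f.
   The mean over mollified curves of the winding number of gamma_j is a smooth
   function Phi_j, equal to 1 near B_j and to 0 near the other points outside Omega,
   such that Per_j w = lambda P(w, Phi_j) for smooth closed forms w. By Weyl's lemma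
   smooth closed forms are dense, so this holds in all of L^{2,1}_c(Omega).
   Projecting the rotated gradient of Phi_j on the closed forms, the weak Bessel
   property yields u_j in Phi_j + {test functions} with ||grad u_j|| nearly at most
   C / lambda. For c_j >= 0, the function U = (sum_j c_j^2 u_j^2)^(1/2), regularized,
   satisfies |grad U|^2 <= sum_j c_j^2 |grad u_j|^2 and equals sum_j c_j Phi_j off
   Omega, whence sum_j c_j Per_j w <= C |c|_2 ||w||. Taking for c the positive and
   the negative part of Per w gives the factor sqrt 2. *)
Require Import Defs.
From HB Require Import structures.
From mathcomp Require Import all_boot all_order all_algebra.
From mathcomp Require Import all_classical all_reals all_analysis.
From mathcomp Require Import measurable_realfun ring lra.
Import Order.TTheory GRing.Theory Num.Theory.
Import numFieldNormedType.Exports.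
Local Open Scope classical_set_scope.
Local Open Scope ring_scope.

Set Implicit Arguments.
Unset Strict Implicit.

(** * Frechet differentiability in the plane *)

Section FrechetPlane.
Context {R : realType}.
Implicit Types (f g : R * R -> R) (p q h : R * R).

(** Two obstacles shape the argument. The gradients of different u_j overlap, so the cross terms in
    the norm of a linear combination cannot be controlled by bounds on the single u_j. Near a point
    outside Omega, however, at most one u_j differs from 0, and its value is 1 there. An l^2
    combination therefore has the same boundary values as the linear one, while Cauchy-Schwarz at
    each point removes the cross terms. The root returns |c_j| instead of c_j, so signs must be
    separated; each of the two parts of Per w contributes C^2 ||w||^2 to the square sum.

    Secondly, [period] is a bare limit along smooth forms; it makes sense only if these are dense
    and line integrals are continuous for the L^2 norm. Both facts come from one curl-free field,
    equal to p / |p|^2 away from 0, whose divergence is a bump. Testing against the difference of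
    two such fields with different radii gives Weyl's lemma. Integrating the field along gamma_j
    gives a smoothed winding number whose rotated gradient is the mollified curve, so a period
    becomes a scalar product. All boundary conditions turn into identities valid near each point
    outside Omega. *)

Definition linform (a b : R) : R * R -> R := fun h => h.1 * a + h.2 * b.
(** Differentiability is bundled with the two partials because [dx] and [dy] are directional
    derivatives, which may exist where the function is not differentiable and obey no chain rule by
    themselves. *)
Definition grad_at f p (a b : R) : Prop := is_diff p f (linform a b).

Lemma grad_atP f p a b : grad_at f p a b <->
  [/\ differentiable f p, dx f p = a & dy f p = b].
Proof.
split.
  case=> df e; split => //; rewrite /dx /dy deriveE// e /linform /=; ring.
case=> df <- <-; split => //; apply/funext => -[h1 h2]; rewrite /linform /=.
rewrite /dx /dy !deriveE//.
have -> : (h1, h2) = h1 *: ((1, 0) : R * R) + h2 *: ((0, 1) : R * R).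
  by congr pair; rewrite /= /GRing.scale/=; ring.
by rewrite linearD !linearZ.
Qed.

Lemma grad_at_diff f p : differentiable f p -> grad_at f p (dx f p) (dy f p).
Proof. by move=> df; apply/grad_atP. Qed.

Lemma grad_at_dx f p a b : grad_at f p a b -> dx f p = a.
Proof. by case/grad_atP. Qed.

Lemma grad_at_dy f p a b : grad_at f p a b -> dy f p = b.
Proof. by case/grad_atP. Qed.

Lemma grad_at_differentiable f p a b : grad_at f p a b -> differentiable f p.
Proof. by case/grad_atP. Qed.

Lemma grad_at_eq f p a b a' b' : grad_at f p a b -> a = a' -> b = b' -> grad_at f p a' b'.
Proof. by move=> ? <- <-. Qed.

Lemma linform_continuous a b : continuous (linform a b).
Proof.
move=> p; apply: (@cvgD _ _ _ _ _ (fun h : R * R => h.1 * a) (fun h => h.2 * b)).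
  by apply: cvgM; [exact: cvg_fst|exact: cvg_cst].
by apply: cvgM; [exact: cvg_snd|exact: cvg_cst].
Qed.

Lemma linform_linear a b : linear (linform a b).
Proof. by move=> k u v; rewrite /linform /= /GRing.scale /=; ring. Qed.

HB.instance Definition _ a b :=
  @GRing.isLinear.Build R (R * R)%type R *:%R (linform a b) (linform_linear a b).

Lemma grad_at_epsP f p a b : grad_at f p a b <->
  forall e, 0 < e -> \forall h \near (0 : R * R),
    `|f (h + p) - f p - linform a b h| <= e * `|h|.
Proof.
split.
  move=> [df dfE] e e0.
  have [_ H] := (@diff_locallyP _ _ _ p f).1 df.
  rewrite dfE in H.
  have /eqaddoP/(_ _ e0) := H.
  by apply: filterS => h /=; rewrite !fctE /= opprD addrA => H'; exact: H'.
move=> H.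
have E : f \o shift p = cst (f p) + (linform a b : {linear _ -> _}) +o_ (0 : R * R) id.
  apply/eqaddoP => e e0; have := H e e0.
  by apply: filterS => h H'; apply: le_trans H'; rewrite -addrA -opprD.
have D := diff_unique (@linform_continuous a b) E.
split=> //; apply/diff_locallyP; rewrite D; split=> //.
exact: linform_continuous.
Qed.

Lemma grad_at_near f g p a b : (\forall q \near p, f q = g q) ->
  grad_at f p a b -> grad_at g p a b.
Proof.
move=> fg /grad_at_epsP H; apply/grad_at_epsP => e e0; near=> h.
rewrite -(nbhs_singleton fg) -(_ : f (h + p) = g (h + p)).
  by near: h; exact: H.
near: h.
have : (fun h => h + p) @ (0 : R * R) --> p.
  rewrite -{2}(add0r p); apply: cvgD; [exact: cvg_id|exact: cvg_cst].
by move/(_ _ fg).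
Unshelve. all: by end_near. Qed.

Lemma grad_at_cst (c : R) p : grad_at (fun=> c) p 0 0.
Proof.
by apply: is_diff_eq (is_diff_cst c p) _; apply/funext => h; rewrite /linform !mulr0 addr0.
Qed.

Lemma grad_at_fst p : grad_at fst p 1 0.
Proof.
apply/grad_at_epsP => e e0; near=> h; rewrite /linform /=.
rewrite [X in `|X|](_ : _ = 0); last by ring.
by rewrite normr0 mulr_ge0// ltW.
Unshelve. all: by end_near. Qed.

Lemma grad_at_snd p : grad_at snd p 0 1.
Proof.
apply/grad_at_epsP => e e0; near=> h; rewrite /linform /=.
rewrite [X in `|X|](_ : _ = 0); last by ring.
by rewrite normr0 mulr_ge0// ltW.
Unshelve. all: by end_near. Qed.

Lemma grad_atD f g p a b a' b' : grad_at f p a b -> grad_at g p a' b' ->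
  grad_at (fun q => f q + g q) p (a + a') (b + b').
Proof.
move=> df dg; apply: is_diff_eq (is_diffD df dg) _.
by apply/funext => h; rewrite /linform /= ?fctE; ring.
Qed.

Lemma grad_atM f g p a b a' b' : grad_at f p a b -> grad_at g p a' b' ->
  grad_at (fun q => f q * g q) p (f p * a' + g p * a) (f p * b' + g p * b).
Proof.
move=> df dg; apply: is_diff_eq (is_diffM df dg) _.
by apply/funext => h; rewrite /linform /= ?fctE /GRing.scale /=; ring.
Qed.

Lemma grad_at_comp (u : R -> R) f p a b d : grad_at f p a b ->
  is_derive (f p) 1 u d -> grad_at (fun q => u (f q)) p (d * a) (d * b).
Proof.
move=> df [du ud].
have Du : differentiable u (f p) by apply/derivable1_diffP.
have du' : is_diff (f p : R) (u : R -> R) (fun h : R => h * d).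
  by split=> //; rewrite deriv1E// derive1E ud.
apply: is_diff_eq (is_diff_comp df du') _.
by apply/funext => h; rewrite /linform /= /GRing.scale /=; ring.
Qed.

Lemma grad_at_sum (I : Type) (s : seq I) (F : I -> R * R -> R) p (A B : I -> R) :
  (forall i, grad_at (F i) p (A i) (B i)) ->
  grad_at (fun q => \sum_(i <- s) F i q) p (\sum_(i <- s) A i) (\sum_(i <- s) B i).
Proof.
move=> H; elim: s => [|i s IH].
  rewrite !big_nil.
  rewrite (_ : (fun _ => _) = (fun=> 0 : R)); first exact: grad_at_cst.
  by apply/funext => q; rewrite big_nil.
rewrite !big_cons (_ : (fun _ => _) = (fun q => F i q + \sum_(i <- s) F i q)).
  exact: grad_atD.
by apply/funext => q; rewrite big_cons.
Qed.

Lemma grad_at_line f p v t a b : grad_at f (t *: v + p) a b ->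
  is_derive t 1 (fun s => f (s *: v + p)) (v.1 * a + v.2 * b).
Proof.
move=> df.
have dl : is_diff (t : R) (fun s : R => s *: v + p) (fun h : R => h *: v).
  apply: is_diff_eq (is_diffD (is_diff_scalel t v) (is_diff_cst p t)) _.
  by apply/funext => h; rewrite !fctE addr0.
have [d e] := is_diff_comp dl df.
split; first exact/derivable1_diffP.
by rewrite deriveE// e /linform /= /GRing.scale /= !mul1r.
Qed.

Lemma grad_at_path f (g1 g2 : R -> R) t d1 d2 a b : grad_at f (g1 t, g2 t) a b ->
  is_derive t 1 g1 d1 -> is_derive t 1 g2 d2 ->
  is_derive t 1 (fun s => f (g1 s, g2 s)) (d1 * a + d2 * b).
Proof.
move=> df [D1 E1] [D2 E2].
have I1 : is_diff (t : R) g1 (fun h : R => h * d1).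
  have Du : differentiable g1 t by apply/derivable1_diffP.
  by split=> //; rewrite deriv1E// derive1E E1.
have I2 : is_diff (t : R) g2 (fun h : R => h * d2).
  have Du : differentiable g2 t by apply/derivable1_diffP.
  by split=> //; rewrite deriv1E// derive1E E2.
have [d e] := is_diff_comp (is_diff_pair I1 I2) df.
split; first exact/derivable1_diffP.
by rewrite deriveE// e /linform /= /GRing.scale /= !mul1r.
Qed.

Lemma differentiable_near f g p : (\forall q \near p, f q = g q) ->
  differentiable f p -> differentiable g p.
Proof.
move=> fg df; apply: grad_at_differentiable; apply: grad_at_near fg _.
exact: grad_at_diff.
Qed.

End FrechetPlane.

(** * Smooth functions *)

Section Flat.
Context {R : realType}.
Implicit Types x : R.

(** The flat function e^(-1/x) with a pole factor x^(-n). The index makes the family stable under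
    differentiation: the derivative of [flat n] is a combination of [flat n.+1] and [flat n.+2]. *)
Definition flat (n : nat) x : R := if 0 < x then x^-1 ^+ n * expR (- x^-1) else 0.

Lemma flat_le0 n x : x <= 0 -> flat n x = 0.
Proof. by rewrite /flat leNgt => /negbTE ->. Qed.

Lemma flat_gt0 n x : 0 < x -> 0 < flat n x.
Proof. by move=> x0; rewrite /flat x0 mulr_gt0 ?expR_gt0// exprn_gt0// invr_gt0. Qed.

Lemma flat_ge0 n x : 0 <= flat n x.
Proof. by case: (ltP 0 x) => [/(flat_gt0 n)/ltW//|/(flat_le0 n)->]. Qed.

(** With u = 1/x, the exponential series gives e^u >= u^(n+2) / (n+2)!. The exponent n+2 leaves a
    factor x^2, enough for a zero derivative at 0. *)
Lemma flat_bound n x : flat n x <= n.+2`!%:R * x ^+ 2.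
Proof.
case: (ltP 0 x) => [x0|/flat_le0->]; last by rewrite mulr_ge0// sqr_ge0.
rewrite /flat x0; set u := x^-1.
have u0 : 0 < u by rewrite invr_gt0.
have E : u ^+ n.+2 / n.+2`!%:R <= expR u.
  by apply: le_trans (expR_ge1Dxn n.+1 (ltW u0)); rewrite lerDr.
have f0 : 0 < n.+2`!%:R :> R by rewrite ltr0n fact_gt0.
rewrite expRN ler_pdivrMr ?expR_gt0//.
have -> : u ^+ n = u ^+ n.+2 * x ^+ 2.
  by rewrite -addn2 exprD -mulrA -exprMn /u mulVf ?gt_eqF// expr1n mulr1.
rewrite ler_pdivrMr// in E.
rewrite [leRHS]mulrAC; apply: ler_wpM2r; first exact: sqr_ge0.
by rewrite mulrC.
Qed.

Lemma is_derive_flat n x : is_derive x 1 (flat n) (- n%:R * flat n.+1 x + flat n.+2 x).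
Proof.
have [x0|x0|->] := ltgtP x 0.
- rewrite !flat_le0 ?(ltW x0)// mulr0 addr0.
  apply: (@near_eq_is_derive _ _ _ (fun=> 0 : R)).
  near=> y; rewrite flat_le0//; apply/ltW; near: y; exact: lt_nbhsl.
- have D : is_derive x 1 (fun y : R => y^-1 ^+ n * expR (- y^-1))
      (- n%:R * flat n.+1 x + flat n.+2 x).
    have x0' : x != 0 by rewrite gt_eqF.
    have DV := is_deriveV x0' (is_derive_id x (1 : R)).
    have DP : is_derive (x^-1) 1 (fun y : R => y ^+ n) (n%:R * x^-1 ^+ n.-1).
      split; first exact: exprn_derivable.
      by rewrite exp_derive /GRing.scale /= mulr1.
    have DX := @is_derive1_comp _ (fun y : R => y ^+ n) (fun y : R => y^-1) x _ _ DP DV.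
    have DE := @is_derive1_comp _ expR (fun y : R => - y^-1) x _ _ (is_derive_expR (- x^-1)) (is_deriveN DV).
    apply: is_derive_eq (is_deriveM DX DE) _.
    rewrite /flat x0 /GRing.scale /=.
    case: n {DX DP} => [|n]; rewrite /= ?fctE !exprS ?expr0 ?invfM ?invr1.
      by move: (expR _) => e; ring.
    by move: (expR _) (n.+1%:R) => e m; ring.
  apply: near_eq_is_derive D.
  near=> y; rewrite /flat ifT//; near: y; exact: lt_nbhsr.
- rewrite !flat_le0// mulr0 addr0.
  (* The inverse of 0 is 0, so this slope function already takes at 0 the value of the wanted
     derivative. *)
  apply/is_derive1_caratheodory; exists (fun z => flat n z / z); split.
  + move=> z; rewrite (flat_le0 n (lexx 0)) !subr0.
    by have [->|z0] := eqVneq z 0; [rewrite mulr0 flat_le0|rewrite divfK].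
  + have E0 : flat n 0 / 0 = 0 by rewrite invr0 mulr0.
    suff : (fun z : R => flat n z / z) @ (0 : R) --> (0 : R) by rewrite -[X in _ --> X]E0.
    apply/cvgrPdist_le => e e0; near=> z; rewrite sub0r normrN.
    have [->|z0] := eqVneq z 0; first by rewrite invr0 mulr0 normr0 ltW.
    rewrite normrM normfV ger0_norm ?flat_ge0//.
    rewrite ler_pdivrMr ?normr_gt0//; apply: le_trans (flat_bound n z) _.
    rewrite -[z ^+ 2]ger0_norm ?sqr_ge0// normrX expr2 mulrA ler_pM2r ?normr_gt0//.
    rewrite mulrC -ler_pdivlMr ?ltr0n ?fact_gt0//.
    near: z; apply: (@nbhs0_le R R^o (e / n.+2`!%:R)); by rewrite divr_gt0// ltr0n fact_gt0.
  + by rewrite (flat_le0 n (lexx 0)) mul0r.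
Unshelve. all: by end_near. Qed.

End Flat.

Section Smooth.
Context {R : realType}.
Implicit Types (U V : set (R * R)) (f g : R * R -> R) (p : R * R).

Lemma partials_rcons s b f : partials (rcons s b) f = partials s (if b then dx f else dy f).
Proof. by rewrite /partials foldr_rcons; case: b. Qed.

Lemma smooth_dx U f : smooth_on U f -> smooth_on U (dx f).
Proof. by move=> H s p Up; rewrite -(partials_rcons s true); exact: H. Qed.

Lemma smooth_dy U f : smooth_on U f -> smooth_on U (dy f).
Proof. by move=> H s p Up; rewrite -(partials_rcons s false); exact: H. Qed.

Lemma smooth_grad U f p : smooth_on U f -> U p -> grad_at f p (dx f p) (dy f p).
Proof. by move=> H Up; apply: grad_at_diff; exact: (H [::]). Qed.

Lemma smooth_sub U V f : V `<=` U -> smooth_on U f -> smooth_on V f.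
Proof. by move=> VU H s p Vp; apply: H; exact: VU. Qed.

Lemma smooth_ext U f g : open U -> (forall p, U p -> f p = g p) ->
  smooth_on U f -> smooth_on U g.
Proof.
move=> oU fg H.
suff E s p : U p -> partials s f p = partials s g p.
  move=> s p Up; apply: differentiable_near (H s p Up).
  by apply: filterS (open_nbhs_nbhs (conj oU Up)) => q; exact: E.
elim: s p => [|b s IH] p Up /=; first exact: fg.
by case: b; apply: near_eq_derive;
  apply: filterS (open_nbhs_nbhs (conj oU Up)) => q Uq; rewrite IH.
Qed.

(** Expressions stable under differentiation: by [alg_grad] the partial derivatives are of the same
    kind, so all orders are reached by iterating one rule. The side conditions of inverse and root
    are required on [U] only. *)
Inductive alg U : (R * R -> R) -> Prop :=
| alg_base f : smooth_on U f -> alg U f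
| alg_cst c : alg U (fun=> c)
| alg_fst : alg U fst
| alg_snd : alg U snd
| alg_add f g : alg U f -> alg U g -> alg U (fun p => f p + g p)
| alg_mul f g : alg U f -> alg U g -> alg U (fun p => f p * g p)
| alg_flat n f : alg U f -> alg U (fun p => flat n (f p))
| alg_inv f : (forall p, U p -> f p != 0) -> alg U f -> alg U (fun p => (f p)^-1)
| alg_sqrt f : (forall p, U p -> 0 < f p) -> alg U f -> alg U (fun p => Num.sqrt (f p)).

Lemma alg_grad U f : alg U f -> exists fx fy,
  [/\ alg U fx, alg U fy & forall p, U p -> grad_at f p (fx p) (fy p)].
Proof.
elim=> {f} [f sf|c| | |f g af [fx [fy [ax ay df]]] ag [gx [gy [bx by' dg]]]
  |f g af [fx [fy [ax ay df]]] ag [gx [gy [bx by' dg]]]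
  |n f af [fx [fy [ax ay df]]]|f f0 af [fx [fy [ax ay df]]]|f f0 af [fx [fy [ax ay df]]]].
- exists (dx f), (dy f); split => [| |p Up]; last exact: (smooth_grad sf).
    by apply: alg_base; exact: smooth_dx.
  by apply: alg_base; exact: smooth_dy.
- exists (fun=> 0), (fun=> 0); split => [| |p Up]; [exact: alg_cst..|exact: grad_at_cst].
- exists (fun=> 1), (fun=> 0); split => [| |p Up]; [exact: alg_cst..|exact: grad_at_fst].
- exists (fun=> 0), (fun=> 1); split => [| |p Up]; [exact: alg_cst..|exact: grad_at_snd].
- exists (fun p => fx p + gx p), (fun p => fy p + gy p); split => [| |p Up].
  + exact: alg_add.
  + exact: alg_add.
  + by apply: grad_atD; [exact: df|exact: dg].
- exists (fun p => f p * gx p + g p * fx p), (fun p => f p * gy p + g p * fy p).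
  split => [| |p Up].
  + by apply: alg_add; exact: alg_mul.
  + by apply: alg_add; exact: alg_mul.
  + by apply: grad_atM; [exact: df|exact: dg].
- pose d p := - n%:R * flat n.+1 (f p) + flat n.+2 (f p).
  have ad : alg U d.
    apply: alg_add; last exact: alg_flat.
    by apply: (alg_mul (alg_cst U (- n%:R))); exact: alg_flat.
  exists (fun p => d p * fx p), (fun p => d p * fy p); split => [| |p Up].
  + exact: alg_mul.
  + exact: alg_mul.
  + by apply: grad_at_comp; [exact: df|exact: is_derive_flat].
- pose d p := -1 * ((f p)^-1 * (f p)^-1).
  have ad : alg U d.
    by apply: (alg_mul (alg_cst U (-1))); apply: alg_mul; exact: alg_inv.
  exists (fun p => d p * fx p), (fun p => d p * fy p); split => [| |p Up].
  + exact: alg_mul.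
  + exact: alg_mul.
  + apply: (@grad_at_comp _ (fun x : R => x^-1)); first exact: df.
    apply: is_derive_eq (is_deriveV (f0 _ Up) (is_derive_id (f p) (1 : R))) _.
    by rewrite /d /GRing.scale /= mulr1 mulN1r -expr2 exprVn.
- pose d p := 2^-1 * (Num.sqrt (f p))^-1.
  have ad : alg U d.
    apply: (alg_mul (alg_cst U 2^-1)); apply: alg_inv; last exact: alg_sqrt.
    by move=> p Up; rewrite gt_eqF// sqrtr_gt0 f0.
  exists (fun p => d p * fx p), (fun p => d p * fy p); split => [| |p Up].
  + exact: alg_mul.
  + exact: alg_mul.
  + apply: (@grad_at_comp _ (fun x : R => Num.sqrt x)); first exact: df.
    by apply: is_derive_eq (is_derive1_sqrt (f0 _ Up)) _; rewrite invfM.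
Qed.

(** Every iterated partial coincides on [U] with a member of [alg]; agreement on an open set is what
    passes to the next derivative. *)
Lemma alg_smooth U f : open U -> alg U f -> smooth_on U f.
Proof.
move=> oU af.
suff E s : exists2 fs, alg U fs & forall p, U p -> partials s f p = fs p.
  move=> s p Up; have [fs afs e] := E s.
  have [fx [fy [_ _ /(_ p Up)/grad_at_differentiable]]] := alg_grad afs.
  apply: differentiable_near.
  by apply: filterS (open_nbhs_nbhs (conj oU Up)) => q Uq; rewrite e.
elim: s => [|b s [g ag e]]; first by exists f.
have [gx [gy [ax ay dg]]] := alg_grad ag.
exists (if b then gx else gy); first by case: b.
move=> p Up.
have N : \forall q \near p, partials s f q = g q.
  by apply: filterS (open_nbhs_nbhs (conj oU Up)) => q; exact: e.
case: b; rewrite /= /dx /dy (near_eq_derive _ N).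
  exact: (grad_at_dx (dg p Up)).
exact: (grad_at_dy (dg p Up)).
Qed.

Lemma smooth_cst U c : open U -> smooth_on U (fun=> c).
Proof. by move=> oU; apply: alg_smooth => //; exact: alg_cst. Qed.

Lemma smoothD U f g : open U -> smooth_on U f -> smooth_on U g ->
  smooth_on U (fun p => f p + g p).
Proof. by move=> oU sf sg; apply: alg_smooth => //; apply: alg_add; exact: alg_base. Qed.

Lemma smoothM U f g : open U -> smooth_on U f -> smooth_on U g ->
  smooth_on U (fun p => f p * g p).
Proof. by move=> oU sf sg; apply: alg_smooth => //; apply: alg_mul; exact: alg_base. Qed.

Lemma smoothZ U c f : open U -> smooth_on U f -> smooth_on U (fun p => c * f p).
Proof. by move=> oU sf; apply: smoothM => //; exact: smooth_cst. Qed.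

Lemma smoothB U f g : open U -> smooth_on U f -> smooth_on U g ->
  smooth_on U (fun p => f p - g p).
Proof.
move=> oU sf sg; rewrite (_ : (fun _ => _) = fun p => f p + (-1) * g p).
  by apply: smoothD => //; exact: smoothZ.
by apply/funext => p; rewrite mulN1r.
Qed.

Lemma smooth_sum U (I : Type) (s : seq I) (F : I -> R * R -> R) : open U ->
  (forall i, smooth_on U (F i)) -> smooth_on U (fun p => \sum_(i <- s) F i p).
Proof.
move=> oU H; elim: s => [|i s IH].
  rewrite (_ : (fun _ => _) = (fun=> 0 : R)); first exact: smooth_cst.
  by apply/funext => q; rewrite big_nil.
rewrite (_ : (fun _ => _) = (fun q => F i q + \sum_(i <- s) F i q)).
  exact: smoothD.
by apply/funext => q; rewrite big_cons.
Qed.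

Lemma smooth_sqrt U f : open U -> (forall p, U p -> 0 < f p) -> smooth_on U f ->
  smooth_on U (fun p => Num.sqrt (f p)).
Proof. by move=> oU f0 sf; apply: alg_smooth => //; apply: alg_sqrt => //; exact: alg_base. Qed.

Lemma smooth_continuous U f p : smooth_on U f -> U p -> {for p, continuous f}.
Proof. by move=> sf Up; apply: differentiable_continuous; exact: (sf [::]). Qed.

Lemma grad_at_shift f c p a b : grad_at f (p - c) a b ->
  grad_at (fun q => f (q - c)) p a b.
Proof.
move=> /grad_at_epsP H; apply/grad_at_epsP => e e0.
by apply: filterS (H e e0) => h; rewrite addrA.
Qed.

Lemma smooth_shift f c : smooth_on setT f -> smooth_on setT (fun p => f (p - c)).
Proof.
move=> sf.
suff E s : partials s (fun p => f (p - c)) = fun p => partials s f (p - c).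
  move=> s p _; rewrite E; apply: (@grad_at_differentiable _ _ _ (dx (partials s f) (p - c))
    (dy (partials s f) (p - c))).
  by apply: grad_at_shift; apply: grad_at_diff; exact: sf.
elim: s => [//|b s IH]; apply/funext => p.
have D : grad_at (fun q => partials s f (q - c)) p (dx (partials s f) (p - c))
    (dy (partials s f) (p - c)).
  by apply: grad_at_shift; apply: grad_at_diff; exact: sf.
by case: b; rewrite /= IH ?(grad_at_dx D) ?(grad_at_dy D).
Qed.

End Smooth.

(** * Radial kernels *)

Section RadialKernel.
Context {R : realType}.
Variables (a b : R).
Hypotheses (a0 : 0 < a) (ab : a < b).
Implicit Types (s : R) (p : R * R).

Let A s := flat 0 (s - a).
Let B s := flat 0 (b - s).
(** The usual smooth transition from 0 below [a] to 1 above [b]; the two terms of the denominator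
    never vanish together because [a < b]. *)
Definition step s : R := flat 0 (s - a) / (flat 0 (s - a) + flat 0 (b - s)).

Let AB_gt0 s : 0 < A s + B s.
Proof.
have [sb|bs] := ltP s b.
  by rewrite ltr_wpDl ?flat_ge0// flat_gt0 ?subr_gt0.
by rewrite ltr_pwDl ?flat_ge0// flat_gt0 ?subr_gt0// (lt_le_trans ab).
Qed.

Lemma step_lo s : s <= a -> step s = 0.
Proof. by move=> sa; rewrite /step flat_le0 ?mul0r// subr_le0. Qed.

Lemma step_hi s : b <= s -> step s = 1.
Proof.
move=> bs; rewrite /step; have := AB_gt0 s; rewrite /A /B.
by rewrite [flat 0 (b - s)]flat_le0 ?subr_le0// addr0 => h; rewrite divff ?gt_eqF.
Qed.

Definition step' s : R :=
  (flat 2 (s - a) * flat 0 (b - s) + flat 0 (s - a) * flat 2 (b - s)) /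
  (flat 0 (s - a) + flat 0 (b - s)) ^+ 2.

Lemma step'_ge0 s : 0 <= step' s.
Proof. by rewrite divr_ge0 ?sqr_ge0// addr_ge0// mulr_ge0// flat_ge0. Qed.

Lemma is_derive_step s : is_derive s 1 step (step' s).
Proof.
have DA : is_derive s 1 A (flat 2 (s - a)).
  apply: is_derive_eq (@is_derive1_comp _ (flat 0) (fun x : R => x - a) s _ _ (is_derive_flat 0 (s - a))
    (is_deriveB (is_derive_id s (1 : R)) (is_derive_cst a s (1 : R)))) _.
  by move: (flat _ _) (flat _ _) => u v; rewrite /=; ring.
have DB : is_derive s 1 B (- flat 2 (b - s)).
  apply: is_derive_eq (@is_derive1_comp _ (flat 0) (fun x : R => b - x) s _ _ (is_derive_flat 0 (b - s))
    (is_deriveB (is_derive_cst b s (1 : R)) (is_derive_id s (1 : R)))) _.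
  by move: (flat _ _) (flat _ _) => u v; rewrite /=; ring.
have ne : A s + B s != 0 by rewrite gt_eqF.
have DI := @is_deriveV _ (fun x => A x + B x) s _ 1 ne (is_deriveD DA DB).
apply: is_derive_eq (is_deriveM DA DI) _.
rewrite /step' -/(A s) -/(B s) /GRing.scale /=.
by field.
Qed.

(* smooth at 0, since step vanishes nearby *)
Definition radial s : R := step s / s.
Definition radial' s : R := (step' s - radial s) / s.

Lemma radial_lo s : s <= a -> radial s = 0.
Proof. by move=> sa; rewrite /radial step_lo ?mul0r. Qed.

Lemma step'_lo s : s < a -> step' s = 0.
Proof.
move=> sa; rewrite /step' !(@flat_le0 _ _ (s - a)) ?subr_le0 ?ltW//.
by rewrite !mul0r addr0 mul0r.
Qed.

Lemma step'_hi s : b < s -> step' s = 0.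
Proof.
move=> sa; rewrite /step' !(@flat_le0 _ _ (b - s)) ?subr_le0 ?ltW//.
by rewrite !mulr0 addr0 mul0r.
Qed.

Lemma radial_hi s : b <= s -> radial s = s^-1.
Proof. by move=> bs; rewrite /radial step_hi// div1r. Qed.

Lemma is_derive_radial s : is_derive s 1 radial (radial' s).
Proof.
have [sa|sa] := ltP s a.
  rewrite /radial' step'_lo// radial_lo ?ltW// subr0 mul0r.
  apply: (@near_eq_is_derive _ _ _ (fun=> 0 : R)).
  by near=> t; rewrite radial_lo//; apply/ltW; near: t; exact: lt_nbhsl.
have s0 : s != 0 by rewrite gt_eqF// (lt_le_trans a0).
apply: is_derive_eq (is_deriveM (is_derive_step s) (is_deriveV s0 (is_derive_id s (1 : R)))) _.
rewrite /radial' /radial /GRing.scale /=; by field.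
Unshelve. all: by end_near. Qed.

(** The product rule for step s = s * radial s. At s = 0, where [radial'] is a default quotient,
    both sides vanish. *)
Lemma radialE s : radial s + s * radial' s = step' s.
Proof.
have [->|s0] := eqVneq s 0; last by rewrite /radial' mulrC divfK// addrC subrK.
by rewrite mul0r radial_lo ?ltW// step'_lo// addr0.
Qed.

Definition nrm2 p : R := p.1 ^+ 2 + p.2 ^+ 2.

Lemma grad_nrm2 p : grad_at nrm2 p (2 * p.1) (2 * p.2).
Proof.
apply: grad_at_eq (grad_atD (grad_atM (grad_at_fst p) (grad_at_fst p))
  (grad_atM (grad_at_snd p) (grad_at_snd p))) _ _; ring.
Qed.

(** The field ([kerX], [kerY]) is the gradient of log |p|, regularized at the origin: it equals p /
    |p|^2 as soon as |p|^2 >= b. Being radial it is curl-free, and its divergence [bump] lives in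
    the annulus a <= |p|^2 <= b. *)
Definition kerX p : R := p.1 * radial (nrm2 p).
Definition kerY p : R := p.2 * radial (nrm2 p).
Definition bump p : R := 2 * step' (nrm2 p).

Lemma grad_radial p : grad_at (fun q => radial (nrm2 q)) p
  (radial' (nrm2 p) * (2 * p.1)) (radial' (nrm2 p) * (2 * p.2)).
Proof. exact: grad_at_comp (grad_nrm2 p) (is_derive_radial _). Qed.

Lemma grad_kerX p : grad_at kerX p
  (radial (nrm2 p) + 2 * p.1 ^+ 2 * radial' (nrm2 p)) (2 * p.1 * p.2 * radial' (nrm2 p)).
Proof. apply: grad_at_eq (grad_atM (grad_at_fst p) (grad_radial p)) _ _; ring. Qed.

Lemma grad_kerY p : grad_at kerY p
  (2 * p.1 * p.2 * radial' (nrm2 p)) (radial (nrm2 p) + 2 * p.2 ^+ 2 * radial' (nrm2 p)).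
Proof. apply: grad_at_eq (grad_atM (grad_at_snd p) (grad_radial p)) _ _; ring. Qed.

Lemma curl_ker p : dy kerX p = dx kerY p.
Proof. by rewrite (grad_at_dy (grad_kerX p)) (grad_at_dx (grad_kerY p)). Qed.

Lemma div_ker p : dx kerX p + dy kerY p = bump p.
Proof.
rewrite (grad_at_dx (grad_kerX p)) (grad_at_dy (grad_kerY p)) /bump -radialE /nrm2; ring.
Qed.

Lemma bump_ge0 p : 0 <= bump p.
Proof. by rewrite mulr_ge0// step'_ge0. Qed.

Lemma bumpN p : bump (- p) = bump p.
Proof. by rewrite /bump /nrm2 /= !sqrrN. Qed.

Lemma bump_supp p : b < nrm2 p -> bump p = 0.
Proof. by move=> h; rewrite /bump step'_hi// mulr0. Qed.

Lemma nrm2_open : open [set p | 0 < nrm2 p].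
Proof.
apply: (@open_comp _ _ nrm2 [set x : R | 0 < x]) => [p _|]; last exact: open_gt.
exact: differentiable_continuous (grad_at_differentiable (grad_nrm2 p)).
Qed.

Lemma nrm2_open_lt (c : R) : open [set p | nrm2 p < c].
Proof.
apply: (@open_comp _ _ nrm2 [set x : R | x < c]) => [p _|]; last exact: open_lt.
exact: differentiable_continuous (grad_at_differentiable (grad_nrm2 p)).
Qed.

Lemma alg_nrm2 U : alg U nrm2.
Proof.
rewrite (_ : nrm2 = fun p => p.1 * p.1 + p.2 * p.2); last by apply/funext => p; rewrite /nrm2 !expr2.
by apply: alg_add; apply: alg_mul; (exact: alg_fst || exact: alg_snd).
Qed.

(** The open sets given by 0 < |p|^2 and |p|^2 < a cover the plane; on the first the quotient
    belongs to [alg], on the second it is 0. *)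
Lemma smooth_radial : smooth_on setT (fun p => radial (nrm2 p)).
Proof.
move=> s p _.
have [p0|p0] := ltP 0 (nrm2 p).
  have : smooth_on [set q | 0 < nrm2 q] (fun p => radial (nrm2 p)).
    apply: alg_smooth; first exact: nrm2_open.
    rewrite /radial /step.
    have al : alg [set q | 0 < nrm2 q] (fun q => flat 0 (nrm2 q - a)).
      by apply: (@alg_flat _ _ 0%N (fun q => nrm2 q - a)); apply: alg_add; [exact: alg_nrm2|exact: alg_cst].
    have bl : alg [set q | 0 < nrm2 q] (fun q => flat 0 (b - nrm2 q)).
      apply: (@alg_flat _ _ 0%N (fun q => b - nrm2 q)).
      rewrite (_ : (fun _ => _) = (fun q => b + (-1) * nrm2 q)).
        apply: (alg_add (alg_cst _ b)); apply: (alg_mul (alg_cst _ (-1))); exact: alg_nrm2.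
      by apply/funext => q; rewrite mulN1r.
    apply: alg_mul.
      apply: (alg_mul al); apply: alg_inv; last exact: alg_add.
      by move=> q _; rewrite gt_eqF// AB_gt0.
    apply: alg_inv; last exact: alg_nrm2.
    by move=> q q0; rewrite gt_eqF.
  exact.
have : smooth_on [set q | nrm2 q < a] (fun p => radial (nrm2 p)).
  apply: (@smooth_ext _ _ (fun=> 0)); first exact: nrm2_open_lt.
    by move=> q /= qa; rewrite radial_lo// ltW.
  by apply: smooth_cst; exact: nrm2_open_lt.
by apply; rewrite /= (le_lt_trans p0).
Qed.

Lemma smooth_kerX : smooth_on setT kerX.
Proof.
by apply: alg_smooth; [exact: openT|apply: (alg_mul (alg_fst _)); apply: alg_base; exact: smooth_radial].
Qed.

Lemma smooth_kerY : smooth_on setT kerY.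
Proof.
by apply: alg_smooth; [exact: openT|apply: (alg_mul (alg_snd _)); apply: alg_base; exact: smooth_radial].
Qed.

Lemma smooth_bump : smooth_on setT bump.
Proof.
rewrite (_ : bump = fun p => dx kerX p + dy kerY p); last by apply/funext => p; rewrite div_ker.
apply: smoothD; first exact: openT.
  exact: smooth_dx smooth_kerX.
exact: smooth_dy smooth_kerY.
Qed.

Lemma bump_pos : 0 < bump (Num.sqrt ((a + b) / 2), 0).
Proof.
have e : nrm2 (Num.sqrt ((a + b) / 2), 0) = (a + b) / 2.
  rewrite /nrm2 /= expr0n /= addr0 sqr_sqrtr//; have := a0; have := ab; lra.
rewrite /bump e mulr_gt0// /step' divr_gt0//; last first.
  by rewrite exprn_gt0// AB_gt0.
by rewrite ltr_pwDl// ?mulr_ge0 ?flat_ge0// mulr_gt0// flat_gt0//; have := ab; lra.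
Qed.

End RadialKernel.

(** * Taylor expansion and symmetry of second derivatives *)

Section PlaneCalculus.
Context {R : realType}.
Implicit Types (f K : R * R -> R) (p q h v : R * R).

Lemma segment_mvt f p v :
  (forall s : R, 0 <= s <= 1 -> differentiable f (s *: v + p)) ->
  exists2 c : R, 0 <= c <= 1 &
    f (v + p) - f p = v.1 * dx f (c *: v + p) + v.2 * dy f (c *: v + p).
Proof.
move=> df.
pose g (s : R) := f (s *: v + p).
pose dg (s : R) := v.1 * dx f (s *: v + p) + v.2 * dy f (s *: v + p).
have Dg (s : R) : 0 <= s <= 1 -> is_derive s 1 g (dg s).
  by move=> s01; apply: grad_at_line; apply: grad_at_diff; exact: df.
have [|||c c01 e] := @MVT_segment _ g dg 0 1.
- exact: ler01.
- by move=> s; rewrite in_itv /= => /andP[s0 s1]; apply: Dg; rewrite !ltW.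
- apply: derivable_within_continuous => s; rewrite in_itv /= => s01.
  exact: (@ex_derive _ _ _ _ _ _ _ (Dg s s01)).
exists c; first by move: c01; rewrite in_itv.
by move: e; rewrite /g /dg scale1r scale0r add0r subr0 mulr1.
Qed.

Lemma norm_fst p : `|p.1| <= `|p|.
Proof. by rewrite prod_normE le_max lexx. Qed.

Lemma norm_snd p : `|p.2| <= `|p|.
Proof. by rewrite prod_normE le_max lexx orbT. Qed.

Lemma segment_norm p v (M s : R) : `|p| <= M -> `|v + p| <= M -> 0 <= s <= 1 ->
  `|s *: v + p| <= M.
Proof.
move=> pM vM /andP[s0 s1].
have -> : s *: v + p = s *: (v + p) + (1 - s) *: p.
  by rewrite scalerDr scalerBl scale1r -addrA; congr (_ + _); rewrite addrC subrK.
apply: le_trans (ler_normD _ _) _; rewrite !normrZ (ger0_norm s0) ger0_norm ?subr_ge0//.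
have : s * `|v + p| <= s * M by rewrite ler_wpM2l.
have : (1 - s) * `|p| <= (1 - s) * M by rewrite ler_wpM2l// subr_ge0.
lra.
Qed.

Lemma linform_norm (a b c : R) v : `|a| <= c -> `|b| <= c ->
  `|v.1 * a + v.2 * b| <= 2 * c * `|v|.
Proof.
move=> ac bc; apply: le_trans (ler_normD _ _) _; rewrite !normrM.
have := ler_pM (normr_ge0 _) (normr_ge0 _) (norm_fst v) ac.
have := ler_pM (normr_ge0 _) (normr_ge0 _) (norm_snd v) bc.
lra.
Qed.

Lemma segment_lipschitz f p v (c : R) :
  (forall s : R, 0 <= s <= 1 -> [/\ differentiable f (s *: v + p),
     `|dx f (s *: v + p)| <= c & `|dy f (s *: v + p)| <= c]) ->
  `|f (v + p) - f p| <= 2 * c * `|v|.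
Proof.
move=> H; have [s s01 ->] : exists2 c : R, 0 <= c <= 1 &
    f (v + p) - f p = v.1 * dx f (c *: v + p) + v.2 * dy f (c *: v + p).
  by apply: segment_mvt => s /H[].
by have [_ ? ?] := H s s01; exact: linform_norm.
Qed.

(** The remainder is h paired with the increment of the gradient between p and an intermediate
    point, and the mean value theorem estimates that increment again. Each pairing costs a factor 2,
    since the norm is the sup norm; whence 4. *)
Lemma taylor1 K (M A : R) p h : smooth_on setT K ->
  (forall q, `|q| <= M -> [/\ `|dx (dx K) q| <= A, `|dy (dx K) q| <= A,
     `|dx (dy K) q| <= A & `|dy (dy K) q| <= A]) ->
  `|p| <= M -> `|h + p| <= M ->
  `|K (h + p) - K p - linform (dx K p) (dy K p) h| <= 4 * A * `|h| ^+ 2.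
Proof.
move=> sK KA pM hM.
have [s s01 ->] : exists2 c : R, 0 <= c <= 1 &
    K (h + p) - K p = h.1 * dx K (c *: h + p) + h.2 * dy K (c *: h + p).
  by apply: segment_mvt => s _; exact: (sK [::]).
have sh : `|s *: h| <= `|h|.
  by case/andP: s01 => s0 s1; rewrite normrZ ger0_norm// ler_piMl.
have A0 : 0 <= A by have [/(le_trans (normr_ge0 _))] := KA p pM.
have shp := segment_norm pM hM s01.
have L f : (forall q, differentiable f q) -> (forall q, `|q| <= M -> `|dx f q| <= A /\ `|dy f q| <= A) ->
    `|f (s *: h + p) - f p| <= 2 * A * `|h|.
  move=> df fA; apply: (@le_trans _ _ (2 * A * `|s *: h|)).
    apply: segment_lipschitz => t t01.
    by have [//|] := fA (t *: (s *: h) + p); first exact: segment_norm.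
  by rewrite ler_wpM2l// mulr_ge0.
have Lx : `|dx K (s *: h + p) - dx K p| <= 2 * A * `|h|.
  by apply: L => [q|q /KA[]//]; exact: (smooth_dx sK [::]).
have Ly : `|dy K (s *: h + p) - dy K p| <= 2 * A * `|h|.
  by apply: L => [q|q /KA[]//]; exact: (smooth_dy sK [::]).
rewrite /linform [X in `|X|](_ : _ = h.1 * (dx K (s *: h + p) - dx K p) +
   h.2 * (dy K (s *: h + p) - dy K p)); last by ring.
apply: le_trans (linform_norm _ Lx Ly) _.
by rewrite le_eqVlt; apply/orP; left; apply/eqP; ring.
Qed.

Lemma compact_ball (M : R) : compact [set p : R * R | `|p| <= M].
Proof.
rewrite (_ : mkset _ = `[- M, M]%classic `*` `[- M, M]%classic).
  by apply: compact_setX; exact: segment_compact.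
apply/seteqP; split => -[x y] /=; rewrite prod_normE /= ge_max !in_itv /= !ler_norml.
  by case/andP.
by case=> -> ->.
Qed.

Lemma continuous_bounded K (A : set (R * R)) : compact A -> (forall p, A p -> {for p, continuous K}) ->
  exists2 M : R, 0 <= M & forall p, A p -> `|K p| <= M.
Proof.
move=> cA cK.
have [A0|/set0P/negP/negPn/eqP ->] := pselect (A !=set0); last by exists 0.
have cK' : {within A, continuous (fun p => `|K p|)}.
  apply: continuous_in_subspaceT => p; rewrite inE => Ap.
  exact: (cvg_norm (cK p Ap)).
have [c _ cM] := compact_EVT_max A0 cA cK'.
by exists `|K c| => // p Ap; apply: cM; rewrite inE.
Qed.

Lemma smooth_bounded K (M : R) : smooth_on setT K ->
  exists2 A : R, 0 <= A & forall q, `|q| <= M -> `|K q| <= A.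
Proof.
move=> sK; have [|A A0 H] := @continuous_bounded K _ (@compact_ball M); last by exists A.
by move=> p _; exact: smooth_continuous sK I.
Qed.

Lemma smooth_taylor K (M : R) : smooth_on setT K ->
  exists2 A : R, 0 <= A & forall p h, `|p| <= M -> `|h + p| <= M ->
  `|K (h + p) - K p - linform (dx K p) (dy K p) h| <= A * `|h| ^+ 2.
Proof.
move=> sK.
have [A1 A10 H1] := smooth_bounded M (smooth_dx (smooth_dx sK)).
have [A2 A20 H2] := smooth_bounded M (smooth_dy (smooth_dx sK)).
have [A3 A30 H3] := smooth_bounded M (smooth_dx (smooth_dy sK)).
have [A4 A40 H4] := smooth_bounded M (smooth_dy (smooth_dy sK)).
exists (4 * (A1 + A2 + A3 + A4)); first by rewrite mulr_ge0// !addr_ge0.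
move=> p h pM hM; apply: taylor1 pM hM => // q qM.
by split; [apply: le_trans (H1 q qM) _|apply: le_trans (H2 q qM) _
  |apply: le_trans (H3 q qM) _|apply: le_trans (H4 q qM) _]; clear -A10 A20 A30 A40; lra.
Qed.

Lemma grad0_cst_ball f p (r : R) :
  (forall q, `|q - p| < r -> grad_at f q 0 0) -> forall q, `|q - p| < r -> f q = f p.
Proof.
move=> H q qr.
have := @segment_mvt f p (q - p).
rewrite subrK => -[s /andP[s0 s1]|s /andP[s0 s1] e].
  apply: (@grad_at_differentiable _ _ _ 0 0); apply: H.
  by rewrite addrK normrZ ger0_norm// (le_lt_trans _ qr)// ler_piMl.
have G : grad_at f (s *: (q - p) + p) 0 0.
  by apply: H; rewrite addrK normrZ ger0_norm// (le_lt_trans _ qr)// ler_piMl.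
by apply/eqP; rewrite -subr_eq0 e (grad_at_dx G) (grad_at_dy G) !mulr0 addr0.
Qed.

(* Both mixed derivatives are the limit of the second difference of f over h^2;
   Young's argument needs only the differentiability of the first derivatives. *)
Lemma second_difference f p : (forall q, differentiable f q) -> differentiable (dx f) p ->
  forall e, 0 < e -> \forall t \near (0 : R)^'+,
  `|f (p.1 + t, p.2 + t) - f (p.1 + t, p.2) - f (p.1, p.2 + t) + f (p.1, p.2)
    - t ^+ 2 * dy (dx f) p| <= e * t ^+ 2.
Proof.
move=> sf sfx e e0.
have /grad_at_epsP H := grad_at_diff sfx.
have e20 : 0 < e / 2 by rewrite divr_gt0.
have /nbhs_normP[r /= r0 Hr] := H _ e20.
near=> t.
have t0 : 0 < t by near: t; exact: nbhs_right_gt.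
have tr : t < r by near: t; exact: nbhs_right_lt.
pose g (x : R) := f (x, p.2 + t) - f (x, p.2).
pose dg (x : R) := dx f (x, p.2 + t) - dx f (x, p.2).
have Dg (x : R) : is_derive x 1 g (dg x).
  have D (y : R) : is_derive x 1 (fun x => f (x, y)) (dx f (x, y)).
    apply: is_derive_eq (grad_at_path (grad_at_diff (sf (x, y))) (is_derive_id x (1 : R))
      (is_derive_cst y x (1 : R))) _.
    by rewrite mul1r mul0r addr0.
  exact: is_deriveB (D _) (D _).
have [||c] := @MVT_segment _ g dg p.1 (p.1 + t).
- by rewrite lerDl ltW.
- by apply: derivable_within_continuous => x _; exact: (@ex_derive _ _ _ _ _ _ _ (Dg x)).
rewrite in_itv /= => /andP[c1 c2]; rewrite (_ : p.1 + t - p.1 = t); last by ring.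
move=> E.
have -> : f (p.1 + t, p.2 + t) - f (p.1 + t, p.2) - f (p.1, p.2 + t) + f (p.1, p.2) = dg c * t.
  by rewrite -E /g; ring.
have B (s : R) : 0 <= s <= t -> `|dx f (c, p.2 + s) - dx f p - linform (dx (dx f) p) (dy (dx f) p) (c - p.1, s)|
    <= e / 2 * t.
  move=> /andP[s0 st].
  have nt : `|(c - p.1, s)| <= t.
    by rewrite prod_normE /= ge_max (ger0_norm s0) st ger0_norm ?subr_ge0// lerBlDl c2.
  have := Hr (c - p.1, s); rewrite /= sub0r normrN => /(_ (le_lt_trans nt tr)).
  rewrite (_ : (c - p.1, s) + p = (c, p.2 + s)); last first.
    by case: (p) => p1 p2; congr pair; rewrite /= ?subrK// addrC.
  move=> /le_trans; apply; rewrite ler_wpM2l// ltW//.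
have tt : 0 <= t <= t by apply/andP; split => //; exact: ltW.
have t00 : 0 <= (0 : R) <= t by apply/andP; split => //; exact: ltW.
have := B t tt; have := B 0 t00; rewrite /linform /= addr0 mul0r addr0.
rewrite (_ : dg c * t - _ = t * ((dx f (c, p.2 + t) - dx f p - ((c - p.1) * dx (dx f) p + t * dy (dx f) p))
  - (dx f (c, p.2) - dx f p - (c - p.1) * dx (dx f) p))); last by rewrite /dg; ring.
move=> B1 B2; rewrite normrM (gtr0_norm t0) expr2 (mulrC e) -mulrA ler_pM2l// mulrC.
by apply: le_trans (ler_normB _ _) _; lra.
Unshelve. all: by end_near. Qed.

Lemma grad_at_swap f p (a b : R) : grad_at f (p.2, p.1) a b ->
  grad_at (fun q => f (q.2, q.1)) p b a.
Proof.
move=> /grad_at_epsP H; apply/grad_at_epsP => e e0.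
have /nbhs_normP[r r0 Hr] := H e e0; apply/nbhs_normP; exists r => // h /=.
have ns : `|(h.2, h.1)| = `|h| by rewrite !prod_normE /= maxC.
rewrite sub0r normrN -ns => hr.
have := Hr (h.2, h.1); rewrite /= sub0r normrN => /(_ hr).
by rewrite /linform /= [h.2 * a + _]addrC.
Qed.

(** Exchanging the coordinates preserves the second difference but swaps the two mixed derivatives,
    so [second_difference], applied to f and to its transpose, exhibits both as the same limit. *)
Lemma clairaut f p : smooth_on setT f -> dx (dy f) p = dy (dx f) p.
Proof.
move=> sf.
pose fs q := f (q.2, q.1).
have G q : grad_at fs q (dy f (q.2, q.1)) (dx f (q.2, q.1)).
  by apply: grad_at_swap; exact: smooth_grad sf I.
have dfs : dx fs = fun q => dy f (q.2, q.1) by apply/funext => q; exact: grad_at_dx (G q).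
have Gy : grad_at (dx fs) (p.2, p.1) (dy (dy f) p) (dx (dy f) p).
  rewrite dfs; apply: grad_at_swap; case: p => p1 p2 /=.
  exact: smooth_grad (smooth_dy sf) I.
have H1 := @second_difference f p (fun q => sf [::] q I) (smooth_dx sf [::] I).
have H2 := @second_difference fs (p.2, p.1) (fun q => grad_at_differentiable (G q))
  (grad_at_differentiable Gy).
apply/eqP; rewrite -subr_eq0 -normr_le0; apply/ler_addgt0Pl => e e0; rewrite addr0.
have e20 : 0 < e / 2 by rewrite divr_gt0.
have {}H1 := H1 _ e20; have {}H2 := H2 _ e20; rewrite (grad_at_dy Gy) /fs /= in H2.
clear G dfs Gy fs.
have [t [t0 [B1 B2]]] := filter_ex (filterI (nbhs_right_gt (0 : R)) (filterI H1 H2)).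
have t20 : 0 < t ^+ 2 by rewrite exprn_gt0.
rewrite -(ler_pM2r t20) -{1}(gtr0_norm t20) -normrM.
rewrite [X in `|X|](_ : _ = (f (p.1 + t, p.2 + t) - f (p.1 + t, p.2) - f (p.1, p.2 + t) + f (p.1, p.2)
    - t ^+ 2 * dy (dx f) p) - (f (p.1 + t, p.2 + t) - f (p.1, p.2 + t) - f (p.1 + t, p.2) + f (p.1, p.2)
    - t ^+ 2 * dx (dy f) p)); last by ring.
apply: le_trans (ler_normB _ _) _; apply: le_trans (lerD B1 B2) _.
by rewrite -mulrDl -splitr.
Qed.

End PlaneCalculus.

(** * Convolution with a smooth kernel *)

(* The Borel structure carried by the domain of area; the one inferred for the
   bare type R * R has the same sets but a different display. *)
Notation plane R := (measurableTypeR R * measurableTypeR R)%type.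

Section PlaneMeasurability.
Context {R : realType}.

Lemma plane_open_measurable (U : set (R * R)) : open U -> @measurable _ (plane R) U.
Proof.
move=> oU.
pose Q := (rat * rat * rat * rat)%type.
pose box (q : Q) : set (R * R) :=
  `]ratr q.1.1.1, ratr q.1.1.2[%classic `*` `]ratr q.1.2, ratr q.2[%classic.
(* Boxes not contained in [U] are replaced by the empty set, so that the union runs over the
   countable type of all rational quadruples. *)
pose F (q : Q) := if `[< box q `<=` U >] then box q else set0.
have -> : U = \bigcup_q F q.
  apply/seteqP; split=> [p Up|p [q _]]; last first.
    by rewrite /F; case: asboolP => // bU /bU.
  have /nbhs_normP[r /= r0 Hr] := open_nbhs_nbhs (conj oU Up).
  have near_rat (x : R) : exists q1 q2 : rat, [/\ ratr q1 < x, x < ratr q2, x - r < ratr q1 & ratr q2 < x + r].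
    have [q1 /itvP E1] := @rat_in_itvoo R (x - r) x ltac:(by rewrite ltrBlDr ltrDl).
    have [q2 /itvP E2] := @rat_in_itvoo R x (x + r) ltac:(by rewrite ltrDl).
    by exists q1, q2; rewrite !E1 !E2.
  have [a1 [a2 [h1 h2 h3 h4]]] := near_rat p.1.
  have [b1 [b2 [g1 g2 g3 g4]]] := near_rat p.2.
  exists (a1, a2, b1, b2) => //; rewrite /F ifT.
    by split=> /=; rewrite in_itv /= ?h1 ?h2 ?g1 ?g2.
  apply/asboolP => -[x y] [/=]; rewrite !in_itv /= => /andP[x1 x2] /andP[y1 y2].
  apply: Hr; rewrite /= prod_normE /= gt_max !ltr_distl; apply/andP; split; lra.
apply: countable_bigcupT_measurable => [|q]; first exact: (@countableP (rat * rat * rat * rat)%type).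
rewrite /F; case: asboolP => _ //.
by apply: measurableX; exact: measurable_itv.
Qed.

Lemma plane_closed_measurable (A : set (R * R)) : closed A -> @measurable _ (plane R) A.
Proof. by move=> cA; rewrite -[A]setCK; apply: measurableC; apply: plane_open_measurable; exact: closed_openC. Qed.

Lemma plane_continuous_measurable (U : set (R * R)) (f : R * R -> R) :
  open U -> (forall p, U p -> {for p, continuous f}) -> measurable_fun U (f : plane R -> R).
Proof.
move=> oU cf; apply: (measurability _ (RGenOInfty.measurableE R)) => _ [_ [a ->] <-].
apply: plane_open_measurable; rewrite openE => p [Up /=]; rewrite in_itv /= andbT => afp.
apply: filterI; first exact: open_nbhs_nbhs.
have := cf p Up (`]a, +oo[%classic); apply.
by apply: open_nbhs_nbhs; split; [exact: rray_open|rewrite /= in_itv /= andbT].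
Qed.

Lemma smooth_measurable (f : R * R -> R) : smooth_on setT f -> measurable_fun setT (f : plane R -> R).
Proof.
move=> sf; apply: plane_continuous_measurable => [|p _]; first exact: openT.
exact: smooth_continuous sf I.
Qed.

Lemma bounded_byP (T : Type) (D : set T) (f : T -> R) (M : R) :
  (forall x, D x -> `|f x| <= M) -> [bounded f x | x in D].
Proof.
move=> H; exists M; split=> [|N MN x Dx]; first exact: num_real.
by apply: le_trans (H x Dx) _; exact: ltW.
Qed.

End PlaneMeasurability.

Section KernelIntegral.
Context d (T : measurableType d) {R : realType} (mu : {measure set T -> \bar R}).
Variables (D : set T) (Z : T -> R * R) (M : R) (k : T -> R).
Hypotheses (mD : measurable D) (mZ : measurable_fun D (Z : T -> plane R)).
Hypotheses (ZM : forall t, D t -> `|Z t| <= M) (ik : mu.-integrable D (EFin \o k)).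
Implicit Types (K : R * R -> R) (c h : R * R).

(** The parameter space is either the plane with [Z] the identity, which gives a convolution, or the
    interval [0, 1] with [Z] a curve, which gives a smoothed line integral. One differentiation rule
    serves both. *)
Definition kconv K c : R := \int[mu]_(t in D) (K (Z t - c) * k t).

Lemma integrable_mul_bounded (f : T -> R) (A : R) : measurable_fun D f ->
  (forall t, D t -> `|f t| <= A) -> mu.-integrable D (EFin \o (fun t => f t * k t)).
Proof.
move=> mf fA.
have := integrableMr mD mf (bounded_byP fA) ik.
by apply: eq_integrable => // t _ /=; rewrite EFinM.
Qed.

Lemma kconv_integrable K c : smooth_on setT K ->
  mu.-integrable D (EFin \o (fun t => K (Z t - c) * k t)).
Proof.
move=> sK; have [A A0 KA] := smooth_bounded (M + `|c|) sK.
apply: (@integrable_mul_bounded _ A).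
  exact: (measurableT_comp (smooth_measurable (smooth_shift c sK)) mZ).
by move=> t Dt; apply: KA; apply: le_trans (ler_normB _ _) _; rewrite lerD2r ZM.
Qed.

(** Since [Z] is bounded, the second-order Taylor remainder of K is uniform in t and integrates
    against |k| to a multiple of |h|^2. The signs come from the argument Z - c. *)
Lemma grad_kconv K c : smooth_on setT K ->
  grad_at (kconv K) c (- kconv (dx K) c) (- kconv (dy K) c).
Proof.
move=> sK; apply/grad_at_epsP => e e0.
(* This radius covers Z t - c as well as Z t - (h + c) for |h| <= 1. *)
have [A A0 KA] := smooth_taylor (M + `|c| + 1) sK.
pose I := \int[mu]_(t in D) `|k t|.
have I0 : 0 <= I by apply: Rintegral_ge0 => t _; exact: normr_ge0.
have IA0 : 0 < A * I + 1 by rewrite ltr_wpDl// mulr_ge0.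
have sKx := smooth_dx sK; have sKy := smooth_dy sK.
have Hh h : `|h| <= 1 -> `|kconv K (h + c) - kconv K c - linform (- kconv (dx K) c) (- kconv (dy K) c) h|
    <= A * I * `|h| ^+ 2.
  move=> h1.
  have i1 := @kconv_integrable _ (h + c) sK; have i2 := @kconv_integrable _ c sK.
  have i3 := @kconv_integrable _ c sKx; have i4 := @kconv_integrable _ c sKy.
  have j3 : mu.-integrable D (EFin \o (fun t => h.1 * (dx K (Z t - c) * k t))).
    by apply: eq_integrable (integrableZl mD h.1 i3).
  have j4 : mu.-integrable D (EFin \o (fun t => h.2 * (dy K (Z t - c) * k t))).
    by apply: eq_integrable (integrableZl mD h.2 i4).
  have j5 : mu.-integrable D (EFin \o (fun t => K (Z t - (h + c)) * k t - K (Z t - c) * k t)).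
    by apply: eq_integrable (integrableB mD i1 i2).
  have j6 : mu.-integrable D (EFin \o (fun t => h.1 * (dx K (Z t - c) * k t) + h.2 * (dy K (Z t - c) * k t))).
    by apply: eq_integrable (integrableD mD j3 j4).
  have -> : kconv K (h + c) - kconv K c - linform (- kconv (dx K) c) (- kconv (dy K) c) h =
    \int[mu]_(t in D) (K (Z t - (h + c)) * k t - K (Z t - c) * k t +
       (h.1 * (dx K (Z t - c) * k t) + h.2 * (dy K (Z t - c) * k t))).
    rewrite (RintegralD mD j5 j6) (RintegralB mD i1 i2) (RintegralD mD j3 j4).
    have e3 : \int[mu]_(t in D) (h.1 * (dx K (Z t - c) * k t)) = h.1 * kconv (dx K) c := RintegralZl h.1 mD i3.
    have e4 : \int[mu]_(t in D) (h.2 * (dy K (Z t - c) * k t)) = h.2 * kconv (dy K) c := RintegralZl h.2 mD i4.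
    rewrite e3 e4 -/(kconv K (h + c)) -/(kconv K c) /linform.
    by move: (kconv _ _) (kconv _ _) (kconv _ _) (kconv _ _) => ? ? ? ?; ring.
  have j7 : mu.-integrable D (EFin \o (fun t => K (Z t - (h + c)) * k t - K (Z t - c) * k t +
       (h.1 * (dx K (Z t - c) * k t) + h.2 * (dy K (Z t - c) * k t)))).
    by apply: eq_integrable (integrableD mD j5 j6).
  have ink : mu.-integrable D (EFin \o (fun t => `|k t|)) by exact: integrable_norm.
  apply: le_trans (le_normr_Rintegral mD j7) _.
  rewrite mulrAC -(RintegralZl _ mD ink).
  apply: le_Rintegral => //.
  - exact: integrable_norm.
  - by apply: eq_integrable (integrableZl mD (A * `|h| ^+ 2) ink).
  - move=> t Dt.
    have -> : K (Z t - (h + c)) * k t - K (Z t - c) * k t +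
       (h.1 * (dx K (Z t - c) * k t) + h.2 * (dy K (Z t - c) * k t)) =
      (K (- h + (Z t - c)) - K (Z t - c) - linform (dx K (Z t - c)) (dy K (Z t - c)) (- h)) * k t.
      have -> : Z t - (h + c) = - h + (Z t - c) by rewrite opprD addrCA.
      rewrite /linform /=; ring.
    rewrite normrM ler_wpM2r//.
    have n1 : `|Z t - c| <= M + `|c| by apply: le_trans (ler_normB _ _) _; rewrite lerD2r ZM.
    have -> : `|h| = `|- h| by rewrite normrN.
    apply: KA; first by apply: le_trans n1 _; rewrite lerDl.
    by apply: le_trans (ler_normD _ _) _; rewrite normrN addrC lerD.
near=> h; have [h1 h2] : `|h| <= 1 /\ `|h| <= e / (A * I + 1).
  by split; near: h; apply: (@nbhs0_le R (R * R)%type) => //; rewrite divr_gt0.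
apply: le_trans (Hh h h1) _; rewrite expr2 mulrA ler_wpM2r//.
apply: (@le_trans _ _ ((A * I + 1) * `|h|)); first by rewrite ler_wpM2r// lerDl.
by rewrite mulrC -ler_pdivlMr.
Unshelve. all: by end_near. Qed.

Lemma smooth_partials s K : smooth_on setT K -> smooth_on setT (partials s K).
Proof. by move=> sK; elim: s => [//|[] s IH] /=; [exact: smooth_dx|exact: smooth_dy]. Qed.

(** A partial derivative of the convolution is, up to sign, the convolution with a partial
    derivative of the kernel; the sign records the order. *)
Lemma smooth_kconv K : smooth_on setT K -> smooth_on setT (kconv K).
Proof.
move=> sK.
have G s c : grad_at (fun c => (-1) ^+ size s * kconv (partials s K) c) c
   ((-1) ^+ (size s).+1 * kconv (dx (partials s K)) c)
   ((-1) ^+ (size s).+1 * kconv (dy (partials s K)) c).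
  apply: grad_at_eq (grad_atM (grad_at_cst ((-1) ^+ size s) c)
    (grad_kconv c (smooth_partials s sK))) _ _; rewrite exprS; ring.
suff E s : partials s (kconv K) = fun c => (-1) ^+ size s * kconv (partials s K) c.
  by move=> s c _; rewrite E; exact: grad_at_differentiable (G s c).
elim: s => [|b s IH]; first by apply/funext => c; rewrite /= expr0 mul1r.
by apply/funext => c; case: b; rewrite /= IH ?(grad_at_dx (G s c)) ?(grad_at_dy (G s c)).
Qed.

End KernelIntegral.

(** * Integrals of compactly supported functions *)

Section SupportIntegral.
Context d (T : measurableType d) {R : realType} (mu : {measure set T -> \bar R}).

Lemma Rintegral_support (D : set T) (f : T -> R) : (forall x, ~ D x -> f x = 0) ->
  \int[mu]_(x in D) f x = \int[mu]_x f x.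
Proof.
move=> f0; rewrite Rintegral_mkcond; congr (Rintegral _ _ _); apply/funext => x.
by rewrite patchE; case: ifPn => // /negP xD; rewrite f0// => Dx; apply: xD; rewrite inE.
Qed.

Lemma integrable_support (D : set T) (f : T -> R) : measurable D ->
  (forall x, ~ D x -> f x = 0) -> mu.-integrable D (EFin \o f) ->
  mu.-integrable setT (EFin \o f).
Proof.
move=> mD f0 /(integrable_mkcond _ mD); congr (is_true (_.-integrable _ _)).
apply/funext => x; rewrite patchE /=; case: ifPn => // /negP xD.
by rewrite f0// => Dx; apply: xD; rewrite inE.
Qed.

Lemma integrable_EFinD (D : set T) (f g : T -> R) : measurable D ->
  mu.-integrable D (EFin \o f) -> mu.-integrable D (EFin \o g) ->
  mu.-integrable D (EFin \o (fun x => f x + g x)).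
Proof. by move=> mD i j; apply: eq_integrable (integrableD mD i j). Qed.

Lemma integrable_EFinB (D : set T) (f g : T -> R) : measurable D ->
  mu.-integrable D (EFin \o f) -> mu.-integrable D (EFin \o g) ->
  mu.-integrable D (EFin \o (fun x => f x - g x)).
Proof. by move=> mD i j; apply: eq_integrable (integrableB mD i j). Qed.

Lemma integrable_EFinZ (D : set T) (c : R) (f : T -> R) : measurable D ->
  mu.-integrable D (EFin \o f) -> mu.-integrable D (EFin \o (fun x => c * f x)).
Proof. by move=> mD i; apply: eq_integrable (integrableZl mD c i). Qed.

End SupportIntegral.

Section CompactSupport.
Context {R : realType}.
Implicit Types (f phi : R * R -> R) (M : R) (p c : R * R).
Notation leb := (@lebesgue_measure R).

Lemma area_ball_fin M : (area [set p : R * R | (`|p| <= M)%R] < +oo)%E.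
Proof.
rewrite (_ : mkset _ = `[- M, M]%classic `*` `[- M, M]%classic).
  rewrite product_measure1E; [|exact: measurable_itv..].
  suff F : leb `[- M, M]%classic \is a fin_num by rewrite ltey_eq fin_numM.
  by rewrite lebesgue_measure_itv /=; case: ifP.
apply/seteqP; split => -[x y] /=; rewrite prod_normE /= ge_max !in_itv /= !ler_norml.
  by case/andP.
by case=> -> ->.
Qed.

Lemma ball_measurable M : @measurable _ (plane R) [set p : R * R | `|p| <= M].
Proof.
apply: plane_closed_measurable; apply: compact_closed; last exact: compact_ball.
exact: norm_hausdorff.
Qed.

Lemma bounded_integrable (D : set (R * R)) f (M A : R) : @measurable _ (plane R) D ->
  (forall p, D p -> `|p| <= M) -> measurable_fun D (f : plane R -> R) -> (forall p, D p -> `|f p| <= A) ->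
  area.-integrable D (EFin \o f).
Proof.
move=> mD DM mf fA; apply: measurable_bounded_integrable => //.
  apply: le_lt_trans (area_ball_fin M); apply: le_measure; rewrite ?inE//; last exact: ball_measurable.
exact: bounded_byP fA.
Qed.

Lemma csupp_integrable f M : (forall p, {for p, continuous f}) -> (forall p, M < `|p| -> f p = 0) ->
  area.-integrable setT (EFin \o f).
Proof.
move=> cf f0; have mB := ball_measurable M.
apply: (integrable_support mB); first by move=> p /negP; rewrite -ltNge; exact: f0.
have [A A0 fA] := @continuous_bounded _ f _ (@compact_ball _ M) (fun p _ => cf p).
apply: (bounded_integrable (M := M) (A := A)) => //.
by apply: measurable_funTS; apply: plane_continuous_measurable => //; exact: openT.
Qed.

Lemma int_deriv_csupp (g g' : R -> R) M : (forall x : R, is_derive x 1 g (g' x)) ->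
  continuous g' -> (forall x, M < `|x| -> g x = 0) ->
  (\int[leb]_x (g' x)%:E = 0)%E.
Proof.
move=> Dg cg' g0.
have g'0 x : M < `|x| -> g' x = 0.
  move=> Mx; have D0 : is_derive x 1 g 0.
    apply: (@near_eq_is_derive _ _ _ (fun=> 0 : R)).
    have H : (fun y : R => `|y|) @ x --> `|x| by apply: cvg_norm; exact: cvg_id.
    by apply: filterS (cvgr_gt _ H _ Mx) => y /g0 ->.
  by have [_ <-] := Dg x; have [_ ->] := D0.
(* [M] may be negative; N is positive and lies beyond [M] in any case. *)
pose N := `|M| + 1.
have MN : M < N by rewrite (le_lt_trans (ler_norm M))// ltrDl.
have N0 : 0 < N by rewrite ltr_wpDl.
have -> : (\int[leb]_x (g' x)%:E = \int[leb]_(x in `[(- N)%R, N]) (g' x)%:E)%E.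
  rewrite [RHS]integral_mkcond; apply: eq_integral => x _; rewrite patchE.
  case: ifPn => // /negP xN; rewrite g'0// ltNge; apply/negP => xM; apply: xN.
  by rewrite inE /= in_itv /= -ler_norml (le_trans xM)// ltW.
have cg : continuous g.
  by move=> x; apply: differentiable_continuous; apply/derivable1_diffP; case: (Dg x).
rewrite (@continuous_FTC2 _ g' g); last 4 first.
- by rewrite gtrN.
- by apply: continuous_subspaceT.
- split; first by move=> x _; case: (Dg x).
    by apply: cvg_at_right_filter; exact: cg.
  by apply: cvg_at_left_filter; exact: cg.
- by move=> x _; rewrite derive1E; case: (Dg x).
by rewrite !g0 ?normrN ?gtr0_norm// subee.
Qed.

Lemma csupp_dx0 phi M p : smooth_on setT phi -> (forall p, M < `|p| -> phi p = 0) ->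
  M < `|p| -> grad_at phi p 0 0.
Proof.
move=> sphi phi0 Mp; apply: (@grad_at_near _ (fun=> 0)); last exact: grad_at_cst.
have H : (fun y : R * R => `|y|) @ p --> `|p| by apply: cvg_norm; exact: cvg_id.
by apply: filterS (cvgr_gt _ H _ Mp) => q /phi0 ->.
Qed.

Lemma smooth_continuousT phi p : smooth_on setT phi -> {for p, continuous phi}.
Proof. by move=> s; exact: smooth_continuous s I. Qed.

Lemma is_derive_line1 f (x y : R) : smooth_on setT f ->
  is_derive x 1 (fun x => f (x, y)) (dx f (x, y)).
Proof.
move=> sf; apply: is_derive_eq (grad_at_path (smooth_grad sf (I : setT (x, y)))
  (is_derive_id x (1 : R)) (is_derive_cst y x (1 : R))) _.
by rewrite mul1r mul0r addr0.
Qed.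

Lemma is_derive_line2 f (x y : R) : smooth_on setT f ->
  is_derive y 1 (fun y => f (x, y)) (dy f (x, y)).
Proof.
move=> sf; apply: is_derive_eq (grad_at_path (smooth_grad sf (I : setT (x, y)))
  (is_derive_cst x y (1 : R)) (is_derive_id y (1 : R))) _.
by rewrite mul1r mul0r add0r.
Qed.

Lemma is_derive_continuous (g : R -> R) (x a : R) : is_derive x 1 g a -> {for x, continuous g}.
Proof. by move=> [Dg _]; apply: differentiable_continuous; exact/derivable1_diffP. Qed.

Lemma int_dx0 phi M : smooth_on setT phi -> (forall p, M < `|p| -> phi p = 0) ->
  area.-integrable setT (EFin \o dx phi) /\ \int[area]_p dx phi p = 0.
Proof.
move=> sphi phi0; have sx := smooth_dx sphi.
have ix : area.-integrable setT (EFin \o dx phi).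
  apply: (@csupp_integrable _ M) => p; first exact: smooth_continuousT.
  by move=> Mp; exact: grad_at_dx (csupp_dx0 sphi phi0 Mp).
split=> //; rewrite /Rintegral -(integral21_prod_meas1 ix).
rewrite integral0_eq// => y _.
apply: (@int_deriv_csupp (fun x => phi (x, y)) _ M) => x.
- exact: is_derive_line1.
- exact: is_derive_continuous (is_derive_line1 x y sx).
- by move=> Mx; apply: phi0; apply: lt_le_trans Mx _; exact: (norm_fst (x, y)).
Qed.

Lemma int_dy0 phi M : smooth_on setT phi -> (forall p, M < `|p| -> phi p = 0) ->
  area.-integrable setT (EFin \o dy phi) /\ \int[area]_p dy phi p = 0.
Proof.
move=> sphi phi0; have sy := smooth_dy sphi.
have iy : area.-integrable setT (EFin \o dy phi).
  apply: (@csupp_integrable _ M) => p; first exact: smooth_continuousT.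
  by move=> Mp; exact: grad_at_dy (csupp_dx0 sphi phi0 Mp).
split=> //; rewrite /Rintegral -(integral12_prod_meas1 iy).
rewrite integral0_eq// => x _.
apply: (@int_deriv_csupp (fun y => phi (x, y)) _ M) => y.
- exact: is_derive_line2.
- exact: is_derive_continuous (is_derive_line2 x y sy).
- by move=> My; apply: phi0; apply: lt_le_trans My _; exact: (norm_snd (x, y)).
Qed.

End CompactSupport.

(** * Orthogonal projection *)

Section PreHilbert.
Context {R : realType} {V : lmodType R} (E : set V) (ip : V -> V -> R).
Hypothesis E_lin : forall a u v, E u -> E v -> E (a *: u + v).
Hypothesis ip_lin : forall a u v w, E u -> E v -> E w -> ip (a *: u + v) w = a * ip u w + ip v w.
Hypothesis ip_sym : forall u v, ip u v = ip v u.
Hypothesis ip_ge0 : forall u, 0 <= ip u u.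

Lemma quadratic_ge0 (a b c : R) : 0 <= c -> (forall t, 0 <= a + 2 * t * b + t ^+ 2 * c) ->
  b ^+ 2 <= a * c.
Proof.
move=> c0 H; have [c0'|c1] := eqVneq c 0.
  have [->|b0] := eqVneq b 0; first by rewrite c0' mulr0 expr0n.
  (* For c = 0 the trinomial is affine in t and takes the value -1 here. *)
  have := H (- (a + 1) / (2 * b)).
  rewrite c0' mulr0 addr0 (_ : 2 * _ * b = - (a + 1)); last by field.
  by rewrite opprD addrA subrr sub0r oppr_ge0 ler10.
have cp : 0 < c by rewrite lt_neqAle eq_sym c1.
have := H (- b / c).
rewrite (_ : a + _ + _ = (a * c - b ^+ 2) / c); last by field.
by rewrite pmulr_lge0 ?invr_gt0// subr_ge0.
Qed.

Lemma E_sub u v : E u -> E v -> E (u - v).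
Proof. by move=> Eu Ev; rewrite addrC -scaleN1r; exact: E_lin. Qed.

Lemma ip_linr a u v w : E u -> E v -> E w -> ip w (a *: u + v) = a * ip w u + ip w v.
Proof. by move=> *; rewrite ip_sym ip_lin// !(ip_sym _ w). Qed.

Lemma ip_quad a u v : E u -> E v ->
  ip (a *: u + v) (a *: u + v) = ip v v + 2 * a * ip v u + a ^+ 2 * ip u u.
Proof.
move=> Eu Ev; have Ew := E_lin a Eu Ev.
rewrite ip_lin// !ip_linr// (ip_sym u v); ring.
Qed.

Lemma ip_subl u v w : E u -> E v -> E w -> ip (u - v) w = ip u w - ip v w.
Proof.
move=> Eu Ev Ew; rewrite (_ : u - v = (-1) *: v + u); last by rewrite scaleN1r addrC.
rewrite ip_lin//; ring.
Qed.

Lemma cauchy_schwarz u v : E u -> E v -> ip u v ^+ 2 <= ip u u * ip v v.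
Proof. by move=> Eu Ev; apply: quadratic_ge0 => // t; rewrite -ip_quad. Qed.

Lemma parallelogram u v w : E u -> E v -> E w ->
  ip (u - v) (u - v) = 2 * ip (w - u) (w - u) + 2 * ip (w - v) (w - v)
   - 4 * ip (w - (2^-1 *: u + 2^-1 *: v)) (w - (2^-1 *: u + 2^-1 *: v)).
Proof.
move=> Eu Ev Ew.
have Ewu := E_sub Ew Eu; have Ewv := E_sub Ew Ev.
rewrite (_ : u - v = (-1) *: (w - u) + (w - v)); last first.
  by rewrite scaleN1r opprB addrA subrK.
have E0 : E 0 by rewrite -(subrr u); exact: E_sub.
have Eh : E (2^-1 *: (w - u)) by rewrite -[X in E X]addr0; exact: E_lin.
have Eh' : E (2^-1 *: (w - v)) by rewrite -[X in E X]addr0; exact: E_lin.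
have ip0 x : E x -> ip 0 x = 0.
  by move=> Ex; have := ip_lin 1 E0 E0 Ex; rewrite scaler0 addr0 mul1r => /eqP; rewrite -subr_eq subrr eq_sym => /eqP.
have ipZ a x y : E x -> E y -> ip (a *: x) y = a * ip x y.
  by move=> Ex Ey; rewrite -[a *: x]addr0 ip_lin// ip0// addr0.
rewrite (_ : w - (2^-1 *: u + 2^-1 *: v) = 2^-1 *: (w - u) + 2^-1 *: (w - v)); last first.
  rewrite !scalerBr addrACA -opprD -scalerDl (_ : 2^-1 + 2^-1 = 1) ?scale1r//.
  by field.
rewrite !ip_quad// (ipZ _ _ (w - u))// (ipZ _ _ (2^-1 *: _))// (ip_sym _ (2^-1 *: (w - v))) ipZ//.
by field.
Qed.

Hypothesis ip_complete : forall u : nat -> V, (forall n, E (u n)) ->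
  (forall k m n, (k <= m)%N -> (k <= n)%N -> ip (u m - u n) (u m - u n) <= 4^-1 ^+ k) ->
  exists2 l, E l & forall e, 0 < e -> exists N, forall n, (N <= n)%N -> ip (u n - l) (u n - l) < e.

(** [S] need not be closed, so the projection of v may fall outside it; what exists is the remainder
    h, the limit of v - s_n along a minimizing sequence. The parallelogram law makes this sequence
    Cauchy, and minimality against every s_n - t s forces h to be orthogonal to s. As [ip] is only
    semidefinite, closeness is measured through [ip] alone. *)
Lemma orthogonal_remainder (S : set V) v : S `<=` E -> S 0 ->
  (forall a u u', S u -> S u' -> S (a *: u + u')) -> E v ->
  exists h, [/\ E h, forall s, S s -> ip h s = 0 &
    forall e, 0 < e -> exists2 s, S s & ip (v - s - h) (v - s - h) < e].
Proof.
move=> SE S0 Slin Ev.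
pose q u := ip u u.
pose Q := [set q (v - s) | s in S].
have Q0 : has_inf Q.
  split; first by exists (q (v - 0)); exists 0.
  by exists 0 => _ [s _ <-]; exact: ip_ge0.
pose dd := inf Q.
have dle s : S s -> dd <= q (v - s) by move=> Ss; apply: ge_inf; [case: Q0|exists s].
(* The exponent is shifted because the parallelogram law yields at most 2 ep n + 2 ep m, which has
   to stay below 4 ep k = 4^(-k). *)
pose ep (n : nat) : R := 4^-1 ^+ n.+1.
have ep0 n : 0 < ep n by rewrite exprn_gt0.
have ep_le m n : (m <= n)%N -> ep n <= ep m.
  by move=> mn; rewrite ler_wiXn2l// ?invf_le1 ?ler1n//; lra.
have /choice[sg Hsg] : forall n : nat, exists s, S s /\ q (v - s) < dd + ep n.
  by move=> n; have [_ [s Ss <-] h] := inf_adherent (ep0 n) Q0; exists s.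
have Ssg n : S (sg n) by case: (Hsg n).
have qsg n : q (v - sg n) < dd + ep n by case: (Hsg n).
pose x n := v - sg n.
have Ex n : E (x n) by apply: E_sub => //; exact: SE.
have small e : 0 < e -> exists N, forall n, (N <= n)%N -> ep n < e.
  move=> e0; have [N] := ltr_add_invr (y := 0) (x := e) e0; rewrite add0r => HN.
  exists N => n Nn; apply: le_lt_trans HN; apply: le_trans (ep_le _ _ Nn) _.
  rewrite /ep exprVn lef_pV2 ?posrE ?ltr0n ?exprn_gt0//.
  by rewrite -natrX ler_nat ltnW// ltn_expl.
have [|h Eh xh] := @ip_complete x Ex.
  move=> k m n km kn.
  have Em := Ex m; have En := Ex n.
  rewrite (_ : x m - x n = sg n - sg m); last by rewrite /x opprB addrC addrA subrK.
  rewrite (@parallelogram (sg n) (sg m) v) //; [|exact: SE..].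
  have Sav : S (2^-1 *: sg n + 2^-1 *: sg m).
    have Sm : S (2^-1 *: sg m) by rewrite -[_ *: sg m]addr0; exact: (Slin _ _ _ (Ssg m) S0).
    exact: (Slin _ _ _ (Ssg n) Sm).
  have := dle _ Sav; have := qsg n; have := qsg m; have := ep_le _ _ km; have := ep_le _ _ kn.
  have -> : 4^-1 ^+ k = 4 * ep k by rewrite /ep exprS mulrA divff ?mul1r// pnatr_eq0.
  rewrite /q; move: (ep n) (ep m) (ep k) (ip _ _) (ip _ _) (ip _ _) => a b c c1 c2 c3.
  by clear; lra.
exists h; split=> //; last first.
  move=> e e0; have [N HN] := xh e e0; exists (sg N) => //; exact: HN.
move=> s Ss; have Es := SE _ Ss.
(* For every t the vector x_n + t s cannot undercut the infimum, so the trinomial with constant term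
   [ep n], linear term 2 t ip (x_n) s and leading term t^2 q s is nonnegative; its discriminant
   gives the bound. *)
have bound n : ip (x n) s ^+ 2 <= ep n * q s.
  apply: quadratic_ge0 => [|t]; first exact: ip_ge0.
  have Sc : S ((- t) *: s + sg n) by exact: Slin.
  have := dle _ Sc; rewrite (_ : v - _ = t *: s + x n); last first.
    by rewrite /x opprD scaleNr opprK addrCA.
  rewrite /q ip_quad//; have := qsg n; rewrite -/(x n) /q.
  by move: (ep n) (ip _ _) (ip _ _) (ip _ _) => a c1 c2 c3; clear; lra.
apply/eqP; rewrite -sqrf_eq0 eq_le sqr_ge0 andbT; apply/ler_addgt0Pl => e e0; rewrite addr0.
have q0 : 0 <= q s by exact: ip_ge0.
have e4 : 0 < e / (4 * (q s + 1)) by rewrite divr_gt0// mulr_gt0// ltr_wpDl.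
have [N1 HN1] := small _ e4; have [N2 HN2] := xh _ e4.
pose n := maxn N1 N2.
have h1 := HN1 n (leq_maxl _ _); have h2 := HN2 n (leq_maxr _ _).
have Exh : E (x n - h) by exact: E_sub.
have cs := cauchy_schwarz Exh Es; have b1 := bound n.
have eq1 : ip h s = ip (x n) s - ip (x n - h) s by rewrite ip_subl//; ring.
have sq2 (a b : R) : (a - b) ^+ 2 <= 2 * a ^+ 2 + 2 * b ^+ 2.
  by rewrite -subr_ge0 (_ : _ - _ = (a + b) ^+ 2) ?sqr_ge0//; ring.
rewrite eq1; apply: le_trans (sq2 _ _) _.
have k1 : ep n * q s <= e / (4 * (q s + 1)) * q s by rewrite ler_wpM2r// ltW.
have k2 : ip (x n - h) (x n - h) * q s <= e / (4 * (q s + 1)) * q s by rewrite ler_wpM2r// ltW.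
have k3 : e / (4 * (q s + 1)) * q s <= e / 4.
  have qp : 0 < q s + 1 by rewrite ltr_wpDl.
  have qn : q s + 1 != 0 by rewrite gt_eqF.
  rewrite (_ : _ * q s = e / 4 * (q s / (q s + 1))); last by field.
  by rewrite ler_piMr ?divr_ge0 ?(ltW e0)// ler_pdivrMr// mul1r lerDl.
have {}cs := le_trans cs (le_trans k2 k3); have {}b1 := le_trans b1 (le_trans k1 k3).
by move: cs b1; clear; move: (_ ^+ 2) (_ ^+ 2) => a b; lra.
Qed.

End PreHilbert.

(** * The Hilbert space of square integrable forms *)

Section SquareIntegrable.
Context d (T : measurableType d) {R : realType} (mu : {measure set T -> \bar R}) (D : set T).
Hypotheses (mD : measurable D) (fD : (mu D < +oo)%E).
Implicit Types (f g : T -> R) (v w : T -> R * R).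

Definition sqint f : Prop :=
  measurable_fun D f /\ mu.-integrable D (EFin \o (fun x => f x ^+ 2)).

Lemma sqint_mul f g : sqint f -> sqint g -> mu.-integrable D (EFin \o (fun x => f x * g x)).
Proof.
move=> [mf i_f] [mg ig]; have i2 := integrable_EFinD mD i_f ig.
apply: (le_integrable mD _ _ i2); first by apply/measurable_EFinP; exact: measurable_funM.
move=> x Dx /=; rewrite lee_fin normrM [leRHS]ger0_norm ?addr_ge0 ?sqr_ge0//.
rewrite -subr_ge0 -[f x ^+ 2]real_normK ?num_real// -[g x ^+ 2]real_normK ?num_real//.
have := sqr_ge0 (`|f x| - `|g x|); have := sqr_ge0 (`|f x|); have := sqr_ge0 (`|g x|).
by move: `|f x| `|g x| => a b; lra.
Qed.

Lemma sqint_lin (a : R) f g : sqint f -> sqint g -> sqint (fun x => a * f x + g x).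
Proof.
move=> sf sg; have [mf i_f] := sf; have [mg ig] := sg; split.
  by apply: measurable_funD => //; apply: measurable_funM => //; exact: measurable_cst.
have i1 := integrable_EFinZ (a ^+ 2) mD i_f.
have i2 := integrable_EFinZ (2 * a) mD (sqint_mul sf sg).
have := integrable_EFinD mD (integrable_EFinD mD i1 i2) ig.
apply: eq_integrable => // x _ /=; congr EFin; ring.
Qed.

Lemma sqint_cst (c : R) : sqint (fun=> c).
Proof.
split; first exact: measurable_cst.
apply: measurable_bounded_integrable => //.
exact: (bounded_byP (M := `|c ^+ 2|)).
Qed.

Lemma sqint_integrable f : sqint f -> mu.-integrable D (EFin \o f).
Proof.
move=> sf; have := sqint_mul sf (sqint_cst 1).
by apply: eq_integrable => // x _ /=; rewrite mulr1.
Qed.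

Lemma sqint_bounded f (A : R) : measurable_fun D f -> (forall x, D x -> `|f x| <= A) -> sqint f.
Proof.
move=> mf fA; split=> //; apply: measurable_bounded_integrable => //.
  exact: measurable_funX.
apply: (bounded_byP (M := A ^+ 2)) => x Dx.
by rewrite normrX lerXn2r ?nnegrE ?fA// (le_trans _ (fA x Dx)).
Qed.

(** The Riesz-Fischer argument: on a set of finite measure the increments are also small in L^1, so
    their sum is integrable, hence finite almost everywhere, and the telescoping series converges
    absolutely there. *)
Lemma fast_cauchy_ae_cvg (u : nat -> T -> R) : (forall n, sqint (u n)) ->
  (forall k m n, (k <= m)%N -> (k <= n)%N -> \int[mu]_(x in D) (u m x - u n x) ^+ 2 <= 4^-1 ^+ k) ->
  {ae mu, forall x, D x -> cvgn (u ^~ x)}.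
Proof.
move=> su Hu.
pose du n x := `|u n.+1 x - u n x|.
have du0 n x : (0 <= (du n x)%:E)%E by rewrite lee_fin normr_ge0.
have sdu n : sqint (fun x => u n.+1 x - u n x).
  have := sqint_lin (-1) (su n) (su n.+1).
  by congr sqint; apply/funext => x; ring.
have idu n : mu.-integrable D (EFin \o du n) by apply: integrable_norm => //; exact: sqint_integrable.
(* From |a| <= 2^n a^2 / 2 + 2^(-n) / 2, with the integral of a^2 at most 4^(-n), each increment has
   L^1 norm at most (1 + mu D) / 2^(n+1). *)
pose C : R := fine (mu D) + 1.
have C0 : 0 <= C by rewrite addr_ge0// fine_ge0.
have bdu n : \int[mu]_(x in D) du n x <= C / (2 ^ n.+1)%:R.
  have i1 := integrable_EFinZ (2 ^+ n / 2) mD (sdu n).2.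
  have i0 := sqint_integrable (sqint_cst (2^-1 ^+ n / 2)).
  apply: (@le_trans _ _ (\int[mu]_(x in D) (2 ^+ n / 2 * (u n.+1 x - u n x) ^+ 2 + 2^-1 ^+ n / 2))).
    apply: le_Rintegral => //; first exact: integrable_EFinD.
    move=> x _; rewrite /du -[(_ - _) ^+ 2]real_normK ?num_real//.
    move: (`|_ - _|) => a; rewrite -subr_ge0.
    have p0 : 2 ^+ n != 0 :> R by rewrite expf_neq0.
    rewrite (_ : _ - a = 2 ^+ n / 2 * (a - 2^-1 ^+ n) ^+ 2); last by rewrite exprVn; field.
    by rewrite mulr_ge0 ?sqr_ge0// divr_ge0// exprn_ge0.
  rewrite RintegralD// RintegralZl//; last exact: (sdu n).2.
  rewrite Rintegral_cst//.
  have := Hu n n.+1 n (leqnSn n) (leqnn n).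
  move=> H; apply: (@le_trans _ _ (2 ^+ n / 2 * 4^-1 ^+ n + 2^-1 ^+ n / 2 * fine (mu D))).
    by rewrite lerD2r ler_wpM2l// divr_ge0// exprn_ge0.
  have -> : 4^-1 ^+ n = 2^-1 ^+ n * 2^-1 ^+ n :> R.
    by rewrite -exprMn; congr (_ ^+ _); field.
  have p0 : 2 ^+ n != 0 :> R by rewrite expf_neq0.
  rewrite natrX exprS exprVn /C le_eqVlt; apply/orP; left; apply/eqP; by field.
pose g x := (\sum_(k <oo) (du k x)%:E)%E.
have mg : measurable_fun D g.
  apply: ge0_emeasurable_sum => [k x _ _|k _]; first exact: du0.
  by have /integrableP[] := idu k.
have ig : mu.-integrable D g.
  apply/integrableP; split=> //.
  rewrite (eq_integral g); last first.
    by move=> x _; rewrite gee0_abs// nneseries_ge0.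
  rewrite integral_nneseries//; last first.
    by move=> k; have /integrableP[] := idu k.
  apply: (@le_lt_trans _ _ C%:E); last exact: ltry.
  apply: le_trans (epsilon_trick0 xpredT C0).
  apply: lee_nneseries => [k _ _|k _].
    exact: integral_ge0.
  by rewrite -(fineK (integrable_fin_num mD (idu k))) lee_fin bdu.
have := integrable_ae mD ig; apply: filterS => x gx Dx.
have {}gx := gx Dx.
have nc : cvgn [normed series (telescope (u ^~ x))].
  apply: nondecreasing_is_cvgn.
    by apply: nondecreasing_series => k _ _; exact: normr_ge0.
  exists (fine (g x)) => _ [n _ <-].
  rewrite -lee_fin fineK//.
  have := @nneseries_lim_ge R (fun k => (du k x)%:E) xpredT 0 n (fun k _ _ => du0 k x).
  by apply: le_trans; rewrite /series /= -sumEFin.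
have := normed_cvg nc; rewrite telescopeK => c.
have -> : u ^~ x = (fun n => (u n x - u 0%N x) + u 0%N x) by apply/funext => n; rewrite subrK.
by apply: is_cvgD => //; exact: is_cvg_cst.
Qed.

End SquareIntegrable.

Section SquareIntegrableForms.
Context d (T : measurableType d) {R : realType} (mu : {measure set T -> \bar R}) (D : set T).
Hypotheses (mD : measurable D) (fD : (mu D < +oo)%E).
Implicit Types (f g : T -> R) (v w : T -> R * R).

Lemma sqint_sub f g : sqint mu D f -> sqint mu D g -> sqint mu D (fun x => f x - g x).
Proof.
move=> sf sg; have := sqint_lin mD (-1) sg sf.
by congr (sqint _ _ _); apply/funext => x; ring.
Qed.

(** Almost everywhere convergence identifies the limit, and Fatou's lemma in one of the two indices
    carries the Cauchy estimate over to it. *)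
Lemma sqint_complete (u : nat -> T -> R) : (forall n, sqint mu D (u n)) ->
  (forall k m n, (k <= m)%N -> (k <= n)%N -> \int[mu]_(x in D) (u m x - u n x) ^+ 2 <= 4^-1 ^+ k) ->
  exists2 l, sqint mu D l & forall k n, (k <= n)%N -> \int[mu]_(x in D) (u n x - l x) ^+ 2 <= 4^-1 ^+ k.
Proof.
move=> su Hu.
(* An upper limit is measurable on all of D, even where the sequence diverges; almost everywhere it
   is the finite pointwise limit. *)
pose L x : \bar R := limn_esup (fun n => (u n x)%:E).
pose l x := fine (L x).
have mEu n : measurable_fun D (EFin \o u n) by apply/measurable_EFinP; case: (su n).
have mL : measurable_fun D L by exact: measurable_fun_limn_esup.
have ml : measurable_fun D l by exact: measurableT_comp mL.
have ul : {ae mu, forall x, D x -> u n x @[n --> \oo] --> l x}.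
  have := fast_cauchy_ae_cvg mD fD su Hu; apply: filterS => x H Dx.
  have cu := H Dx; rewrite /l /L.
  have /cvg_limn_einf_sup[_ ->] : (u n x)%:E @[n --> \oo] --> (limn (u ^~ x))%:E.
    by apply: cvg_EFin; [exact: nearW|exact: cu].
  exact: cu.
have key k n : (k <= n)%N -> (\int[mu]_(x in D) ((u n x - l x) ^+ 2)%:E <= (4^-1 ^+ k)%:E)%E.
  move=> kn.
  pose F m x := ((u n x - u (m + k)%N x) ^+ 2)%:E.
  have mF m : measurable_fun D (F m).
    apply/measurable_EFinP; apply: measurable_funX; apply: measurable_funB.
      by case: (su n).
    by case: (su (m + k)%N).
  have F0 m x : D x -> (0 <= F m x)%E by move=> _; rewrite lee_fin sqr_ge0.
  have mE : measurable_fun D (fun x => limn_einf (F ^~ x)).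
    rewrite (_ : (fun _ => _) = (fun x => - limn_esup (fun m => - F m x))%E); last first.
      by apply/funext => x; rewrite limn_esupN oppeK.
    apply: measurableT_comp => //; apply: measurable_fun_limn_esup => m.
    exact: measurableT_comp.
  have -> : (\int[mu]_(x in D) ((u n x - l x) ^+ 2)%:E = \int[mu]_(x in D) limn_einf (F ^~ x))%E.
    apply: ge0_ae_eq_integral => //.
    - by apply/measurable_EFinP; apply: measurable_funX; apply: measurable_funB => //; case: (su n).
    - by move=> x _; rewrite lee_fin sqr_ge0.
    - move=> x Dx; rewrite limn_einf_lim; apply: lime_ge; first exact: is_cvg_einfs.
      by apply: nearW => m; apply: le_ereal_inf_tmp => _ [j _ <-]; exact: F0.
    - move: ul; apply: filterS => x H Dx; have {}H := H Dx.
      have c : F m x @[m --> \oo] --> ((u n x - l x) ^+ 2)%:E.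
        apply: cvg_EFin; first exact: nearW.
        have H' : (fun m => u (m + k)%N x) @ \oo --> l x.
          by have := H; rewrite -(cvg_shiftn k) => H'; exact: H'.
        have c0 : (fun m => u n x - u (m + k)%N x) @ \oo --> u n x - l x.
          by apply: cvgB => //; exact: cvg_cst.
        exact: (cvgM c0 c0).
      by have [->] := cvg_limn_einf_sup c.
  apply: le_trans (fatou mu mD mF F0) _.
  rewrite limn_einf_lim; apply: lime_le; first exact: is_cvg_einfs.
  apply: nearW => m; apply: (@le_trans _ _ (\int[mu]_(x in D) F m x)%E).
    by apply: ereal_inf_lbound; exists m => /=.
  have i2 : mu.-integrable D (EFin \o (fun x => (u n x - u (m + k)%N x) ^+ 2)).
    by case: (sqint_sub (su n) (su (m + k)%N)).
  by rewrite /F -(fineK (integrable_fin_num mD i2)) lee_fin; apply: Hu => //; exact: leq_addl.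
have ki n : mu.-integrable D (EFin \o (fun x => (u n x - l x) ^+ 2)).
  apply/integrableP; split.
    by apply/measurable_EFinP; apply: measurable_funX; apply: measurable_funB => //; case: (su n).
  apply: le_lt_trans (ltry (4^-1 ^+ 0)); apply: le_trans (key 0%N n (leq0n n)).
  rewrite le_eqVlt; apply/orP; left; apply/eqP; apply: eq_integral => x _ /=.
  by rewrite ger0_norm// sqr_ge0.
exists l.
  have s0 : sqint mu D (fun x => u 0%N x - l x).
    by split=> //; apply: measurable_funB => //; case: (su 0%N).
  have := sqint_sub (su 0%N) s0.
  by congr (sqint _ _ _); apply/funext => x; ring.
move=> k n kn; rewrite -lee_fin /Rintegral fineK ?key//; exact: integrable_fin_num (ki n).
Qed.

Definition L2p : set (T -> R * R) :=
  [set w | sqint mu D (fun x => (w x).1) /\ sqint mu D (fun x => (w x).2)].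

Definition ip w v : R := \int[mu]_(x in D) ((w x).1 * (v x).1 + (w x).2 * (v x).2).

Lemma L2p_lin (a : R) v w : L2p v -> L2p w -> L2p (a *: v + w).
Proof. by move=> [v1 v2] [w1 w2]; split; exact: sqint_lin. Qed.

Lemma ip_integrable v w : L2p v -> L2p w ->
  mu.-integrable D (EFin \o (fun x => (w x).1 * (v x).1 + (w x).2 * (v x).2)).
Proof. by move=> [v1 v2] [w1 w2]; apply: integrable_EFinD => //; exact: sqint_mul. Qed.

Lemma ip_lin (a : R) u v w : L2p u -> L2p v -> L2p w -> ip (a *: u + v) w = a * ip u w + ip v w.
Proof.
move=> Lu Lv Lw; have i1 := ip_integrable Lw Lu; have i2 := ip_integrable Lw Lv.
rewrite /ip -RintegralZl// -RintegralD//; last exact: integrable_EFinZ.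
by apply: eq_Rintegral => x _; rewrite /= /GRing.scale /=; ring.
Qed.

Lemma ip_sym v w : ip v w = ip w v.
Proof. by apply: eq_Rintegral => x _; rewrite /=; ring. Qed.

Lemma ip_ge0 w : 0 <= ip w w.
Proof. by apply: Rintegral_ge0 => x _; rewrite -!expr2 addr_ge0// sqr_ge0. Qed.

Lemma ip_complete (u : nat -> T -> R * R) : (forall n, L2p (u n)) ->
  (forall k m n, (k <= m)%N -> (k <= n)%N -> ip (u m - u n) (u m - u n) <= 4^-1 ^+ k) ->
  exists2 l, L2p l & forall e, 0 < e -> exists N, forall n, (N <= n)%N -> ip (u n - l) (u n - l) < e.
Proof.
move=> Lu Hu.
have split_ip v w : L2p v -> L2p w -> ip (v - w) (v - w) =
   \int[mu]_(x in D) ((v x).1 - (w x).1) ^+ 2 + \int[mu]_(x in D) ((v x).2 - (w x).2) ^+ 2.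
  move=> [v1 v2] [w1 w2]; have [_ i1] := sqint_sub v1 w1; have [_ i2] := sqint_sub v2 w2.
  by rewrite -RintegralD//; apply: eq_Rintegral => x _; rewrite !expr2.
have int0 f : 0 <= \int[mu]_(x in D) (f x) ^+ 2 by apply: Rintegral_ge0 => x _; exact: sqr_ge0.
have Hu1 k m n : (k <= m)%N -> (k <= n)%N -> \int[mu]_(x in D) ((u m x).1 - (u n x).1) ^+ 2 <= 4^-1 ^+ k.
  by move=> km kn; apply: le_trans (Hu k m n km kn); rewrite split_ip// lerDl.
have Hu2 k m n : (k <= m)%N -> (k <= n)%N -> \int[mu]_(x in D) ((u m x).2 - (u n x).2) ^+ 2 <= 4^-1 ^+ k.
  by move=> km kn; apply: le_trans (Hu k m n km kn); rewrite split_ip// lerDr.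
have [l1 sl1 H1] := @sqint_complete (fun n x => (u n x).1) (fun n => (Lu n).1) Hu1.
have [l2 sl2 H2] := @sqint_complete (fun n x => (u n x).2) (fun n => (Lu n).2) Hu2.
exists (fun x => (l1 x, l2 x)) => // e e0.
have [N HN] : exists N, 4^-1 ^+ N < e / 2.
  have e20 : 0 < e / 2 by rewrite divr_gt0.
  have [N] := ltr_add_invr (y := 0) (x := e / 2) e20; rewrite add0r => HN.
  exists N.+1; apply: le_lt_trans HN.
  rewrite exprVn lef_pV2 ?posrE ?ltr0n ?exprn_gt0//.
  by rewrite -natrX ler_nat ltnW// ltn_expl.
exists N => n Nn; rewrite split_ip//=.
have h1 := H1 N n Nn; have h2 := H2 N n Nn.
by apply: le_lt_trans (lerD h1 h2) _; rewrite [ltRHS]splitr ltrD.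
Qed.

End SquareIntegrableForms.

(** * Fubini for kernels *)

Section PlaneArea.
Context {R : realType}.

(* The library only registers product measures of subprobabilities as sigma-finite. *)
Definition plane_area : set (plane R) -> \bar R := area.

HB.instance Definition _ := Measure.copy plane_area area.

Lemma plane_area_sigma_finite : sigma_finite setT plane_area.
Proof.
exists (fun n => [set p : R * R | `|p| <= n%:R]).
  apply/seteqP; split=> // p _; exists (Num.truncn `|p|).+1 => //=.
  by rewrite ltW// truncnS_gt.
by move=> n; split; [exact: ball_measurable|exact: area_ball_fin].
Qed.

HB.instance Definition _ := Measure_isSigmaFinite.Build _ _ _ plane_area plane_area_sigma_finite.

End PlaneArea.
Section KernelFubini.
Context d (T : measurableType d) {R : realType} (mu : {sigma_finite_measure set T -> \bar R}).
Variables (D : set T) (Om : set (R * R)) (Z : T -> R * R) (k : T -> R) (f : R * R -> R) (M : R).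
Hypotheses (mD : measurable D) (mOm : @measurable _ (plane R) Om).
Hypotheses (mZ : measurable_fun setT (Z : T -> plane R)).
Hypotheses (ZM : forall t, D t -> `|Z t| <= M) (OmM : forall p, Om p -> `|p| <= M).
Hypotheses (ik : mu.-integrable D (EFin \o k)) (i_f : area.-integrable Om (EFin \o f)).

(** [Z] and [Om] are bounded, so K is bounded by some A on the arguments that occur, and A |k| |f|
    dominates the integrand. Extending k and f by 0 gives a single integral over the whole
    product. *)
Lemma kernel_fubini (K : R * R -> R) : smooth_on setT K ->
  \int[mu]_(t in D) (k t * \int[area]_(p in Om) (K (p - Z t) * f p)) =
  \int[area]_(p in Om) (f p * \int[mu]_(t in D) (K (p - Z t) * k t)).
Proof.
move=> sK.
have [A A0 KA] := smooth_bounded (M + M) sK.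
pose kD := k \_ D; pose fO := f \_ Om.
have mK : measurable_fun setT (fun z : T * plane R => K (z.2 - Z z.1)).
  apply: (measurableT_comp (smooth_measurable sK)).
  have mZ1 : measurable_fun setT (fun z : T * plane R => Z z.1 : plane R).
    exact: measurableT_comp mZ measurable_fst.
  apply: (@measurable_fun_pair _ _ _ _ _ _ (fun z : T * plane R => z.2.1 - (Z z.1).1)
     (fun z : T * plane R => z.2.2 - (Z z.1).2)).
    apply: measurable_funB.
      exact: measurableT_comp measurable_fst measurable_snd.
    exact: measurableT_comp measurable_fst mZ1.
  apply: measurable_funB.
    exact: measurableT_comp measurable_snd measurable_snd.
  exact: measurableT_comp measurable_snd mZ1.
have ikD : mu.-integrable setT (EFin \o kD).
  by rewrite /kD -restrict_EFin; apply/(integrable_mkcond _ mD).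
have ifO : area.-integrable setT (EFin \o fO).
  by rewrite /fO -restrict_EFin; apply/(integrable_mkcond _ mOm).
have mkD : measurable_fun setT kD by apply/measurable_EFinP; case/integrableP: ikD.
have mfO : measurable_fun setT (fO : plane R -> R) by apply/measurable_EFinP; case/integrableP: ifO.
pose F (z : T * plane R) := kD z.1 * K (z.2 - Z z.1) * fO z.2.
have mF : measurable_fun setT F.
  apply: measurable_funM; first apply: measurable_funM => //.
    exact: measurableT_comp mkD measurable_fst.
  exact: measurableT_comp mfO measurable_snd.
have FA t p : `|F (t, p)| <= A * (`|kD t| * `|fO p|).
  rewrite /F /= !normrM /kD /fO !patchE.
  case: ifPn => [|_]; last by rewrite !normr0 !mul0r mulr0.
  rewrite inE => Dt; case: ifPn => [|_]; last by rewrite !normr0 !mulr0.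
  rewrite inE => Op; rewrite mulrA ler_wpM2r// [leRHS]mulrC ler_wpM2l//; apply: KA.
  by apply: le_trans (ler_normB _ _) _; rewrite lerD ?ZM ?OmM.
have int_fin g (X : set (plane R)) : @measurable _ (plane R) X -> area.-integrable X (EFin \o g) ->
    (\int[area]_(p in X) (g p)%:E)%E = (\int[area]_(p in X) g p)%:E.
  by move=> mX ig; rewrite /Rintegral fineK//; exact: integrable_fin_num ig.
have int_finT g (X : set T) : measurable X -> mu.-integrable X (EFin \o g) ->
    (\int[mu]_(t in X) (g t)%:E)%E = (\int[mu]_(t in X) g t)%:E.
  by move=> mX ig; rewrite /Rintegral fineK//; exact: integrable_fin_num ig.
have iF : (mu \x plane_area)%E.-integrable setT (EFin \o F).
  have ifn := integrable_norm ifO; have ikn := integrable_norm ikD.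
  have mEF : measurable_fun setT (EFin \o F) by exact/measurable_EFinP.
  apply: ((@integrable12ltyP _ _ T (plane R) R mu plane_area _ mEF).2).
  pose I := \int[area]_p `|fO p|.
  apply: (@le_lt_trans _ _ (\int[mu]_t ((A * I) * `|kD t|)%:E)%E).
    apply: ge0_le_integral => //.
    - by move=> t _; exact: integral_ge0.
    - apply: (@measurable_fun_fubini_tonelli_F _ _ _ _ _ _ (fun z => `|(F z)%:E|)%E) => //.
      by apply: measurableT_comp => //; exact/measurable_EFinP.
    - apply/measurable_EFinP; apply: measurable_funM; first exact: measurable_cst.
      exact: measurableT_comp.
    - move=> t _; apply: (@le_trans _ _ (\int[area]_p (A * `|kD t| * `|fO p|)%:E)%E).
        apply: ge0_le_integral => //.
        + apply: measurableT_comp => //; apply/measurable_EFinP.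
          exact: (measurableT_comp mF (pair1_measurable t)).
        + apply/measurable_EFinP; apply: measurable_funM; first exact: measurable_cst.
          exact: measurableT_comp.
        + by move=> p _; rewrite lee_fin -mulrA; exact: FA.
      rewrite (int_fin (fun p => A * `|kD t| * `|fO p|) setT)//; last exact: integrable_EFinZ.
      by rewrite RintegralZl// lee_fin -/I le_eqVlt; apply/orP; left; apply/eqP; ring.
  by rewrite int_finT ?ltry//; exact: integrable_EFinZ.
have E := @Fubini _ _ T (plane R) R mu plane_area _ iF.
have inP t : (\int[area]_p (EFin \o F) (t, p))%E =
   ((fun t => k t * \int[area]_(p in Om) (K (p - Z t) * f p)) \_ D t)%:E.
  rewrite patchE; case: ifPn => [|tD].
    rewrite inE => Dt.
    have i1 := @kconv_integrable _ (plane R) R _ Om id M f mOm (@measurable_id _ (plane R) Om) OmM i_f K (Z t) sK.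
    have -> : k t * \int[area]_(p in Om) (K (p - Z t) * f p) =
       \int[area]_(p in Om) (k t * (K (p - Z t) * f p)) by rewrite RintegralZl.
    rewrite -int_fin//; last exact: integrable_EFinZ.
    rewrite [RHS]integral_mkcond; apply: eq_integral => p _.
    rewrite !patchE /F /kD /fO /= !patchE mem_set//; case: ifP => _; last by rewrite mulr0.
    by rewrite mulrA.
  by apply: integral0_eq => p _; rewrite /F /kD /= patchE (negbTE tD) !mul0r.
have inT p : (\int[mu]_t (EFin \o F) (t, p))%E =
   ((fun p => f p * \int[mu]_(t in D) (K (p - Z t) * k t)) \_ Om p)%:E.
  rewrite patchE; case: ifPn => [|pO].
    rewrite inE => Op.
    have i1 : mu.-integrable D (EFin \o (fun t => K (p - Z t) * k t)).
      apply: (@integrable_mul_bounded _ _ _ mu D k mD ik _ A).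
        apply: measurable_funTS; exact: (measurableT_comp mK (pair2_measurable p)).
      by move=> t Dt; apply: KA; apply: le_trans (ler_normB _ _) _; rewrite lerD ?ZM ?OmM.
    have -> : f p * \int[mu]_(t in D) (K (p - Z t) * k t) =
       \int[mu]_(t in D) (f p * (K (p - Z t) * k t)) by rewrite RintegralZl.
    rewrite -int_finT//; last exact: integrable_EFinZ.
    rewrite [RHS]integral_mkcond; apply: eq_integral => t _.
    rewrite !patchE /F /kD /fO /= !patchE [p \in _]mem_set//; case: ifP => _; last by rewrite !mul0r.
    by congr EFin; ring.
  by apply: integral0_eq => t _; rewrite /F /fO /= patchE (negbTE pO) mulr0.
rewrite (eq_integral _ _ (fun t _ => inP t)) (eq_integral _ _ (fun p _ => inT p)) in E.
by rewrite [LHS]Rintegral_mkcond [RHS]Rintegral_mkcond /Rintegral E.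
Qed.
End KernelFubini.

(** * Functions with vanishing integrals on boxes *)

Section ZeroIntegral.
Context {R : realType}.

(** The sets B with vanishing integral form a Dynkin system. With [phi] left general, the same
    argument acts on the first coordinate, on the second one, and on the whole plane. *)
Lemma zero_integral_dynkin d d' (T : measurableType d) (T' : measurableType d')
    (mu : {measure set T -> \bar R}) (u : T -> \bar R) (phi : T -> T') (C : set T) (G : set (set T')) :
  mu.-integrable setT u -> measurable_fun setT phi -> measurable C ->
  @measurable _ T' = <<s G >> -> setI_closed G ->
  (\int[mu]_(x in C) u x = 0)%E ->
  (forall B, G B -> \int[mu]_(x in C `&` phi @^-1` B) u x = 0)%E ->
  forall B, measurable B -> (\int[mu]_(x in C `&` phi @^-1` B) u x = 0)%E.
Proof.
move=> iu mphi mC GE GI C0 G0 B; rewrite GE; move: B.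
have mX S : measurable S -> measurable (C `&` phi @^-1` S).
  by move=> mS; apply: measurableI => //; rewrite -[X in measurable X]setTI; exact: mphi.
have iX S : measurable S -> mu.-integrable (C `&` phi @^-1` S) u.
  by move=> mS; apply: integrableS iu => //; exact: mX.
apply: (dynkin_induction GE GI) => //.
- by rewrite preimage_setT setIT.
- move=> S mS S0.
  have mSC := measurableC mS.
  have CE : C = (C `&` phi @^-1` S) `|` (C `&` phi @^-1` (~` S)).
    by rewrite -setIUr preimage_setC setUv setIT.
  move: C0; rewrite {1}CE integral_setU; first by rewrite S0 add0e.
  + exact: mX.
  + exact: mX.
  + by rewrite -CE; apply: measurable_funTS; case/integrableP: iu.
  + by apply/disj_setPS; rewrite setIACA preimage_setC setICr setI0.
- move=> F mF tF F0; rewrite preimage_bigcup setI_bigcupr integral_bigcup.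
  + by rewrite eseries0// => k _ _; exact: F0.
  + by apply: trivIset_setIl; move=> i j _ _ [x [fi fj]]; apply: (tF i j) => //; exists (phi x).
  + by move=> k; exact: mX.
  + by apply: integrableS iu => //; apply: bigcupT_measurable => k; exact: mX.
Qed.

Variables (u : plane R -> R) (M : R).
Hypotheses (iu : area.-integrable setT (EFin \o u)) (uM : forall p, M < `|p : R * R| -> u p = 0).
Hypothesis box0 : forall a b c d : R,
  (\int[area]_(p in `]a, b]%classic `*` `]c, d]%classic) (u p)%:E = 0)%E.

Lemma integral_same_support (A B : set (plane R)) :
  (forall p, `|p : R * R| <= M -> A p <-> B p) ->
  (\int[area]_(p in A) (u p)%:E = \int[area]_(p in B) (u p)%:E)%E.
Proof.
move=> AB; rewrite integral_mkcond [RHS]integral_mkcond; apply: eq_integral => p _.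
rewrite !patchE; have [pM|pM] := leP (`|p : R * R|) M; last by rewrite uM//; case: ifP; case: ifP.
suff -> : (p \in A) = (p \in B) by [].
by apply/idP/idP; rewrite !inE => /(AB p pM).
Qed.

Let N := `|M| + 1.

Lemma big_itv (x : R) : `|x| <= M -> `]- N, N]%classic x.
Proof.
move=> xM; have h : `|x| < N by rewrite /N (le_lt_trans xM)// (le_lt_trans (ler_norm M))// ltrDl.
by move: h; rewrite /= in_itv /= ltr_norml => /andP[-> /ltW ->].
Qed.

(** One side of the box is enlarged at a time: first the horizontal side becomes any measurable set,
    then the vertical one, and the rectangles so obtained generate all measurable sets. *)
Lemma zero_on_boxes (E : set (plane R)) : measurable E -> (\int[area]_(p in E) (u p)%:E = 0)%E.
Proof.
have ocE : @measurable _ (measurableTypeR R) = <<s (@ocitv R) >> by [].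
have step1 (c d : R) (A : set (measurableTypeR R)) : measurable A ->
    (\int[area]_(p in A `*` `]c, d]%classic) (u p)%:E = 0)%E.
  move=> mA.
  have mC : @measurable _ (plane R) (setT `*` `]c, d]%classic).
    by apply: measurableX => //; exact: measurable_itv.
  have := @zero_integral_dynkin _ _ (plane R) (measurableTypeR R) area (EFin \o u) fst _ (@ocitv R)
    iu measurable_fst mC ocE (@ocitvI R).
  have SX (X : set R) : (setT `*` `]c, d]%classic) `&` fst @^-1` X = X `*` `]c, d]%classic.
    by apply/seteqP; split => -[x y] /=; tauto.
  move=> /(_ _ _ A mA); rewrite SX; apply.
    (* The Dynkin argument also asks for the integral over the whole strip; u has bounded support,
       so a long box has the same integral. *)
    rewrite (@integral_same_support _ (`]- N, N]%classic `*` `]c, d]%classic)); first exact: box0.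
    move=> p pM /=; have := big_itv (le_trans (norm_fst p) pM); rewrite /=; tauto.
  by move=> _ [[a b] _ <-]; rewrite SX; exact: box0.
have step2 (A B : set (measurableTypeR R)) : measurable A -> measurable B ->
    (\int[area]_(p in A `*` B) (u p)%:E = 0)%E.
  move=> mA mB.
  have mC : @measurable _ (plane R) (A `*` setT) by exact: measurableX.
  have := @zero_integral_dynkin _ _ (plane R) (measurableTypeR R) area (EFin \o u) snd _ (@ocitv R)
    iu measurable_snd mC ocE (@ocitvI R).
  have SX (X : set R) : (A `*` setT) `&` snd @^-1` X = A `*` X.
    by apply/seteqP; split => -[x y] /=; tauto.
  move=> /(_ _ _ B mB); rewrite SX; apply.
    rewrite (@integral_same_support _ (A `*` `]- N, N]%classic)); first exact: step1.
    move=> p pM /=; have := big_itv (le_trans (norm_snd p) pM); rewrite /=; tauto.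
  by move=> _ [[a b] _ <-]; rewrite SX; exact: step1.
move=> mE.
have := @zero_integral_dynkin _ _ (plane R) (plane R) area (EFin \o u) id setT _
    iu (@measurable_id _ _ setT) measurableT (@measurable_prod_measurableType _ _ (measurableTypeR R) (measurableTypeR R)).
move=> /(_ _ _ _ E mE); rewrite setTI; apply.
- move=> _ _ [A mA [B mB <-]] [A' mA' [B' mB' <-]]; exists (A `&` A'); first exact: measurableI.
  exists (B `&` B'); first exact: measurableI.
  by rewrite setXI.
- rewrite (@integral_same_support _ (`]- N, N]%classic `*` `]- N, N]%classic)); first exact: box0.
  move=> p pM; split=> // _; split; first exact: big_itv (le_trans (norm_fst p) pM).
  exact: big_itv (le_trans (norm_snd p) pM).
- by move=> _ [A mA [B mB <-]]; rewrite setTI; exact: step2.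
Qed.

Lemma zero_on_boxes_ae : ae_eq area setT (EFin \o u) (cst 0%E).
Proof.
apply: integral_ae_eq => // E _ mE; rewrite integral0; exact: zero_on_boxes.
Qed.

End ZeroIntegral.

(** * Mollifiers *)

Section Mollifier.
Context {R : realType}.
Implicit Types (r : R) (p q c : R * R).

(** The parameters of the kernels are squared radii. The support of [mol r] lies in the Euclidean
    disc of radius r, hence in the sup-norm ball of that radius. Its mass is left unnormalized and
    does not depend on r. *)
Definition molX r : R * R -> R := kerX (r ^+ 2 / 2) (r ^+ 2).
Definition molY r : R * R -> R := kerY (r ^+ 2 / 2) (r ^+ 2).
Definition mol r : R * R -> R := bump (r ^+ 2 / 2) (r ^+ 2).

Lemma mol_par r : 0 < r -> 0 < r ^+ 2 / 2 /\ r ^+ 2 / 2 < r ^+ 2.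
Proof.
move=> r0; have r2 : 0 < r ^+ 2 by rewrite exprn_gt0.
by split; [rewrite divr_gt0|rewrite ltr_pdivrMr// mulr_natr mulr2n ltrDl].
Qed.

Lemma smooth_mol r : 0 < r -> smooth_on setT (mol r).
Proof. by move=> /mol_par[h1 h2]; exact: smooth_bump. Qed.

Lemma smooth_molX r : 0 < r -> smooth_on setT (molX r).
Proof. by move=> /mol_par[h1 h2]; exact: smooth_kerX. Qed.

Lemma smooth_molY r : 0 < r -> smooth_on setT (molY r).
Proof. by move=> /mol_par[h1 h2]; exact: smooth_kerY. Qed.

Lemma mol_ge0 r p : 0 < r -> 0 <= mol r p.
Proof. by move=> _; exact: bump_ge0. Qed.

Lemma molN r p : mol r (- p) = mol r p.
Proof. exact: bumpN. Qed.

Lemma nrm2_norm r p : 0 < r -> r < `|p| -> r ^+ 2 < nrm2 p.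
Proof.
move=> r0 rp; rewrite /nrm2.
have : r < `|p.1| \/ r < `|p.2|.
  by move: rp; rewrite prod_normE lt_max => /orP.
have sq (x : R) : r < `|x| -> r ^+ 2 < x ^+ 2.
  by move=> rx; rewrite -(real_normK (num_real x)) ltrXn2r// ?nnegrE// ltW.
by case=> /sq h; [rewrite ltr_wpDr// sqr_ge0|rewrite ltr_wpDl// sqr_ge0].
Qed.

Lemma mol_supp r p : 0 < r -> r < `|p| -> mol r p = 0.
Proof. by move=> r0 rp; apply: bump_supp; exact: nrm2_norm. Qed.

Lemma radial_far r p : 0 < r -> r < `|p| -> radial (r ^+ 2 / 2) (r ^+ 2) (nrm2 p) = (nrm2 p)^-1.
Proof.
move=> r0 rp; have [h1 h2] := mol_par r0.
by rewrite radial_hi// ltW// nrm2_norm.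
Qed.

Lemma mol_div r p : 0 < r -> dx (molX r) p + dy (molY r) p = mol r p.
Proof. by move=> /mol_par[h1 h2]; exact: div_ker. Qed.

Lemma mol_curl r p : 0 < r -> dy (molX r) p = dx (molY r) p.
Proof. by move=> /mol_par[h1 h2]; exact: curl_ker. Qed.

(* The difference of two such fields is compactly supported, although neither of them is. *)
Lemma molB_supp r r' p : 0 < r -> 0 < r' -> Num.max r r' < `|p| ->
  molX r p - molX r' p = 0 /\ molY r p - molY r' p = 0.
Proof.
move=> r0 r0'; rewrite gt_max => /andP[h1 h2].
by rewrite /molX /molY /kerX /kerY !radial_far// !subrr.
Qed.

(** The divergence theorem would give 2 pi. The constant is kept symbolic, known to be positive and
    the same at all scales and centres, and it cancels in the final estimate. *)
Definition kappa : R := \int[area]_p mol 1 p.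

Lemma grad_atB (f g : R * R -> R) p (a b a' b' : R) : grad_at f p a b -> grad_at g p a' b' ->
  grad_at (fun q => f q - g q) p (a - a') (b - b').
Proof.
move=> Df Dg; rewrite (_ : (fun _ => _) = fun q => f q + (-1) * g q); last first.
  by apply/funext => q; rewrite mulN1r.
by apply: grad_at_eq (grad_atD Df (grad_atM (grad_at_cst (-1) p) Dg)) _ _; ring.
Qed.

Lemma mol_integrable r c : 0 < r -> area.-integrable setT (EFin \o (fun p => mol r (p - c))).
Proof.
move=> r0; apply: (@csupp_integrable _ _ (r + `|c|)) => p.
  exact: smooth_continuousT (smooth_shift c (smooth_mol r0)).
move=> h; apply: mol_supp => //; apply: (@lt_le_trans _ _ (`|p| - `|c|)); first by rewrite ltrBrDr.
exact: lerB_dist.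
Qed.

(** The difference of two mollifiers is the divergence of a field that vanishes far away, so its
    integral is 0. *)
Lemma mol_mass0 r : 0 < r -> \int[area]_p mol r p = kappa.
Proof.
move=> r0; apply/eqP; rewrite -subr_eq0 /kappa.
have i0 (s : R) : 0 < s -> area.-integrable setT (EFin \o mol s).
  move=> s0; have := mol_integrable 0 s0.
  by apply: eq_integrable => // p _ /=; rewrite subr0.
rewrite -RintegralB//; [|exact: i0..].
have sX := smoothB (@openT _) (smooth_molX r0) (smooth_molX ltr01).
have sY := smoothB (@openT _) (smooth_molY r0) (smooth_molY ltr01).
have [ix ex] := int_dx0 (M := Num.max r 1) sX (fun p h => (molB_supp r0 ltr01 h).1).
have [iy ey] := int_dy0 (M := Num.max r 1) sY (fun p h => (molB_supp r0 ltr01 h).2).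
apply/eqP; rewrite -[RHS](addr0 0) -{1}ex -ey -RintegralD//.
apply: eq_Rintegral => p _.
have G s s0 := smooth_grad (@smooth_molX s s0) (I : setT p).
have G' s s0 := smooth_grad (@smooth_molY s s0) (I : setT p).
rewrite (grad_at_dx (grad_atB (G r r0) (G 1 ltr01))).
rewrite (grad_at_dy (grad_atB (G' r r0) (G' 1 ltr01))).
by rewrite -!mol_div//; ring.
Qed.

(** Translation invariance by differentiation in c: the gradient of the mass is the integral of
    derivatives of a function with bounded support, hence 0, and the mass is constant on a ball
    containing both 0 and c. *)
Lemma mol_mass r c : 0 < r -> \int[area]_p mol r (p - c) = kappa.
Proof.
move=> r0; rewrite -(mol_mass0 r0).
(* Large enough for the support of every translate by q with |q| < |c| + 1, so that near these q the
   mass is a [kconv] over a bounded set. *)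
pose M := `|c| + 1 + r; pose D := [set p : R * R | `|p| <= M].
have mD : @measurable _ (plane R) D by exact: ball_measurable.
have i1 : area.-integrable D (EFin \o (fun=> 1 : R)).
  by apply: (bounded_integrable (M := M) (A := 1)) => // p _; rewrite normr1.
have sm := smooth_mol r0.
have FE q : `|q| < `|c| + 1 -> kconv area D id (fun=> 1) (mol r) q = \int[area]_p mol r (p - q).
  move=> qc; rewrite /kconv; under eq_Rintegral do rewrite mulr1.
  apply: Rintegral_support => p /negP; rewrite -ltNge => Mp; apply: mol_supp => //.
  apply: (@lt_le_trans _ _ (`|p| - `|q|)); last exact: lerB_dist.
  by rewrite ltrBrDl; apply: lt_trans Mp; rewrite /M ltrD2r.
have F0 (g : R * R -> R) q : `|q| < `|c| + 1 -> (forall p, r < `|p| -> g p = 0) ->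
    \int[area]_p g (p - q) = 0 -> kconv area D id (fun=> 1) g q = 0.
  move=> qc g0 <-; rewrite /kconv; under eq_Rintegral do rewrite mulr1.
  apply: Rintegral_support => p /negP; rewrite -ltNge => Mp; apply: g0.
  apply: (@lt_le_trans _ _ (`|p| - `|q|)); last exact: lerB_dist.
  by rewrite ltrBrDl; apply: lt_trans Mp; rewrite /M ltrD2r.
have G q : `|q - 0| < `|c| + 1 -> grad_at (kconv area D id (fun=> 1) (mol r)) q 0 0.
  rewrite subr0 => qc.
  have ss := smooth_shift q sm.
  have supp p : r + `|q| < `|p| -> mol r (p - q) = 0.
    move=> h; apply: mol_supp => //; apply: (@lt_le_trans _ _ (`|p| - `|q|)); first by rewrite ltrBrDr.
    exact: lerB_dist.
  have dE p : grad_at (fun p => mol r (p - q)) p (dx (mol r) (p - q)) (dy (mol r) (p - q)).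
    by apply: grad_at_shift; exact: smooth_grad sm I.
  have [_ ex] := int_dx0 ss supp; have [_ ey] := int_dy0 ss supp.
  have vx p (rp : r < `|p|) := csupp_dx0 sm (fun p => mol_supp r0) rp.
  have Fx : kconv area D id (fun=> 1) (dx (mol r)) q = 0.
    apply: (F0 _ _ qc (fun p rp => grad_at_dx (vx p rp))).
    by rewrite -[RHS]ex; apply: eq_Rintegral => p _; rewrite (grad_at_dx (dE p)).
  have Fy : kconv area D id (fun=> 1) (dy (mol r)) q = 0.
    apply: (F0 _ _ qc (fun p rp => grad_at_dy (vx p rp))).
    by rewrite -[RHS]ey; apply: eq_Rintegral => p _; rewrite (grad_at_dy (dE p)).
  have GK := @grad_kconv _ (plane R) R area D id M (fun=> 1) mD (@measurable_id _ (plane R) D)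
    (fun p h => h) i1 _ q sm.
  apply: (grad_at_eq GK); [move: Fx => {GK}|move: Fy => {GK}]; move: (kconv _ _ _ _ _ _) => v ->;
    exact: oppr0.
have hc : `|c| < `|c| + 1 by rewrite ltrDl.
have h0 : `|0 : R * R| < `|c| + 1 by rewrite normr0 ltr_wpDl.
have hc' : `|c - 0| < `|c| + 1 by rewrite subr0.
have E := @grad0_cst_ball _ _ 0 (`|c| + 1) G c hc'.
apply: (etrans (esym (FE c hc)) (etrans E (etrans (FE 0 h0) _))).
by apply: eq_Rintegral => p _; rewrite subr0.
Qed.

Lemma kappa_gt0 : 0 < kappa.
Proof.
have [h1 h2] := @mol_par 1 ltr01.
pose p0 : R * R := (Num.sqrt ((1 ^+ 2 / 2 + 1 ^+ 2) / 2), 0).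
have m0 : 0 < mol 1 p0 by exact: bump_pos.
have cm : {for p0, continuous (mol 1)} := @smooth_continuousT _ _ p0 (smooth_mol ltr01).
have m20 : mol 1 p0 / 2 < mol 1 p0 by rewrite ltr_pdivrMr// mulr_natr mulr2n ltrDl.
have H0 : mol 1 @ p0 --> mol 1 p0 := cm.
have /nbhs_normP[e /= e0 He] : \forall p \near p0, mol 1 p0 / 2 < mol 1 p by exact: cvgr_gt H0 _ m20.
pose Q : set (plane R) := `[p0.1 - e / 2, p0.1 + e / 2]%classic `*` `[p0.2 - e / 2, p0.2 + e / 2]%classic.
have mQ : measurable Q by apply: measurableX; exact: measurable_itv.
have Qe (p : R * R) : Q p -> mol 1 p0 / 2 < mol 1 p.
  case; rewrite /= !in_itv /= => /andP[a1 a2] /andP[b1 b2]; apply: He => /=.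
  rewrite prod_normE /= gt_max !ltr_norml; lra.
have im : area.-integrable setT (EFin \o mol 1).
  by have := mol_integrable 0 (@ltr01 R); apply: eq_integrable => // p _ /=; rewrite subr0.
have aQ : area Q = (e * e)%:E.
  have li x : lebesgue_measure `[x - e / 2, x + e / 2]%classic = e%:E.
    rewrite lebesgue_measure_itv /= lte_fin ifT; last by lra.
    by rewrite -EFinD; congr EFin; field.
  rewrite product_measure1E; [|exact: measurable_itv|exact: measurable_itv].
  by apply: etrans (congr2 mule (li p0.1) (li p0.2)) _.
have icst : area.-integrable Q (EFin \o (fun=> mol 1 p0 / 2)).
  have fQ : (area Q < +oo)%E by rewrite aQ ltry.
  have bQ : [bounded (fun=> mol 1 p0 / 2) p | p in Q] by exact: (bounded_byP (M := `|mol 1 p0 / 2|)).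
  exact: measurable_bounded_integrable bQ.
apply: (@lt_le_trans _ _ (\int[area]_(p in Q) (mol 1 p0 / 2))).
  rewrite Rintegral_cst// [X in fine X](_ : _ = (e * e)%:E); last exact: aQ.
  by apply: mulr_gt0; [exact: divr_gt0|exact: mulr_gt0].
rewrite /kappa; apply: (@le_trans _ _ (\int[area]_(p in Q) mol 1 p)).
  apply: le_Rintegral => //; first exact: integrableS im.
  by move=> p /Qe/ltW.
rewrite Rintegral_mkcond; apply: le_Rintegral => //.
  by rewrite -restrict_EFin; apply/(integrable_mkcond _ mQ); exact: integrableS im.
move=> p _; rewrite patchE; case: ifP => // _; exact: mol_ge0.
Qed.

End Mollifier.

(** * Functions with the mean value property *)

Section AlmostEverywhere.
Context d (T : measurableType d) {R : realType} (mu : {measure set T -> \bar R}).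

Lemma aeS (P Q : T -> Prop) : {ae mu, forall x, P x} -> (forall x, P x -> Q x) ->
  {ae mu, forall x, Q x}.
Proof. by move=> aP PQ; apply: filterS aP. Qed.

Lemma aeS2 (P Q S : T -> Prop) : {ae mu, forall x, P x} -> {ae mu, forall x, Q x} ->
  (forall x, P x -> Q x -> S x) -> {ae mu, forall x, S x}.
Proof. by move=> aP aQ PQS; apply: filterS2 aP aQ => x; exact: PQS. Qed.

End AlmostEverywhere.

(** * Sets whose frontier has measure zero *)

Section AeLocallyConstant.
Context {R : realType}.
Implicit Types (X Y : set (plane R)).

(* that is, the frontier of X is null *)
Definition ae_loc_cst X : Prop :=
  {ae area, forall p : R * R, (\forall q \near p, X q) \/ (\forall q \near p, ~ X q)}.

Lemma ae_loc_cstC X : ae_loc_cst X -> ae_loc_cst (~` X).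
Proof.
move=> lX; apply: (aeS lX) => p [h|h]; [right|left] => //.
by apply: filterS h => q Xq; exact.
Qed.

Lemma ae_loc_cstI X Y : ae_loc_cst X -> ae_loc_cst Y -> ae_loc_cst (X `&` Y).
Proof.
move=> lX lY; apply: (aeS2 lX lY) => p [hX|hX] [hY|hY].
- by left; exact: filterI.
- by right; apply: filterS hY => q h [].
- by right; apply: filterS hX => q h [].
- by right; apply: filterS hY => q h [].
Qed.

Lemma lebesgue_measure_point (a : R) : (@lebesgue_measure R [set a] = 0)%E.
Proof. by rewrite lebesgue_measure_set1. Qed.

Lemma vertical_null (a : R) : {ae area, forall p : R * R, p.1 <> a}.
Proof.
exists ([set a] `*` setT); split.
- by apply: measurableX; [exact: measurable_set1|exact: measurableT].
- rewrite product_measure1E; [|exact: measurable_set1|exact: measurableT].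
  exact: etrans (congr1 (fun z => z * _)%E (lebesgue_measure_point a)) (mul0e _).
- by move=> p /= /contrapT ->.
Qed.

Lemma horizontal_null (a : R) : {ae area, forall p : R * R, p.2 <> a}.
Proof.
exists (setT `*` [set a]); split.
- by apply: measurableX; [exact: measurableT|exact: measurable_set1].
- rewrite product_measure1E; [|exact: measurableT|exact: measurable_set1].
  exact: etrans (congr1 (fun z => _ * z)%E (lebesgue_measure_point a)) (mule0 _).
- by move=> p /= /contrapT ->.
Qed.

Lemma near_fst (p : R * R) (P : set R) : (\forall x \near p.1, P x) -> \forall q \near p, P q.1.
Proof. by move=> h; have C : (fun q : R * R => q.1) @ p --> p.1; [exact: cvg_fst|exact: (C _ h)]. Qed.

Lemma near_snd (p : R * R) (P : set R) : (\forall x \near p.2, P x) -> \forall q \near p, P q.2.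
Proof. by move=> h; have C : (fun q : R * R => q.2) @ p --> p.2; [exact: cvg_snd|exact: (C _ h)]. Qed.

Lemma near_cmp (a x : R) : x <> a ->
  ((\forall y \near x, a < y) \/ (\forall y \near x, ~ a < y)) /\
  ((\forall y \near x, y < a) \/ (\forall y \near x, ~ y < a)).
Proof.
move=> /eqP xa; have [h|h|/eqP] := ltgtP x a; last by rewrite (negbTE xa).
  have N := lt_nbhsl h; split; [right|by left].
  by apply: filterS N => y /ltW; rewrite leNgt => /negP.
have N := lt_nbhsr h; split; [by left|right].
by apply: filterS N => y /ltW; rewrite leNgt => /negP.
Qed.

Lemma ae_loc_cst_gt1 (a : R) : ae_loc_cst [set p | a < p.1].
Proof.
apply: (aeS (vertical_null a)) => p /near_cmp[[h|h] _]; [left|right]; exact: near_fst h.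
Qed.
Lemma ae_loc_cst_lt1 (a : R) : ae_loc_cst [set p | p.1 < a].
Proof.
apply: (aeS (vertical_null a)) => p /near_cmp[_ [h|h]]; [left|right]; exact: near_fst h.
Qed.
Lemma ae_loc_cst_gt2 (a : R) : ae_loc_cst [set p | a < p.2].
Proof.
apply: (aeS (horizontal_null a)) => p /near_cmp[[h|h] _]; [left|right]; exact: near_snd h.
Qed.
Lemma ae_loc_cst_lt2 (a : R) : ae_loc_cst [set p | p.2 < a].
Proof.
apply: (aeS (horizontal_null a)) => p /near_cmp[_ [h|h]]; [left|right]; exact: near_snd h.
Qed.

Lemma ae_loc_cst_box (a b c d : R) : ae_loc_cst (`]a, b]%classic `*` `]c, d]%classic).
Proof.
rewrite (_ : _ `*` _ = ([set p | a < p.1] `&` ~` [set p | b < p.1]) `&`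
  ([set p | c < p.2] `&` ~` [set p | d < p.2])).
  by do 2![apply: ae_loc_cstI]; (try apply: ae_loc_cstC);
    (exact: ae_loc_cst_gt1 || exact: ae_loc_cst_gt2).
apply/seteqP; split => -[x y] /=; rewrite !in_itv /= ?(leNgt x) ?(leNgt y).
  by move=> [/andP[-> /negP ?] /andP[-> /negP ?]].
by move=> [[-> /negP ->] [-> /negP ->]].
Qed.

Lemma ae_loc_cst_ball (p : R * R) (s : R) : ae_loc_cst [set q : R * R | `|q - p| <= s].
Proof.
rewrite (_ : mkset _ = (~` [set q | q.1 < p.1 - s] `&` ~` [set q | p.1 + s < q.1]) `&`
  (~` [set q | q.2 < p.2 - s] `&` ~` [set q | p.2 + s < q.2])).
  apply: ae_loc_cstI; apply: ae_loc_cstI; apply: ae_loc_cstC.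
  - exact: ae_loc_cst_lt1.
  - exact: ae_loc_cst_gt1.
  - exact: ae_loc_cst_lt2.
  - exact: ae_loc_cst_gt2.
apply/seteqP; split => -[x y] /=; rewrite prod_normE /= ge_max !ler_distl.
  by move=> /andP[/andP[a b] /andP[c d]]; split; split; apply/negP; rewrite -leNgt.
by move=> [[/negP a /negP b] [/negP c /negP d]]; move: a b c d; rewrite -!leNgt => -> -> -> ->.
Qed.

End AeLocallyConstant.

Section MollifyAe.
Context {R : realType}.
Variables (Om : set (R * R)) (M : R) (f g : R * R -> R).
Hypotheses (oOm : open Om) (OmM : forall p, Om p -> `|p| <= M).
Hypothesis i_f : area.-integrable Om (EFin \o f).
Hypothesis cg : forall p, Om p -> {for p, continuous g}.
Hypothesis mean : forall (c : R * R) (r : R), 0 < r -> (forall q, `|q - c| <= r -> Om q) ->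
  \int[area]_(p in Om) (mol r (p - c) * f p) = kappa * g c.

Let mOm : @measurable _ (plane R) Om := plane_open_measurable oOm.

Section LocalBox.
Variables (q0 : R * R) (s : R) (X : set (R * R)).
Hypotheses (s0 : 0 < s) (q0s : forall q, `|q - q0| <= 2 * s -> Om q).
Hypotheses (mX : @measurable _ (plane R) X) (XQ : forall p, X p -> `|p - q0| <= s).
Hypothesis Xlc : ae_loc_cst X.

Let XOm p : X p -> Om p.
Proof. by move=> /XQ h; apply: q0s; apply: le_trans h _; rewrite ler_peMl// ?ltW// ltr1n. Qed.

Let XM p : X p -> `|p| <= M. Proof. by move=> /XOm; exact: OmM. Qed.

Let i1 : area.-integrable X (EFin \o (fun=> 1 : R)).
Proof. by apply: (bounded_integrable (M := M) (A := 1)) => // p _; rewrite normr1. Qed.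

(** The mollified indicator of X; the factor 1 is the weight k of [kernel_fubini]. *)
Definition blur (r : R) (p : R * R) : R := \int[area]_(c in X) (mol r (p - c) * 1).

Lemma blurE r p : blur r p = kconv area X id (fun=> 1) (mol r) p.
Proof. by apply: eq_Rintegral => c _; rewrite -molN opprB. Qed.

(** Fubini turns the integral over X of the mollified values of f into a pairing of f with [blur r].
    The left-hand side does not contain r, which prepares the passage to r -> 0. *)
Lemma blur_mean r : 0 < r -> r <= s ->
  kappa * \int[area]_(p in X) g p = \int[area]_(p in Om) (f p * blur r p).
Proof.
move=> r0 rs.
have := @kernel_fubini _ (plane R) R plane_area X Om id (fun=> 1) f M mX mOm
  (@measurable_id _ (plane R) setT) XM OmM i1 i_f (mol r) (smooth_mol r0).
rewrite /blur => <-.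
have igX : area.-integrable X (EFin \o g).
  have cB : compact [set q : R * R | `|q - q0| <= s].
    rewrite (_ : mkset _ = (fun p => p + q0) @` [set p : R * R | `|p| <= s]).
      apply: continuous_compact; last exact: compact_ball.
      apply: continuous_subspaceT => p; apply: cvgD; [exact: cvg_id|exact: cvg_cst].
    apply/seteqP; split=> [q qs|_ [p ps <-]] /=; last by rewrite addrK.
    by exists (q - q0) => //; rewrite subrK.
  have [|A A0 gA] := continuous_bounded cB (K := g).
    move=> p ps; apply: cg; apply: q0s; apply: le_trans ps _.
    by rewrite ler_peMl// ?ltW// ltr1n.
  apply: (bounded_integrable (M := M) (A := A)) => //.
    by apply: measurable_funS (plane_continuous_measurable oOm cg).
  by move=> p /XQ; exact: gA.
rewrite -RintegralZl//; apply: eq_Rintegral => c; rewrite inE => Xc.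
rewrite mul1r mean// => q qc; apply: q0s.
rewrite (_ : q - q0 = (q - c) + (c - q0)); last by rewrite addrA subrK.
apply: le_trans (ler_normD _ _) _; have := XQ Xc; have := le_trans qc rs.
by move: (`|q - c|) (`|c - q0|) => u v; lra.
Qed.

Lemma blur_ge0 r p : 0 < r -> 0 <= blur r p.
Proof. by move=> r0; apply: Rintegral_ge0 => c _; rewrite mulr1 mol_ge0. Qed.

Lemma blur_le r p : 0 < r -> blur r p <= kappa.
Proof.
move=> r0; rewrite -(mol_mass p r0) blurE /kconv.
have im := mol_integrable p r0.
have imX : area.-integrable X (EFin \o (fun c => mol r (c - p))).
  exact: integrableS im.
under eq_Rintegral do rewrite mulr1.
rewrite Rintegral_mkcond; apply: le_Rintegral => //.
  by rewrite -restrict_EFin; apply/(integrable_mkcond _ mX).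
by move=> c _; rewrite patchE; case: ifP => // _; exact: mol_ge0.
Qed.

Lemma blur_in r p : 0 < r -> (forall q, `|q - p| <= r -> X q) -> blur r p = kappa.
Proof.
move=> r0 H; rewrite -(mol_mass p r0) blurE /kconv.
under eq_Rintegral do rewrite mulr1.
apply: Rintegral_support => c Xc; apply: mol_supp => //.
by rewrite ltNge; apply/negP => /H.
Qed.

Lemma blur_out r p : 0 < r -> (forall q, `|q - p| <= r -> ~ X q) -> blur r p = 0.
Proof.
move=> r0 H; rewrite blurE /kconv.
rewrite /Rintegral integral0_eq// => c Xc.
by rewrite mulr1 mol_supp// ltNge; apply/negP => h; exact: H h Xc.
Qed.

Lemma measurable_blur r : 0 < r -> measurable_fun Om (blur r : plane R -> R).
Proof.
move=> r0; rewrite (_ : blur r = kconv area X id (fun=> 1) (mol r)); last by apply/funext => p; exact: blurE.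
apply: measurable_funTS; apply: smooth_measurable.
exact: (@smooth_kconv _ (plane R) R area X id M (fun=> 1) mX (@measurable_id _ (plane R) X) XM i1 _ (smooth_mol r0)).
Qed.

Let rad (n : nat) : R := s / n.+1%:R.

Let rad_gt0 n : 0 < rad n. Proof. by rewrite divr_gt0. Qed.

Let rad_le n : rad n <= s.
Proof. by rewrite ler_pdivrMr ?ltr0n//; apply: ler_peMr; [exact: ltW|rewrite ler1n]. Qed.

Lemma rad_small e : 0 < e -> \forall n \near \oo, rad n < e.
Proof.
move=> e0; have es : 0 < e / s by rewrite divr_gt0.
have [N] := ltr_add_invr (y := 0) (x := e / s) es; rewrite add0r => HN.
exists N => // n /= Nn; rewrite /rad mulrC -ltr_pdivlMr//.
by apply: le_lt_trans HN; rewrite lef_pV2 ?posrE ?ltr0n// ler_nat ltnS.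
Qed.

Lemma blur_cvg p : (\forall q \near p, X q) \/ (\forall q \near p, ~ X q) ->
  blur (rad n) p @[n --> \oo] --> kappa * \1_X p.
Proof.
move=> H; apply: cvg_near_cst.
case: H => H; have Xp := nbhs_singleton H; have /nbhs_normP[e /= e0 He] := H.
  apply: filterS (rad_small e0) => n ne; rewrite indicE mem_set// mulr1 blur_in// => q qn.
  by apply: He; rewrite /= distrC; apply: le_lt_trans ne.
apply: filterS (rad_small e0) => n ne; rewrite indicE memNset// mulr0 blur_out// => q qn.
by apply: He; rewrite /= distrC; apply: le_lt_trans ne.
Qed.

(** As r tends to 0, [blur r] stays below kappa and tends to kappa times the indicator of X off its
    null frontier. By dominated convergence the limit acts on the indicator, while f itself is never
    approximated. *)
Lemma blur_integral : \int[area]_(p in X) f p = \int[area]_(p in X) g p.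
Proof.
have k0 := @kappa_gt0 R; have kn : kappa != 0 :> R by rewrite gt_eqF.
have mf : measurable_fun Om (f : plane R -> R) by apply/measurable_EFinP; case/integrableP: i_f.
have XO : X `<=` Om by move=> p /XOm.
have mi : measurable_fun Om (\1_X : plane R -> R) by exact: measurable_indic.
have ig : area.-integrable Om (EFin \o (fun p => kappa * `|f p|)).
  by apply: integrable_EFinZ => //; exact: integrable_norm.
have m1 n : measurable_fun Om ((fun p => (f p * blur (rad n) p)%:E) : plane R -> \bar R).
  by apply/measurable_EFinP; apply: measurable_funM => //; exact: measurable_blur.
have m2 : measurable_fun Om ((fun p => (f p * (kappa * \1_X p))%:E) : plane R -> \bar R).
  apply/measurable_EFinP; apply: measurable_funM => //; apply: measurable_funM => //.
have c1 : {ae area, forall p, Om p -> (f p * blur (rad n) p)%:E @[n --> \oo] --> (f p * (kappa * \1_X p))%:E}.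
  apply: (aeS Xlc) => p h _; apply: cvg_EFin; first exact: nearW.
  by apply: cvgM; [exact: cvg_cst|exact: blur_cvg].
have d1 : {ae area, forall p n, Om p -> (`|(f p * blur (rad n) p)%:E| <= (kappa * `|f p|)%:E)%E}.
  apply: aeW => p n _; rewrite lee_fin normrM mulrC ler_wpM2r//.
  by rewrite ger0_norm ?blur_ge0// blur_le.
have [_ _ C] := @dominated_convergence _ (plane R) R area Om mOm _ _ _ m1 m2 c1 ig d1.
have igX : area.-integrable Om (EFin \o (fun p => kappa * (f \_ X) p)).
  apply: integrable_EFinZ => //.
  have : area.-integrable setT (EFin \o (f \_ X)).
    by rewrite -restrict_EFin; apply/(integrable_mkcond _ mX); exact: integrableS i_f.
  exact: integrableS.
have E1 n : (\int[area]_(p in Om) (f p * blur (rad n) p)%:E = (kappa * \int[area]_(p in X) g p)%:E)%E.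
  rewrite (blur_mean (rad_gt0 n) (rad_le n)) /Rintegral fineK//.
  apply: (@integrable_fin_num _ _ _ area Om mOm).
  apply: (le_integrable mOm (m1 n) _ ig) => p _ /=.
  by rewrite lee_fin normrM mulrC [leRHS]ger0_norm ?mulr_ge0 ?(ltW k0)// ler_wpM2r// ger0_norm ?blur_ge0// blur_le.
have E2 : (\int[area]_(p in Om) (f p * (kappa * \1_X p))%:E = (kappa * \int[area]_(p in X) f p)%:E)%E.
  have -> : kappa * \int[area]_(p in X) f p = \int[area]_(p in Om) (kappa * (f \_ X) p).
    rewrite RintegralZl//.
      congr (_ * _); rewrite Rintegral_mkcond; symmetry; apply: Rintegral_support => p Op.
      by rewrite patchE memNset// => /XO.
    have : area.-integrable setT (EFin \o (f \_ X)).
      by rewrite -restrict_EFin; apply/(integrable_mkcond _ mX); exact: integrableS i_f.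
    exact: integrableS.
  rewrite /Rintegral fineK; last exact: (@integrable_fin_num _ _ _ area Om mOm _ igX).
  by apply: eq_integral => p _; rewrite patchE indicE; case: (p \in X); rewrite /= ?mulr1 ?mulr0// mulrC.
have : (fun n : nat => (kappa * \int[area]_(p in X) g p)%:E) @ \oo --> (kappa * \int[area]_(p in X) f p)%:E.
  by move: C; rewrite E2; under eq_fun do rewrite E1.
move/cvg_lim => /(_ (@ereal_hausdorff R)); rewrite lim_cst; last exact: ereal_hausdorff.
by move=> [] /(mulfI kn).
Qed.

End LocalBox.

Lemma mean_value_local_ae (q0 : R * R) (s : R) : 0 < s -> (forall q, `|q - q0| <= 2 * s -> Om q) ->
  {ae area, forall p : R * R, `|p - q0| <= s -> f p = g p}.
Proof.
move=> s0 q0s.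
pose Q : set (R * R) := [set p | `|p - q0| <= s].
have cB : compact Q.
  rewrite (_ : Q = (fun p => p + q0) @` [set p : R * R | `|p| <= s]).
    apply: continuous_compact; last exact: compact_ball.
    apply: continuous_subspaceT => p; apply: cvgD; [exact: cvg_id|exact: cvg_cst].
  apply/seteqP; split=> [q qs|_ [p ps <-]] /=; last by rewrite /Q /= addrK.
  by exists (q - q0) => //; rewrite subrK.
have mQ : @measurable _ (plane R) Q.
  by apply: plane_closed_measurable; apply: compact_closed cB; exact: norm_hausdorff.
have QO p : Q p -> Om p.
  by move=> h; apply: q0s; apply: le_trans h _; rewrite ler_peMl// ?ltW// ltr1n.
have [|A A0 gA] := continuous_bounded cB (K := g); first by move=> p /QO; exact: cg.
have igQ : area.-integrable Q (EFin \o g).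
  apply: (bounded_integrable (M := M) (A := A)) => //; first by move=> p /QO; exact: OmM.
  by apply: measurable_funS (plane_continuous_measurable oOm cg).
have ifQ : area.-integrable Q (EFin \o f) by exact: integrableS i_f.
pose u := (fun p => f p - g p) \_ Q.
have iu : area.-integrable setT (EFin \o u).
  by rewrite /u -restrict_EFin; apply/(integrable_mkcond _ mQ); exact: integrable_EFinB.
have uM p : M < `|p| -> u p = 0.
  move=> Mp; rewrite /u patchE memNset// => /QO/OmM; by rewrite leNgt Mp.
have := @zero_on_boxes_ae R u M iu uM.
have box0 (a b c d : R) : (\int[area]_(p in `]a, b]%classic `*` `]c, d]%classic) (u p)%:E = 0)%E.
  pose I : set (plane R) := `]a, b]%classic `*` `]c, d]%classic.
  have mI : measurable I by apply: measurableX; exact: measurable_itv.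
  have mX : @measurable _ (plane R) (I `&` Q) by exact: measurableI.
  have ifX : area.-integrable (I `&` Q) (EFin \o f) by exact: integrableS ifQ.
  have igX : area.-integrable (I `&` Q) (EFin \o g) by exact: integrableS igQ.
  have Xlc : ae_loc_cst (I `&` Q) by apply: ae_loc_cstI; [exact: ae_loc_cst_box|exact: ae_loc_cst_ball].
  have E := blur_integral s0 q0s mX (fun p => @proj2 _ _) Xlc.
  have i3 := integrable_EFinB mX ifX igX.
  have F : (\int[area]_(p in I `&` Q) (f p - g p)%:E = 0)%E.
    rewrite -(fineK (integrable_fin_num mX i3)).
    have := RintegralB mX ifX igX; rewrite E subrr => E0.
    by congr EFin.
  rewrite -[RHS]F [in RHS]integral_mkcondr; apply: eq_integral => p _.
  by rewrite /u !patchE; case: ifP.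
move=> /(_ box0) Z; apply: (@aeS _ (plane R) R area (fun p => setT p -> (EFin \o u) p = cst 0%E p) _ Z) => p /(_ I) /=.
rewrite /u patchE => h pQ.
by move: h; rewrite mem_set// => -[] /eqP; rewrite subr_eq0 => /eqP.
Qed.

(** Every point of [Om] lies in a ball of rational centre and radius whose double is still contained
    in [Om], so countably many local statements suffice. *)
Lemma mean_value_ae : {ae area, forall p : R * R, Om p -> f p = g p}.
Proof.
pose T := (rat * rat * rat)%type.
pose good (t : T) := 0 < ratr t.2 :> R /\ forall q : R * R, `|q - (ratr t.1.1, ratr t.1.2)| <= 2 * ratr t.2 -> Om q.
have Ht (t : T) : {ae area, forall p : R * R, good t -> `|p - (ratr t.1.1, ratr t.1.2)| <= ratr t.2 -> f p = g p}.
  have [[h1 h2]|ng] := pselect (good t); last by apply: aeW => p /ng.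
  by apply: (aeS (mean_value_local_ae h1 h2)).
have Hn : {ae area, forall p : R * R, forall n : nat, forall t : T, unpickle n = Some t ->
    good t -> `|p - (ratr t.1.1, ratr t.1.2)| <= ratr t.2 -> f p = g p}.
  apply: (@ae_foralln _ (plane R) R area) => n.
  case: (unpickle n) => [t|]; last by apply: aeW.
  by apply: (aeS (Ht t)) => p h t' [<-].
apply: (aeS Hn) => p H Op.
have /nbhs_normP[r /= r0 Hr] := open_nbhs_nbhs (conj oOm Op).
(* A centre within s1 of p and a ball of radius 2 s1 around it remain within 3 s1 < r of p. *)
have [s1 /itvP E1] := @rat_in_itvoo R 0 (r / 3) ltac:(by rewrite divr_gt0).
have s0 : 0 < ratr s1 :> R by rewrite E1.
have sr : ratr s1 < r / 3 :> R by rewrite E1.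
have near_rat (x : R) : exists q : rat, `|x - ratr q| <= ratr s1.
  have [q1 /itvP E] := @rat_in_itvoo R (x - ratr s1) x ltac:(by rewrite ltrBlDr ltrDl).
  exists q1; rewrite ger0_norm ?subr_ge0 ?E// lerBlDr -lerBlDl.
  by rewrite ltW// ?E.
have [a Ha] := near_rat p.1; have [b Hb] := near_rat p.2.
have pt : `|p - (ratr a, ratr b)| <= ratr s1 by rewrite prod_normE /= ge_max Ha Hb.
apply: (H (pickle ((a, b, s1) : T)) (a, b, s1)) => //; first exact: pickleK.
split=> //= q hq; apply: Hr => /=.
rewrite (_ : p - q = (p - (ratr a, ratr b)) - (q - (ratr a, ratr b))); last by rewrite opprB addrA subrK.
apply: le_lt_trans (ler_normB _ _) _; move: pt hq sr.
by move: (`|p - _|) (`|q - _|) (ratr s1) => x y z; lra.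
Qed.

End MollifyAe.

(** * Exact and coexact forms *)

Section LfunSquare.
Context d (T : measurableType d) {R : realType} (mu : {measure set T -> \bar R}) (D : set T).
Hypothesis mD : measurable D.

Lemma Lfun_sqint (f : T -> R) : f \_ D \in Lfun mu 2%:E <-> sqint mu D f.
Proof.
have E : (fun x => (f \_ D) x ^+ 2) = (fun x => f x ^+ 2) \_ D.
  by apply/funext => x; rewrite !patchE; case: ifP => // _; rewrite expr0n.
split=> [Lf|[mf i_f]].
  have := Lfun2_integrable_sqr Lf; rewrite E -restrict_EFin => /(integrable_mkcond _ mD).2 H.
  split=> //; move: Lf; rewrite inE => /andP[]; rewrite inE /= => m _.
  exact/(measurable_restrictT _ mD).2.
have mfD : measurable_fun setT (f \_ D) by exact/(measurable_restrictT _ mD).1.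
rewrite inE; apply/andP; split; rewrite inE//=.
rewrite /finite_norm unlock poweR_lty//.
have : mu.-integrable setT (EFin \o (fun x => (f \_ D) x ^+ 2)).
  by rewrite E -restrict_EFin; apply/(integrable_mkcond _ mD).
move=> /integrableP[_]; apply: le_lt_trans.
rewrite le_eqVlt; apply/orP; left; apply/eqP; apply: eq_integral => x _ /=.
by rewrite powR_mulrn// normrX.
Qed.

Lemma sqint_ae (f g : T -> R) : sqint mu D f -> measurable_fun D g ->
  {ae mu, forall x, D x -> f x = g x} -> sqint mu D g.
Proof.
move=> [mf i_f] mg fg; split=> //; apply/integrableP; split.
  by apply/measurable_EFinP; exact: measurable_funX.
move: i_f => /integrableP[_]; apply: le_lt_trans.
rewrite le_eqVlt; apply/orP; left; apply/eqP.
apply: ge0_ae_eq_integral => //.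
- by apply: measurableT_comp => //; apply/measurable_EFinP; exact: measurable_funX.
- by apply: measurableT_comp => //; apply/measurable_EFinP; exact: measurable_funX.
- by apply: (aeS fg) => x /[swap] Dx /(_ Dx) /= ->.
Qed.

Lemma ip_ae (v w w' : T -> R * R) : L2p mu D v -> L2p mu D w -> L2p mu D w' ->
  {ae mu, forall x, D x -> w x = w' x} -> ip mu D w v = ip mu D w' v.
Proof.
move=> Lv Lw Lw' ww'; rewrite /ip /Rintegral; congr fine.
have := ip_integrable mD Lv Lw; have := ip_integrable mD Lv Lw'.
move=> /integrableP[m1 _] /integrableP[m2 _].
apply: ae_eq_integral => //.
by apply: (aeS ww') => x h Dx; rewrite h.
Qed.

End LfunSquare.

Section TestFunctions.
Context {R : realType}.
Variables (Om : set (R * R)) (M : R).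
Hypotheses (oOm : open Om) (OmM : forall p, Om p -> `|p| <= M).
Implicit Types (phi psi : R * R -> R) (w : R * R -> R * R).

Definition gradf phi : R * R -> R * R := fun p => (dx phi p, dy phi p).
(** Rotated so that the pairing with w is the integral of w /\ d phi; closedness of w becomes
    orthogonality to these fields. *)
Definition rotg phi : R * R -> R * R := fun p => (dy phi p, - dx phi p).

Lemma plane_mOm : @measurable _ (plane R) Om. Proof. exact: plane_open_measurable. Qed.
Let mOm := plane_mOm.

Lemma area_Om : (area Om < +oo)%E.
Proof.
by apply: le_lt_trans (area_ball_fin M); apply: le_measure; rewrite ?inE//; exact: ball_measurable.
Qed.

Lemma test_near phi p : test_function Om phi -> ~ Om p -> \forall q \near p, phi q = 0.
Proof.
move=> [_ [K [cK KO phi0]]] Op.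
have oK : open (~` K) by apply: closed_openC; apply: compact_closed cK; exact: norm_hausdorff.
have : \forall q \near p, (~` K) q by apply: open_nbhs_nbhs; split => // /KO.
by apply: filterS => q; exact: phi0.
Qed.

(** A local condition at each point outside [Om] stands for compact support: it keeps the closure of
    the nonzero set inside [Om], and boundedness of [Om] makes this closure compact. *)
Lemma test_of_near phi : smooth_on setT phi ->
  (forall p, ~ Om p -> \forall q \near p, phi q = 0) -> test_function Om phi.
Proof.
move=> sphi H; split=> //; exists (closure [set p | phi p <> 0]).
have KO : closure [set p | phi p <> 0] `<=` Om.
  move=> p cp; apply: contrapT => Op; have [q [/= a b]] := cp _ (H p Op); exact: a b.
split=> //; last by move=> p h; apply: contrapT => n; apply: h; exact: subset_closure.
apply: (subclosed_compact _ (@compact_ball R M)); first exact: closed_closure.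
by move=> p /KO; exact: OmM.
Qed.

Lemma test_smooth phi : test_function Om phi -> smooth_on setT phi.
Proof. by case. Qed.

Lemma test_out phi p : test_function Om phi -> ~ Om p -> phi p = 0.
Proof. by move=> t Op; exact: nbhs_singleton (test_near t Op). Qed.

Lemma test_far phi p : test_function Om phi -> M < `|p| -> phi p = 0.
Proof. by move=> t Mp; apply: (test_out t) => /OmM; rewrite leNgt Mp. Qed.

Lemma test_grad_out phi p : test_function Om phi -> ~ Om p -> grad_at phi p 0 0.
Proof.
move=> t Op; apply: (@grad_at_near _ (fun=> 0)); last exact: grad_at_cst.
by apply: filterS (test_near t Op) => q ->.
Qed.

Lemma grad_lin (a : R) phi psi p : smooth_on setT phi -> smooth_on setT psi ->
  grad_at (fun q => a * phi q + psi q) p (a * dx phi p + dx psi p) (a * dy phi p + dy psi p).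
Proof.
move=> s1 s2; apply: grad_at_eq (grad_atD (grad_atM (grad_at_cst a p) (smooth_grad s1 (I : setT p)))
  (smooth_grad s2 (I : setT p))) _ _; ring.
Qed.

Lemma test_lin (a : R) phi psi : test_function Om phi -> test_function Om psi ->
  test_function Om (fun q => a * phi q + psi q).
Proof.
move=> t1 t2; apply: test_of_near.
  apply: smoothD; [exact: openT| |exact: test_smooth].
  by apply: smoothZ; [exact: openT|exact: test_smooth].
move=> p Op; apply: filterS2 (test_near t1 Op) (test_near t2 Op) => q -> ->.
by rewrite mulr0 addr0.
Qed.

Lemma test0 : test_function Om (fun=> 0).
Proof.
apply: test_of_near => [|p _]; first by apply: smooth_cst; exact: openT.
by apply: (@filterE _ (nbhs p)) => q.
Qed.

Lemma smooth_sqint phi : smooth_on setT phi -> sqint area Om phi.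
Proof.
move=> s; have [A A0 H] := smooth_bounded M s.
apply: (sqint_bounded mOm area_Om (A := A)) => [|p /OmM]; last exact: H.
by apply: measurable_funTS; exact: smooth_measurable.
Qed.

Lemma gradf_L2 phi : smooth_on setT phi -> L2p area Om (gradf phi).
Proof. by move=> s; split; apply: smooth_sqint; [exact: smooth_dx|exact: smooth_dy]. Qed.

Lemma rotg_L2 phi : smooth_on setT phi -> L2p area Om (rotg phi).
Proof.
move=> s; split; apply: smooth_sqint; first exact: smooth_dy.
rewrite (_ : (fun _ => _) = fun p => (-1) * dx phi p); last by apply/funext => p; rewrite /= mulN1r.
by apply: smoothZ; [exact: openT|exact: smooth_dx].
Qed.

Lemma gradf_lin (a : R) phi psi : smooth_on setT phi -> smooth_on setT psi ->
  gradf (fun q => a * phi q + psi q) = a *: gradf phi + gradf psi.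
Proof.
move=> s1 s2; apply/funext => p; have G := grad_lin a p s1 s2.
by rewrite /gradf (grad_at_dx G) (grad_at_dy G).
Qed.

Lemma rotg_lin (a : R) phi psi : smooth_on setT phi -> smooth_on setT psi ->
  rotg (fun q => a * phi q + psi q) = a *: rotg phi + rotg psi.
Proof.
move=> s1 s2; apply/funext => p; have G := grad_lin a p s1 s2.
rewrite /rotg (grad_at_dx G) (grad_at_dy G); congr pair; rewrite /= /GRing.scale /=; ring.
Qed.

Lemma gradf0 : gradf (fun=> 0) = 0.
Proof.
apply/funext => p; have G := grad_at_cst (0 : R) p.
by rewrite /gradf (grad_at_dx G) (grad_at_dy G).
Qed.

Lemma rotg0 : rotg (fun=> 0) = 0.
Proof.
apply/funext => p; have G := grad_at_cst (0 : R) p.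
by rewrite /rotg (grad_at_dx G) (grad_at_dy G) oppr0.
Qed.

Lemma closed_formE w : closed_form Om w <-> forall phi, test_function Om phi -> ip area Om w (rotg phi) = 0.
Proof.
have E phi : \int[area]_(p in Om) ((w p).1 * dy phi p - (w p).2 * dx phi p) = ip area Om w (rotg phi).
  by apply: eq_Rintegral => p _; rewrite /rotg /= mulrN.
by split=> H phi t; [rewrite -E|rewrite E]; exact: H.
Qed.

Lemma L2_formE w : L2_form Om w <-> L2p area Om w.
Proof. by split=> -[h1 h2]; split; apply/(Lfun_sqint _ mOm). Qed.

Lemma form_normE w : form_norm Om w = Num.sqrt (ip area Om w w).
Proof. by congr Num.sqrt; apply: eq_Rintegral => p _; rewrite !expr2. Qed.

(* int d(phi) /\ d(psi) = int d(phi d(psi)) = 0 *)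
Lemma exact_closed phi psi : test_function Om phi -> test_function Om psi ->
  ip area Om (gradf phi) (rotg psi) = 0.
Proof.
move=> t1 t2; have s1 := test_smooth t1; have s2 := test_smooth t2.
have sF := smoothM (@openT _) s1 (smooth_dy s2); have sG := smoothM (@openT _) s1 (smooth_dx s2).
have [ix ex] := int_dx0 (M := M) sF (fun p h => ltac:(by rewrite /= (test_far t1 h) mul0r)).
have [iy ey] := int_dy0 (M := M) sG (fun p h => ltac:(by rewrite /= (test_far t1 h) mul0r)).
have -> : ip area Om (gradf phi) (rotg psi) =
    \int[area]_p (dx phi p * dy psi p + dy phi p * - dx psi p).
  apply: Rintegral_support => p Op; have G := test_grad_out t1 Op.
  by rewrite /= (grad_at_dx G) (grad_at_dy G) !mul0r addr0.
have e0 := RintegralB measurableT ix iy; rewrite [X in X - _]ex [X in _ - X]ey subrr in e0.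
apply: etrans e0; apply: eq_Rintegral => p _.
have g1 := smooth_grad s1 (I : setT p).
rewrite (grad_at_dx (grad_atM g1 (smooth_grad (smooth_dy s2) (I : setT p)))).
rewrite (grad_at_dy (grad_atM g1 (smooth_grad (smooth_dx s2) (I : setT p)))).
rewrite (clairaut p s2); ring.
Qed.

End TestFunctions.

(** * Weyl's lemma and density of smooth closed forms *)

Section Weyl.
Context {R : realType}.
Variables (Om : set (R * R)) (M : R) (h : R * R -> R * R).
Hypotheses (oOm : open Om) (OmM : forall p, Om p -> `|p| <= M).
Hypothesis Lh : L2p area Om h.
Hypothesis h_coclosed : forall phi, test_function Om phi -> ip area Om h (gradf phi) = 0.
Hypothesis h_closed : forall phi, test_function Om phi -> ip area Om h (rotg phi) = 0.

Let mOm : @measurable _ (plane R) Om := plane_mOm oOm.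
Let fOm : (area Om < +oo)%E := area_Om oOm OmM.

Lemma far_near (c p : R * R) (r : R) : r < `|p - c| -> \forall q \near p, r < `|q - c|.
Proof.
move=> rp; apply/nbhs_normP; exists (`|p - c| - r); rewrite /= ?subr_gt0// => q /=.
rewrite ltrBrDl -ltrBrDr => /lt_le_trans; apply.
rewrite (_ : q - c = (p - c) - (p - q)); last by rewrite opprB [RHS]addrC addrA subrK.
exact: lerB_dist.
Qed.

Section TwoRadii.
Variables (c : R * R) (r r' : R).
Hypotheses (r0 : 0 < r) (r0' : 0 < r') (cO : forall q, `|q - c| <= Num.max r r' -> Om q).

Let phi1 p := molX r (p - c) - molX r' (p - c).
Let phi2 p := molY r (p - c) - molY r' (p - c).

Let out_far p : ~ Om p -> Num.max r r' < `|p - c|.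
Proof. by move=> Op; rewrite ltNge; apply/negP => /cO. Qed.

Let t1 : test_function Om phi1.
Proof.
apply: (test_of_near OmM).
  by apply: smoothB; [exact: openT|apply: smooth_shift; exact: smooth_molX..].
move=> p /out_far/far_near; apply: filterS => q /(molB_supp r0 r0')[e _]; exact: e.
Qed.

Let t2 : test_function Om phi2.
Proof.
apply: (test_of_near OmM).
  by apply: smoothB; [exact: openT|apply: smooth_shift; exact: smooth_molY..].
move=> p /out_far/far_near; apply: filterS => q /(molB_supp r0 r0')[_ e]; exact: e.
Qed.

Let g1 p : grad_at phi1 p (dx (molX r) (p - c) - dx (molX r') (p - c))
  (dy (molX r) (p - c) - dy (molX r') (p - c)).
Proof.
by apply: grad_atB; apply: grad_at_shift; apply: smooth_grad I; exact: smooth_molX.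
Qed.

Let g2 p : grad_at phi2 p (dx (molY r) (p - c) - dx (molY r') (p - c))
  (dy (molY r) (p - c) - dy (molY r') (p - c)).
Proof.
by apply: grad_atB; apply: grad_at_shift; apply: smooth_grad I; exact: smooth_molY.
Qed.

Let div12 p : dx phi1 p + dy phi2 p = mol r (p - c) - mol r' (p - c).
Proof. 
rewrite (grad_at_dx (g1 p)) (grad_at_dy (g2 p)) -(mol_div _ r0) -(mol_div _ r0').
move: (dx _ _) (dx _ _) (dy _ _) (dy _ _) => x x' y y'; ring.
 Qed.

Let curl12 p : dy phi1 p = dx phi2 p.
Proof. by rewrite (grad_at_dy (g1 p)) (grad_at_dx (g2 p)) !mol_curl. Qed.

Lemma mol_conv_integrable (f : R * R -> R) (s : R) : 0 < s -> sqint area Om f ->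
  area.-integrable Om (EFin \o (fun p => mol s (p - c) * f p)).
Proof.
move=> s0 /(sqint_integrable mOm fOm) i_f.
exact: (@kconv_integrable _ (plane R) R area Om id M f mOm (@measurable_id _ (plane R) Om) OmM i_f _ c (smooth_mol s0)).
Qed.

(** The difference of the two mollifiers is the divergence of the compactly supported curl-free
    field (phi1, phi2). Multiplied by the first component of h, it is the pairing of h with
    [gradf phi1] plus that with [rotg phi2], and both vanish. *)
Lemma conv_indep1 : \int[area]_(p in Om) (mol r (p - c) * (h p).1) =
  \int[area]_(p in Om) (mol r' (p - c) * (h p).1).
Proof.
have iG := ip_integrable mOm (gradf_L2 oOm OmM (test_smooth t1)) Lh.
have iR := ip_integrable mOm (rotg_L2 oOm OmM (test_smooth t2)) Lh.
have := RintegralD mOm iG iR.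
rewrite [X in _ = X + _](h_coclosed t1) [X in _ = _ + X](h_closed t2) addr0 => E.
apply/eqP; rewrite -subr_eq0 -RintegralB//; [|exact: mol_conv_integrable Lh.1..].
apply/eqP; rewrite -[RHS]E; apply: eq_Rintegral => p _.
rewrite /gradf /rotg /= curl12 -mulrBl -div12; ring.
Qed.

(** The combination [gradf phi2] - [rotg phi1] isolates the second component in the same way. *)
Lemma conv_indep2 : \int[area]_(p in Om) (mol r (p - c) * (h p).2) =
  \int[area]_(p in Om) (mol r' (p - c) * (h p).2).
Proof.
have iG := ip_integrable mOm (gradf_L2 oOm OmM (test_smooth t2)) Lh.
have iR := ip_integrable mOm (rotg_L2 oOm OmM (test_smooth t1)) Lh.
have := RintegralB mOm iG iR.
rewrite [X in _ = X - _](h_coclosed t2) [X in _ = _ - X](h_closed t1) subr0 => E.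
apply/eqP; rewrite -subr_eq0 -RintegralB//; [|exact: mol_conv_integrable Lh.2..].
apply/eqP; rewrite -[RHS]E; apply: eq_Rintegral => p _.
rewrite /gradf /rotg /= curl12 -mulrBl -div12; ring.
Qed.

End TwoRadii.

(** The value of g at c is the mollification of f, divided by kappa, at any radius that fits into
    [Om] around c. Near a given point one radius fits for all centres, whence smoothness; the mean
    value property then gives equality almost everywhere. *)
Lemma conv_smooth_version (f : R * R -> R) : sqint area Om f ->
  (forall c r r', 0 < r -> 0 < r' -> (forall q, `|q - c| <= Num.max r r' -> Om q) ->
    \int[area]_(p in Om) (mol r (p - c) * f p) = \int[area]_(p in Om) (mol r' (p - c) * f p)) ->
  exists2 g, smooth_on Om g & {ae area, forall p : R * R, Om p -> f p = g p}.
Proof.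
move=> sf indep.
have i_f := sqint_integrable mOm fOm sf.
have /choice[rr Hrr] : forall c : R * R, exists r : R, Om c -> 0 < r /\ forall q, `|q - c| <= r -> Om q.
  move=> c; have [Oc|nc] := pselect (Om c); last by exists 0.
  have /nbhs_normP[r /= r0 Hr] := open_nbhs_nbhs (conj oOm Oc).
  exists (r / 2) => _; split; first by rewrite divr_gt0.
  move=> q qc; apply: Hr; rewrite /= distrC; apply: le_lt_trans qc _.
  by rewrite ltr_pdivrMr// ltr_pMr// ltr1n.
have k0 := @kappa_gt0 R; have kn : kappa != 0 :> R by rewrite gt_eqF.
have [conv convE sconv] : exists2 conv : R -> R * R -> R,
    forall r c, conv r c = \int[area]_(p in Om) (mol r (p - c) * f p) &
    forall r, 0 < r -> smooth_on setT (conv r).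
  exists (fun r c => kconv area Om id f (mol r) c) => [//|r r0].
  exact: (@smooth_kconv _ (plane R) R area Om id M f mOm (@measurable_id _ (plane R) Om) OmM i_f _ (smooth_mol r0)).
pose g c := kappa^-1 * conv (rr c) c.
have gE c r : 0 < r -> (forall q, `|q - c| <= r -> Om q) -> g c = kappa^-1 * conv r c.
  move=> r0 Hr; congr (_ * _).
  have Oc : Om c by apply: Hr; rewrite subrr normr0 ltW.
  have [rr0 Hc] := Hrr c Oc; rewrite !convE; apply: indep => // q; rewrite le_max => /orP[/Hc//|/Hr//].
have sg : smooth_on Om g.
  move=> s c Oc; have [r0 Hr] := Hrr c Oc; set r := rr c in r0 Hr.
  pose U := [set q : R * R | `|c - q| < r / 2].
  have oU : open U.
    rewrite (_ : U = ball c (r / 2)); first exact: ball_open.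
    by rewrite -ball_normE.
  have r20 : 0 < r / 2 by rewrite divr_gt0.
  have : smooth_on U g.
    apply: (@smooth_ext _ _ (fun q => kappa^-1 * conv (r / 2) q)) => //.
      move=> q Uq; rewrite -gE// => q' q'q; apply: Hr.
      rewrite (_ : q' - c = (q' - q) - (c - q)); last by rewrite opprB addrA subrK.
      apply: le_trans (ler_normB _ _) _; rewrite [leRHS]splitr lerD// ltW//.
    apply: (@smooth_sub _ setT) => //; apply: smoothZ; [exact: openT|exact: sconv].
  by apply; rewrite /U /= subrr normr0.
exists g => //; apply: (mean_value_ae oOm OmM i_f).
  by move=> p Op; exact: smooth_continuous sg Op.
move=> c r r0 Hr; by rewrite (gE c r)// convE mulrA divff// mul1r.
Qed.

Lemma weyl : exists h', smooth_form Om h' /\ {ae area, forall p : R * R, Om p -> h p = h' p}.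
Proof.
have [g1 s1 e1] := conv_smooth_version Lh.1 (fun c r r' r0 r0' H => conv_indep1 r0 r0' H).
have [g2 s2 e2] := conv_smooth_version Lh.2 (fun c r r' r0 r0' H => conv_indep2 r0 r0' H).
exists (fun p => (g1 p, g2 p)); split=> //.
by apply: (aeS2 e1 e2) => p a1 a2 Op; rewrite [h p]surjective_pairing a1// a2.
Qed.

End Weyl.

Section SmoothDensity.
Context {R : realType}.
Variables (Om : set (R * R)) (M : R).
Hypotheses (oOm : open Om) (OmM : forall p, Om p -> `|p| <= M).

Let mOm : @measurable _ (plane R) Om := plane_mOm oOm.
Let fOm : (area Om < +oo)%E := area_Om oOm OmM.
Notation Lp := (L2p (area : {measure set (plane R) -> \bar R}) Om).
Notation ipO := (ip (area : {measure set (plane R) -> \bar R}) Om).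

Lemma plane_projection (S : set (R * R -> R * R)) v : S `<=` Lp -> S 0 ->
  (forall a u u', S u -> S u' -> S (a *: u + u')) -> Lp v ->
  exists h, [/\ Lp h, forall s, S s -> ipO h s = 0 &
    forall e, 0 < e -> exists2 s, S s & ipO (v - s - h) (v - s - h) < e].
Proof.
exact: (orthogonal_remainder (L2p_lin mOm) (ip_lin mOm) (ip_sym _ _) (ip_ge0 _ _) (ip_complete mOm fOm)).
Qed.

Lemma plane_cs u v : Lp u -> Lp v -> ipO u v ^+ 2 <= ipO u u * ipO v v.
Proof. exact: (cauchy_schwarz (L2p_lin mOm) (ip_lin mOm) (ip_sym _ _) (ip_ge0 _ _)). Qed.

Lemma Lp_sub u v : Lp u -> Lp v -> Lp (u - v).
Proof. exact: (E_sub (L2p_lin mOm)). Qed.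

Lemma plane_ipB u v w : Lp u -> Lp v -> Lp w -> ipO (u - v) w = ipO u w - ipO v w.
Proof. exact: (ip_subl (ip_lin mOm)). Qed.

Lemma plane_ip_linr (a : R) u v w : Lp u -> Lp v -> Lp w ->
  ipO w (a *: u + v) = a * ipO w u + ipO w v.
Proof. exact: (ip_linr (ip_lin mOm) (ip_sym _ _)). Qed.

Lemma smooth_on_measurable f : smooth_on Om f -> measurable_fun Om (f : plane R -> R).
Proof.
by move=> sf; apply: (plane_continuous_measurable oOm) => p Op; exact: smooth_continuous sf Op.
Qed.

(** Projecting w off the exact forms [gradf phi] leaves a remainder h that is coclosed by
    construction and closed as a limit of closed forms, hence smooth after a change on a null set.
    The rest of w is approximated by some [gradf phi], which is smooth anyway. *)
Lemma smooth_closed_dense w : L2c Om w -> forall e, 0 < e ->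
  exists s, [/\ L2c Om s, smooth_form Om s & form_norm Om (s - w) < e].
Proof.
move=> [/(L2_formE oOm) Lw /(closed_formE) cw] e e0.
pose S := [set u | exists2 phi, test_function Om phi & u = gradf phi].
have SE : S `<=` Lp by move=> _ [phi t ->]; apply: (gradf_L2 oOm OmM); exact: test_smooth t.
have S0 : S 0 by exists (fun=> 0); [exact: test0 OmM|rewrite gradf0].
have Slin a u u' : S u -> S u' -> S (a *: u + u').
  move=> [phi t ->] [psi t' ->]; exists (fun q => a * phi q + psi q); first exact: (test_lin OmM a t t').
  by rewrite (gradf_lin a (test_smooth t) (test_smooth t')).
have [h [Lh horth happ]] := plane_projection SE S0 Slin Lw.
have h1 phi : test_function Om phi -> ipO h (gradf phi) = 0 by move=> t; apply: horth; exists phi.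
(* The remainder is an L^2 limit of the forms w - [gradf phi], whose two terms are both orthogonal
   to [rotg psi]; Cauchy-Schwarz passes to the limit. *)
have h2 psi : test_function Om psi -> ipO h (rotg psi) = 0.
  move=> t; apply/eqP; rewrite -sqrf_eq0 eq_le sqr_ge0 andbT; apply/ler_addgt0Pl => d d0; rewrite addr0.
  have Lr : Lp (rotg psi) by apply: (rotg_L2 oOm OmM); exact: test_smooth t.
  have C0 : 0 < ipO (rotg psi) (rotg psi) + 1 by rewrite ltr_wpDl ?ip_ge0.
  have dC : 0 < d / (ipO (rotg psi) (rotg psi) + 1) by rewrite divr_gt0.
  have [_ [phi t' ->] Hs] := happ _ dC.
  have Lg : Lp (gradf phi) by apply: (gradf_L2 oOm OmM); exact: test_smooth t'.
  have Lwg := Lp_sub Lw Lg; have Lx := Lp_sub Lwg Lh.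
  have cs := plane_cs Lx Lr.
  have E1 : ipO (w - gradf phi - h) (rotg psi) = - ipO h (rotg psi).
    rewrite plane_ipB// plane_ipB//.
    by rewrite (cw _ t) (exact_closed OmM t' t) subr0 sub0r.
  rewrite E1 sqrrN in cs; apply: le_trans cs _.
  apply: (@le_trans _ _ (d / (ipO (rotg psi) (rotg psi) + 1) * ipO (rotg psi) (rotg psi))).
    by rewrite ler_wpM2r ?ip_ge0// ltW.
  rewrite mulrAC ler_pdivrMr// ler_wpM2l ?(ltW d0)// lerDl ler01//.
have [h' [[s1 s2] hh']] := weyl oOm OmM Lh h1 h2.
have m1 := smooth_on_measurable s1; have m2 := smooth_on_measurable s2.
have Lh' : Lp h'.
  split.
    by apply: (sqint_ae mOm Lh.1 m1); apply: (aeS hh') => p H Op; rewrite H.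
  by apply: (sqint_ae mOm Lh.2 m2); apply: (aeS hh') => p H Op; rewrite H.
have e20 : 0 < e ^+ 2 by rewrite exprn_gt0.
have [_ [phi t ->] Hs] := happ _ e20.
have Lg : Lp (gradf phi) by apply: (gradf_L2 oOm OmM); exact: test_smooth t.
have lin1 u v : 1 *: u + v = u + v :> (R * R -> R * R) by rewrite scale1r.
have Ls : Lp (h' + gradf phi) by rewrite -lin1; exact: (L2p_lin mOm).
exists (h' + gradf phi); split.
- split; first exact/(L2_formE oOm).
  apply/closed_formE => psi t'.
  have Lr : Lp (rotg psi) by apply: (rotg_L2 oOm OmM); exact: test_smooth t'.
  rewrite -lin1 (ip_lin mOm)// (exact_closed OmM t t') addr0 mul1r.
  rewrite -(ip_ae mOm Lr Lh Lh' hh'); exact: h2.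
- have sx := smooth_sub (@subsetT _ Om) (smooth_dx (test_smooth t)).
  have sy := smooth_sub (@subsetT _ Om) (smooth_dy (test_smooth t)).
  by split; apply: smoothD.
- have Lhg : Lp (h + gradf phi) by rewrite -lin1; exact: (L2p_lin mOm).
  have La := Lp_sub Ls Lw; have Lb := Lp_sub Lhg Lw.
  have ab : {ae area, forall p : R * R, Om p -> (h' + gradf phi - w) p = (h + gradf phi - w) p}.
    by apply: (aeS hh') => p H Op; rewrite !fctE H.
  (* [ip_ae] changes the first argument only, so it is used twice, with a swap in between. *)
  rewrite form_normE (ip_ae mOm La La Lb ab) ip_sym (ip_ae mOm Lb La Lb ab).
  rewrite -(ger0_norm (ltW e0)) -sqrtr_sqr ltr_sqrt//.
  apply: le_lt_trans Hs; rewrite le_eqVlt; apply/orP; left; apply/eqP.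
  apply: eq_Rintegral => p _; rewrite !fctE /=; ring.
Qed.

End SmoothDensity.

(** * Periods as pairings with coexact forms *)

Section Loop.
Context {R : realType}.
Variables (Om : set (R * R)) (M : R) (g : R -> R * R).
Hypotheses (OmM : forall p, Om p -> `|p| <= M).
Hypotheses (sg : smooth_loop g) (gO : forall t, Om (g t)).
Notation leb := (@lebesgue_measure R).
Notation I01 := (`[0, 1]%classic : set (measurableTypeR R)).
Notation d1 := (derive1 (fun s => (g s).1)).
Notation d2 := (derive1 (fun s => (g s).2)).
Implicit Types (K : R * R -> R) (c p q : R * R).

Lemma derive1n_regular (f : R -> R) : (forall n (t : R), derivable (derive1n n f) t 1) ->
  (forall t : R, is_derive t 1 f (derive1 f t)) /\ continuous (derive1 f).
Proof.
move=> H; split=> t; first by split; [exact: H 0%N t|rewrite derive1E].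
by have := H 1%N t; rewrite derive1n1 => /derivable1_diffP; exact: differentiable_continuous.
Qed.

Let Dg1 : (forall t : R, is_derive t 1 (fun s => (g s).1) (d1 t)) /\ continuous d1.
Proof. by have [_ h _] := sg; exact: derive1n_regular. Qed.
Let Dg2 : (forall t : R, is_derive t 1 (fun s => (g s).2) (d2 t)) /\ continuous d2.
Proof. by have [_ _ h] := sg; exact: derive1n_regular. Qed.

Lemma loop_continuous : continuous g.
Proof.
move=> t; have c1 := is_derive_continuous (Dg1.1 t); have c2 := is_derive_continuous (Dg2.1 t).
have H : ((g x).1, (g x).2) @[x --> t] --> (nbhs (g t).1, nbhs (g t).2) by apply: cvg_pair.
rewrite /continuous_at; under eq_cvg do rewrite [g _]surjective_pairing.
by rewrite [g t]surjective_pairing.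
Qed.

Lemma loop_measurable (D : set (measurableTypeR R)) : measurable_fun D (g : _ -> plane R).
Proof.
apply: measurable_funTS; rewrite (_ : g = fun s => ((g s).1, (g s).2)); last first.
  by apply/funext => s; case: (g s).
apply: measurable_fun_pair.
  by apply: continuous_measurable_fun => t; exact: is_derive_continuous (Dg1.1 t).
by apply: continuous_measurable_fun => t; exact: is_derive_continuous (Dg2.1 t).
Qed.

Lemma unit_integrable (f : R -> R) : continuous f -> leb.-integrable I01 (EFin \o f).
Proof.
move=> cf; apply: continuous_compact_integrable; first exact: segment_compact.
exact: continuous_subspaceT.
Qed.

Let mI : measurable I01 := measurable_itv _.
Let id1 : leb.-integrable I01 (EFin \o d1) := unit_integrable Dg1.2.
Let id2 : leb.-integrable I01 (EFin \o d2) := unit_integrable Dg2.2.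
Let gM t : I01 t -> `|g t| <= M. Proof. by move=> _; exact: OmM. Qed.

(** With k a component of the velocity of g, this integrates K(z - c) dx or K(z - c) dy along the
    curve. *)
Definition loop_conv (k : R -> R) K c : R := kconv leb I01 g k K c.

Lemma loop_conv_integrable (k : R -> R) K c : leb.-integrable I01 (EFin \o k) -> smooth_on setT K ->
  leb.-integrable I01 (EFin \o (fun t => K (g t - c) * k t)).
Proof. by move=> ik; exact: (@kconv_integrable _ _ R leb I01 g M _ mI (@loop_measurable _) gM ik). Qed.

Lemma smooth_loop_conv (k : R -> R) K : leb.-integrable I01 (EFin \o k) -> smooth_on setT K ->
  smooth_on setT (loop_conv k K).
Proof. by move=> ik; exact: (@smooth_kconv _ _ R leb I01 g M _ mI (@loop_measurable _) gM ik). Qed.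

Lemma grad_loop_conv (k : R -> R) K c : leb.-integrable I01 (EFin \o k) -> smooth_on setT K ->
  grad_at (loop_conv k K) c (- loop_conv k (dx K) c) (- loop_conv k (dy K) c).
Proof. by move=> ik; exact: (@grad_kconv _ _ R leb I01 g M _ mI (@loop_measurable _) gM ik). Qed.

Lemma loop_conv_mol (k : R -> R) (r : R) c : leb.-integrable I01 (EFin \o k) -> 0 < r ->
  loop_conv k (mol r) c = loop_conv k (dx (molX r)) c + loop_conv k (dy (molY r)) c.
Proof.
move=> ik r0; rewrite /loop_conv /kconv -RintegralD//; last 2 first.
  exact: loop_conv_integrable ik (smooth_dx (smooth_molX r0)).
  exact: loop_conv_integrable ik (smooth_dy (smooth_molY r0)).
by apply: eq_Rintegral => t _; rewrite -mulrDl mol_div.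
Qed.

(* The integral of d(K(. - c)) along the closed curve g *)
Lemma loop_exact K c : smooth_on setT K -> loop_conv d1 (dx K) c + loop_conv d2 (dy K) c = 0.
Proof.
move=> sK; have sx := smooth_dx sK; have sy := smooth_dy sK.
pose F t := K (g t - c); pose f t := dx K (g t - c) * d1 t + dy K (g t - c) * d2 t.
have DF (t : R) : is_derive t 1 F (f t).
  have G := grad_at_shift (smooth_grad sK (I : setT (g t - c))).
  rewrite [g t]surjective_pairing in G.
  have := grad_at_path G (Dg1.1 t) (Dg2.1 t).
  under eq_fun do rewrite -surjective_pairing.
  rewrite -surjective_pairing => H; apply: is_derive_eq H _.
  by rewrite /f mulrC [X in _ + X]mulrC.
have cK k t : smooth_on setT k -> {for t, continuous (fun t => k (g t - c))}.
  move=> sk; apply: (@continuous_comp _ _ _ g (fun p => k (p - c))); first exact: loop_continuous.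
  exact: smooth_continuousT (smooth_shift c sk).
have cf : continuous f.
  move=> t; apply: cvgD; apply: cvgM; [exact: cK|exact: Dg1.2|exact: cK|exact: Dg2.2].
rewrite /loop_conv /kconv -RintegralD//;
  [|exact: loop_conv_integrable id1 _|exact: loop_conv_integrable id2 _].
rewrite /Rintegral (@continuous_FTC2 _ f F 0 1)//.
- have [per _ _] := sg; rewrite /F -(per 0) add0r; apply/eqP.
  by rewrite -EFinB subrr.
- exact: continuous_subspaceT.
- split.
  + by move=> t _; have [] := DF t.
  + by apply: cvg_at_right_filter; exact: is_derive_continuous (DF 0).
  + by apply: cvg_at_left_filter; exact: is_derive_continuous (DF 1).
- by move=> t _; rewrite derive1E; have [_ ->] := DF t.
Qed.

(* Smoothing of c |-> \int_g darg(z - c), which is 2 pi times the winding number. *)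
Definition loop_potential (r : R) c : R := loop_conv d2 (molX r) c - loop_conv d1 (molY r) c.

Lemma smooth_loop_potential r : 0 < r -> smooth_on setT (loop_potential r).
Proof.
move=> r0; apply: smoothB; first exact: openT.
  exact: smooth_loop_conv id2 (smooth_molX r0).
exact: smooth_loop_conv id1 (smooth_molY r0).
Qed.

(** Exactness of d[molY] along the closed curve trades the derivative of [molY] in x against dx for
    the one in y against dy, which completes the divergence [mol r]; likewise for [molX]. The
    rotated gradient is thus the tangent of the curve, mollified at scale r. *)
Lemma grad_loop_potential r c : 0 < r ->
  grad_at (loop_potential r) c (- loop_conv d2 (mol r) c) (loop_conv d1 (mol r) c).
Proof.
move=> r0; have sX := smooth_molX r0; have sY := smooth_molY r0.
apply: grad_at_eq (grad_atB (grad_loop_conv c id2 sX) (grad_loop_conv c id1 sY)) _ _.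
  have := loop_exact c sY; rewrite (loop_conv_mol c id2 r0).
  by move: (loop_conv _ _ _) (loop_conv _ _ _) (loop_conv _ _ _) => x y z; lra.
have := loop_exact c sX; rewrite (loop_conv_mol c id1 r0).
by move: (loop_conv _ _ _) (loop_conv _ _ _) (loop_conv _ _ _) => x y z; lra.
Qed.

Lemma grad_loop_potential_far r c : 0 < r -> (forall t, I01 t -> r < `|g t - c|) ->
  grad_at (loop_potential r) c 0 0.
Proof.
move=> r0 far; have := grad_loop_potential c r0.
rewrite /loop_conv /kconv.
have E (k : R -> R) : \int[leb]_(t in I01) (mol r (g t - c) * k t) = 0.
  rewrite (_ : Rintegral _ _ _ = \int[leb]_(t in I01) (fun=> 0) t); first by rewrite /Rintegral integral0.
  by apply: eq_Rintegral => t; rewrite inE => It; rewrite mol_supp ?mul0r//; exact: far.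
by rewrite !E oppr0.
Qed.

(** Beyond distance r the kernel is exactly p / |p|^2, so the integrand is that of d arg. *)
Lemma loop_potential_winding r c : 0 < r -> (forall t, I01 t -> r < `|g t - c|) ->
  loop_potential r c = 2 * pi * winding_number g c.
Proof.
move=> r0 far; rewrite /winding_number mulrC divfK ?gt_eqF ?mulr_gt0 ?pi_gt0//.
rewrite /loop_potential /loop_conv /kconv -RintegralB//; last 2 first.
  exact: loop_conv_integrable id2 (smooth_molX r0).
  exact: loop_conv_integrable id1 (smooth_molY r0).
apply: eq_Rintegral => t; rewrite inE => /far ft; rewrite /molX /molY /kerX /kerY radial_far//.
rewrite /darg /= -/(nrm2 (g t - c)); move: (nrm2 _)^-1 => N; ring.
Qed.

End Loop.

Section LoopPairing.
Context {R : realType}.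
Variables (Om : set (R * R)) (M : R) (g : R -> R * R).
Hypotheses (oOm : open Om) (OmM : forall p, Om p -> `|p| <= M).
Hypotheses (sg : smooth_loop g) (gO : forall t, Om (g t)).
Notation leb := (@lebesgue_measure R).
Notation I01 := (`[0, 1]%classic : set (measurableTypeR R)).
Notation d1 := (derive1 (fun s => (g s).1)).
Notation d2 := (derive1 (fun s => (g s).2)).
Notation ipO := (ip (area : {measure set (plane R) -> \bar R}) Om).
Let mOm : @measurable _ (plane R) Om := plane_mOm oOm.
Let fOm : (area Om < +oo)%E := area_Om oOm OmM.
Let mI : measurable I01 := measurable_itv _.
Let gM t : I01 t -> `|g t| <= M. Proof. by move=> _; exact: OmM. Qed.

(** Compactness of [0, 1] makes the radius uniform, like a Lebesgue number. The hypothesis allows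
    two points q, q' near g t because the base point moves along the curve as well. *)
Lemma near_loop (P : R * R -> R * R -> Prop) :
  (forall t, exists2 d : R, 0 < d & forall q q', `|g t - q| < d -> `|g t - q'| < d -> P q q') ->
  \forall r \near 0^'+, forall t, I01 t -> forall q, `|g t - q| <= r -> P (g t) q.
Proof.
move=> H; have /compact_near_coveringP cI := @segment_compact R 0 1.
apply: (cI R 0^'+ (fun r t => forall q, `|g t - q| <= r -> P (g t) q)) => t _.
have [d d0 Hd] := H t; have d20 : 0 < d / 2 by rewrite divr_gt0.
have dd : d / 2 < d by rewrite ltr_pdivrMr// ltr_pMr// ltr1n.
have gd : \forall s \near t, `|g t - g s| < d / 2.
  by have /cvgrPdist_lt/(_ _ d20) := @loop_continuous _ _ sg t.
exists ([set s | `|g t - g s| < d / 2], [set r | r < d / 2]) => /=.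
  by split=> //; exact: nbhs_right_lt.
move=> [s r] /= [h1 h2] q h3; apply: Hd; first exact: lt_trans dd.
rewrite (_ : g t - q = (g t - g s) + (g s - q)); last by rewrite addrA subrK.
by apply: le_lt_trans (ler_normD _ _) _; rewrite [d]splitr ltrD// (le_lt_trans h3).
Qed.

Lemma loop_tube : \forall r \near 0^'+, forall t, I01 t -> forall q, `|g t - q| <= r -> Om q.
Proof.
apply: (@near_loop (fun _ q => Om q)) => t.
have /nbhs_normP[d d0 Hd] := open_nbhs_nbhs (conj oOm (gO t)).
by exists d => // _ q _; exact: Hd.
Qed.

Lemma loop_uniform (f : R * R -> R) (e : R) : (forall p, Om p -> {for p, continuous f}) -> 0 < e ->
  \forall r \near 0^'+, forall t, I01 t -> forall q, `|g t - q| <= r -> `|f q - f (g t)| <= e.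
Proof.
move=> cf e0; apply: (@near_loop (fun q q' => `|f q' - f q| <= e)) => t.
have e20 : 0 < e / 2 by rewrite divr_gt0.
have /cvgrPdist_lt/(_ _ e20)/nbhs_normP[d d0 Hd] := cf _ (gO t).
exists d => // q q' /Hd/= h /Hd/= h'.
rewrite (_ : f q' - f q = (f (g t) - f q) - (f (g t) - f q')); last by rewrite opprB [RHS]addrC subrKA.
by apply: le_trans (ler_normB _ _) _; rewrite [e]splitr lerD// ltW.
Qed.

(** Moving the centre by less than rho - r keeps it at distance more than r from the curve, where
    the gradient vanishes. *)
Lemma loop_potential_near (r rho : R) c : 0 < r -> r < rho -> (forall t, I01 t -> rho < `|g t - c|) ->
  \forall q \near c, loop_potential g r q = 2 * pi * winding_number g c.
Proof.
move=> r0 rrho far; apply/nbhs_normP; exists (rho - r); rewrite /= ?subr_gt0// => q.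
rewrite /= distrC => qc.
have farq p : `|p - c| < rho - r -> forall t, I01 t -> r < `|g t - p|.
  move=> pc t /far ft.
  rewrite (_ : g t - p = (g t - c) - (p - c)); last by rewrite opprB addrA subrK.
  apply: lt_le_trans (lerB_dist _ _); move: ft pc; lra.
rewrite (grad0_cst_ball (f := loop_potential g r) (p := c) (r := rho - r)) //.
  apply: (loop_potential_winding OmM sg gO) => //.
  by apply: farq; rewrite subrr normr0 subr_gt0.
by move=> p pc; apply: (grad_loop_potential_far OmM sg gO) => //; exact: farq.
Qed.

(** Near a point outside [Om] both potentials equal 2 pi times the winding number there, whatever
    the radius. *)
Lemma loop_potential_test (r r' rho : R) : 0 < r -> r < rho -> 0 < r' -> r' < rho ->
  (forall t, I01 t -> forall q, `|g t - q| <= rho -> Om q) ->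
  test_function Om (fun q => (-1) * loop_potential g r' q + loop_potential g r q).
Proof.
move=> r0 rrho r0' rrho' tube.
have s := smooth_loop_potential OmM sg gO r0; have s' := smooth_loop_potential OmM sg gO r0'.
apply: (test_of_near OmM).
  by apply: smoothD => //; [exact: openT|apply: smoothZ => //; exact: openT].
move=> c Oc.
have far t : I01 t -> rho < `|g t - c| by move=> It; rewrite ltNge; apply/negP => /(tube _ It).
apply: filterS2 (loop_potential_near r0 rrho far) (loop_potential_near r0' rrho' far) => q -> ->.
by rewrite mulN1r addNr.
Qed.

Lemma loop_pairing_indep w (r r' rho : R) : L2c Om w -> 0 < r -> r < rho -> 0 < r' -> r' < rho ->
  (forall t, I01 t -> forall q, `|g t - q| <= rho -> Om q) ->
  ipO w (rotg (loop_potential g r)) = ipO w (rotg (loop_potential g r')).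
Proof.
move=> [/(L2_formE oOm) Lw /closed_formE cw] r0 rrho r0' rrho' tube.
have s := smooth_loop_potential OmM sg gO r0; have s' := smooth_loop_potential OmM sg gO r0'.
have := cw _ (loop_potential_test r0 rrho r0' rrho' tube).
rewrite (rotg_lin (-1) s' s) (plane_ip_linr oOm (-1) (rotg_L2 oOm OmM s') (rotg_L2 oOm OmM s) Lw).
by move=> /eqP; rewrite mulN1r addrC subr_eq0 => /eqP.
Qed.

Lemma mol_average (f : R * R -> R) (r e : R) c : sqint area Om f -> 0 < r ->
  (forall q, `|c - q| <= r -> Om q) -> (forall q, `|c - q| <= r -> `|f q - f c| <= e) ->
  `|\int[area]_(p in Om) (mol r (p - c) * f p) - kappa * f c| <= kappa * e.
Proof.
move=> sf r0 cO fe.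
have i1 := mol_conv_integrable oOm OmM c r0 sf.
have im (a : R) : area.-integrable Om (EFin \o (fun p : plane R => mol r (p - c) * a)).
  apply: (mol_conv_integrable oOm OmM c r0); exact: (sqint_cst mOm fOm).
have mass (a : R) : \int[area]_(p in Om) (mol r (p - c) * a) = kappa * a.
  have i0 := im 1.
  transitivity (\int[area]_(p in Om) (a * (mol r (p - c) * 1))).
    by apply: eq_Rintegral => p _; rewrite mulr1 mulrC.
  rewrite RintegralZl// mulrC; congr (_ * _).
  rewrite -(mol_mass c r0) -(@Rintegral_support _ _ _ area Om); last first.
    move=> p Op; apply: mol_supp => //; rewrite ltNge distrC; apply/negP => /cO; exact: Op.
  by apply: eq_Rintegral => p _; rewrite mulr1.
rewrite -(mass (f c)) -(RintegralB mOm i1 (im (f c))).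
have ib := integrable_EFinB mOm i1 (im (f c)).
apply: le_trans (le_normr_Rintegral mOm ib) _.
rewrite -(mass e); apply: le_Rintegral => //; first exact: integrable_norm.
move=> p Op; rewrite -mulrBr normrM ger0_norm ?mol_ge0//.
have [pr|pr] := leP `|c - p| r; first by rewrite ler_wpM2l ?mol_ge0// fe.
by rewrite mol_supp ?mul0r// distrC.
Qed.

(** Fubini moves the integral along the curve to the outside; the inner integral is then kappa times
    an average of f over points close to g t, where f differs from f (g t) by at most e. *)
Lemma loop_average (f : R * R -> R) (k : R -> R) (r e : R) :
  sqint area Om f -> (forall p, Om p -> {for p, continuous f}) -> continuous k -> 0 < r ->
  (forall t, I01 t -> forall q, `|g t - q| <= r -> Om q) ->
  (forall t, I01 t -> forall q, `|g t - q| <= r -> `|f q - f (g t)| <= e) ->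
  `|\int[area]_(p in Om) (f p * kconv leb I01 g k (mol r) p)
    - kappa * \int[leb]_(t in I01) (f (g t) * k t)| <= kappa * e * \int[leb]_(t in I01) `|k t|.
Proof.
move=> sf cf ck r0 tube fe.
have ik : leb.-integrable I01 (EFin \o k) := unit_integrable ck.
have i_f := sqint_integrable mOm fOm sf.
have -> : \int[area]_(p in Om) (f p * kconv leb I01 g k (mol r) p) =
    \int[leb]_(t in I01) (k t * kconv area Om id f (mol r) (g t)).
  rewrite (kernel_fubini mI mOm (@loop_measurable _ _ sg setT) gM OmM ik i_f (smooth_mol r0)).
  have E p : kconv leb I01 g k (mol r) p = \int[leb]_(t in I01) (mol r (p - g t) * k t).
    by apply: eq_Rintegral => t _; rewrite -(molN r (p - g t)) opprB.
  by apply: eq_Rintegral => p _; rewrite E.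
have i1 : leb.-integrable I01 (EFin \o (fun t => k t * kconv area Om id f (mol r) (g t))).
  have sc := @smooth_kconv _ (plane R) R area Om id M f mOm (@measurable_id _ (plane R) Om) OmM i_f _ (smooth_mol r0).
  have [A A0 HA] := smooth_bounded M sc.
  have : leb.-integrable I01 (EFin \o (fun t => kconv area Om id f (mol r) (g t) * k t)).
    apply: (@integrable_mul_bounded _ _ _ leb I01 k mI ik _ A) => [|t It]; last exact/HA/gM.
    exact: (measurableT_comp (smooth_measurable sc) (@loop_measurable _ _ sg _)).
  by apply: eq_integrable => // t _; rewrite /= mulrC.
have i2 : leb.-integrable I01 (EFin \o (fun t => f (g t) * k t)).
  apply: unit_integrable => t; apply: cvgM; last exact: ck.
  apply: (@continuous_comp _ _ _ g f); first exact: loop_continuous.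
  exact: cf.
rewrite -RintegralZl//.
have i2' := integrable_EFinZ kappa mI i2.
rewrite -RintegralB//; have ib := integrable_EFinB mI i1 i2'.
have ink : leb.-integrable I01 (EFin \o (fun t => `|k t|)) by exact: integrable_norm.
apply: le_trans (le_normr_Rintegral mI ib) _.
rewrite -RintegralZl//; apply: le_Rintegral => //; first exact: integrable_norm.
  exact: integrable_EFinZ.
move=> t It.
rewrite (_ : _ - _ = (kconv area Om id f (mol r) (g t) - kappa * f (g t)) * k t); last first.
  by move: (kconv _ _ _ _ _ _) => u; ring.
rewrite normrM ler_wpM2r//; apply: mol_average => //; [exact: tube|exact: fe].
Qed.

(** The pairing does not depend on the radius, whereas for small radii it is as close as desired to
    kappa times the line integral; so the two coincide. *)
Lemma loop_line_integral w (r rho : R) : L2c Om w -> smooth_form Om w -> 0 < r -> r < rho ->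
  (forall t, I01 t -> forall q, `|g t - q| <= rho -> Om q) ->
  ipO w (rotg (loop_potential g r)) = kappa * line_integral g w.
Proof.
move=> Lw [s1 s2] r0 rrho tube.
have [h1 h2 h3] := sg; have [_ c1] := derive1n_regular h2; have [_ c2] := derive1n_regular h3.
have [[Lw1 Lw2] _] : L2p area Om w /\ True by split=> //; apply/(L2_formE oOm); case: Lw.
have cf1 p : Om p -> {for p, continuous (fun p => (w p).1)} by exact: smooth_continuous s1.
have cf2 p : Om p -> {for p, continuous (fun p => (w p).2)} by exact: smooth_continuous s2.
pose I1 := \int[leb]_(t in I01) `|d1 t|; pose I2 := \int[leb]_(t in I01) `|d2 t|.
have I10 : 0 <= I1 by apply: Rintegral_ge0 => t _; exact: normr_ge0.
have I20 : 0 <= I2 by apply: Rintegral_ge0 => t _; exact: normr_ge0.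
have k0 := @kappa_gt0 R.
have C0 : 0 < kappa * (I1 + I2) + 1.
  exact: (ltr_wpDl (mulr_ge0 (ltW k0) (addr_ge0 I10 I20)) ltr01).
apply/eqP; rewrite -subr_eq0 -normr_eq0 eq_le normr_ge0 andbT.
apply/ler_addgt0Pl => e e0; rewrite addr0.
have [e' e0' ee] : exists2 e', 0 < e' & kappa * (I1 + I2) * e' <= e.
  exists (e / (kappa * (I1 + I2) + 1)); first by rewrite divr_gt0.
  by rewrite mulrA ler_pdivrMr// mulrC ler_wpM2l ?(ltW e0)// lerDl ler01.
have rho0 := lt_trans r0 rrho.
near (0 : R)^'+ => r'.
have r0' : 0 < r' by near: r'; exact: nbhs_right_gt.
have rrho' : r' < rho by near: r'; exact: nbhs_right_lt.
have tube' t : I01 t -> forall q, `|g t - q| <= r' -> Om q.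
  by move=> It q h; apply: (tube _ It); apply: le_trans h _; exact: ltW.
have u1 : forall t, I01 t -> forall q, `|g t - q| <= r' -> `|(w q).1 - (w (g t)).1| <= e'.
  by near: r'; exact: (loop_uniform (f := fun p => (w p).1)).
have u2 : forall t, I01 t -> forall q, `|g t - q| <= r' -> `|(w q).2 - (w (g t)).2| <= e'.
  by near: r'; exact: (loop_uniform (f := fun p => (w p).2)).
have a1 := loop_average Lw1 cf1 c1 r0' tube' u1.
have a2 := loop_average Lw2 cf2 c2 r0' tube' u2.
rewrite (loop_pairing_indep Lw r0 rrho r0' rrho' tube).
have -> : ipO w (rotg (loop_potential g r')) =
    \int[area]_(p in Om) ((w p).1 * kconv leb I01 g d1 (mol r') p) +
    \int[area]_(p in Om) ((w p).2 * kconv leb I01 g d2 (mol r') p).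
  have ic (f : R * R -> R) (k : R -> R) : sqint area Om f -> continuous k ->
      area.-integrable Om (EFin \o (fun p : plane R => f p * kconv leb I01 g k (mol r') p)).
    move=> sf ck; have i_f := sqint_integrable mOm fOm sf.
    have sc := @smooth_kconv _ _ R leb I01 g M _ mI (@loop_measurable _ _ sg _) gM (unit_integrable ck) _ (smooth_mol r0').
    have [A A0 HA] := smooth_bounded M sc.
    have : area.-integrable Om (EFin \o (fun p : plane R => kconv leb I01 g k (mol r') p * f p)).
      apply: (@integrable_mul_bounded _ (plane R) _ area Om f mOm i_f _ A) => [|p Op]; last exact/HA/OmM.
      by apply: measurable_funTS; exact: smooth_measurable.
    by apply: eq_integrable => // p _; rewrite /= mulrC.
  have j1 := ic _ _ Lw1 c1; have j2 := ic _ _ Lw2 c2.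
  rewrite -(RintegralD mOm j1 j2); apply: eq_Rintegral => p _.
  have G := grad_loop_potential OmM sg gO p r0'.
  by rewrite /rotg /= (grad_at_dx G) (grad_at_dy G) opprK.
have -> : line_integral g w = \int[leb]_(t in I01) ((w (g t)).1 * d1 t) +
    \int[leb]_(t in I01) ((w (g t)).2 * d2 t).
  have ic (f : R * R -> R) (k : R -> R) : (forall p, Om p -> {for p, continuous f}) -> continuous k ->
      leb.-integrable I01 (EFin \o (fun t => f (g t) * k t)).
    move=> cf ck; apply: unit_integrable => t; apply: cvgM; last exact: ck.
    apply: (@continuous_comp _ _ _ g f); first exact: loop_continuous.
    exact: cf.
  have j1 := ic _ _ cf1 c1; have j2 := ic _ _ cf2 c2.
  by rewrite -(RintegralD mI j1 j2).
rewrite -/I1 in a1; rewrite -/I2 in a2.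
rewrite mulrDr opprD addrACA; apply: le_trans (ler_normD _ _) _.
apply: le_trans (lerD a1 a2) _; apply: le_trans ee; rewrite le_eqVlt; apply/orP; left; apply/eqP.
by rewrite -mulrDr mulrAC.
Unshelve. all: by end_near. Qed.

End LoopPairing.

(** * The loop potential outside the unit disc *)

Section LoopOutside.
Context {R : realType}.
Variables (Om : set (R * R)) (g : R -> R * R).
Hypotheses (OmD : Om `<=` unit_disc) (sg : smooth_loop g) (gO : forall t, Om (g t)).
Notation leb := (@lebesgue_measure R).
Notation I01 := (`[0, 1]%classic : set (measurableTypeR R)).
Notation d1 := (derive1 (fun s => (g s).1)).
Notation d2 := (derive1 (fun s => (g s).2)).

Lemma nrm2_ge_norm (p : R * R) : `|p| ^+ 2 <= nrm2 p.
Proof.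
rewrite /nrm2 prod_normE; have [_|_] := leP `|p.1| `|p.2|; rewrite real_normK ?num_real//.
  by rewrite lerDr sqr_ge0.
by rewrite lerDl sqr_ge0.
Qed.

Lemma unit_disc_norm (p : R * R) : unit_disc p -> `|p| <= 1.
Proof.
move=> /= /ltW h; rewrite -(@ler_pXn2r _ 2)// ?nnegrE// expr1n.
exact: le_trans (nrm2_ge_norm p) h.
Qed.

Lemma mol_decay (r a : R) (p : R * R) : 0 < r -> r < a -> a <= `|p| ->
  `|molX r p| <= a^-1 /\ `|molY r p| <= a^-1.
Proof.
move=> r0 ra ap; have a0 := lt_trans r0 ra; have p0 := lt_le_trans a0 ap.
have n0 : 0 < nrm2 p by apply: lt_le_trans (nrm2_ge_norm p); rewrite exprn_gt0.
rewrite /molX /molY /kerX /kerY radial_far ?(lt_le_trans ra)//.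
have H (x : R) : `|x| <= `|p| -> `|x * (nrm2 p)^-1| <= a^-1.
  move=> xp; rewrite normrM normfV (gtr0_norm n0) ler_pdivrMr// ler_pdivlMl//.
  apply: le_trans (nrm2_ge_norm p); rewrite expr2; apply: ler_pM => //; exact: ltW.
by split; apply: H; [exact: norm_fst|exact: norm_snd].
Qed.

(** Winding numbers are prescribed on the holes only, so points beyond the disc need an argument of
    their own: the ray from c to infinity stays outside the disc, the potential is constant along
    it, and it decays like the inverse of the distance. *)
Lemma loop_potential_outside (r : R) c : 0 < r -> (forall q, ~ Om q -> forall t, I01 t -> r < `|g t - q|) ->
  ~ unit_disc c -> loop_potential g r c = 0.
Proof.
move=> r0 far Dc; have OmM p : Om p -> `|p| <= 1 by move=> /OmD; exact: unit_disc_norm.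
have c1 : 1 <= nrm2 c by rewrite leNgt; apply/negP => h; exact: Dc h.
have sG := smooth_loop_potential OmM sg gO r0.
have [h1 h2 h3] := sg; have [_ k1] := derive1n_regular h2; have [_ k2] := derive1n_regular h3.
have i1 := unit_integrable k1; have i2 := unit_integrable k2.
have mI : measurable I01 by exact: measurable_itv.
pose I1 := \int[leb]_(t in I01) `|d1 t|; pose I2 := \int[leb]_(t in I01) `|d2 t|.
have I10 : 0 <= I1 by apply: Rintegral_ge0 => t _; exact: normr_ge0.
have I20 : 0 <= I2 by apply: Rintegral_ge0 => t _; exact: normr_ge0.
have cst s : 1 <= s -> loop_potential g r (s *: c) = loop_potential g r c.
  move=> s1; have := @segment_mvt _ (loop_potential g r) c ((s - 1) *: c).
  have E (u : R) : u *: ((s - 1) *: c) + c = (u * (s - 1) + 1) *: c.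
    by rewrite scalerDl scale1r scalerA.
  have -> : (s - 1) *: c + c = s *: c by rewrite -[X in _ + X]scale1r -scalerDl subrK.
  move=> [u _|u /andP[u0 u1]]; first exact: (sG [::]).
  rewrite E => H; apply/eqP; rewrite -subr_eq0 H.
  set k := u * (s - 1) + 1; have k1' : 1 <= k by rewrite /k lerDr mulr_ge0// subr_ge0.
  have Dk : ~ Om (k *: c).
    move=> /OmD /=; apply/negP; rewrite -leNgt !exprMn -mulrDr.
    by rewrite -[leLHS]mul1r; apply: ler_pM => //; rewrite exprn_ege1.
  have G := grad_loop_potential_far OmM sg gO r0 (far _ Dk).
  by rewrite (grad_at_dx G) (grad_at_dy G) !mulr0 addr0.
have bnd a q : r < a -> (forall t, I01 t -> a <= `|g t - q|) -> `|loop_potential g r q| <= (I1 + I2) / a.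
  move=> ra aq.
  have B (K : R * R -> R) (k : R -> R) : leb.-integrable I01 (EFin \o k) ->
      leb.-integrable I01 (EFin \o (fun t => K (g t - q) * k t)) ->
      (forall t, I01 t -> `|K (g t - q)| <= a^-1) ->
      `|kconv leb I01 g k K q| <= a^-1 * \int[leb]_(t in I01) `|k t|.
    move=> ik iK Ka; have ink : leb.-integrable I01 (EFin \o (fun t => `|k t|)) by exact: integrable_norm.
    apply: le_trans (le_normr_Rintegral mI iK) _; rewrite -RintegralZl//.
    apply: le_Rintegral => //; first exact: integrable_norm.
      exact: integrable_EFinZ.
    by move=> t It; rewrite normrM ler_wpM2r// Ka.
  have b1 : `|loop_conv g d2 (molX r) q| <= a^-1 * I2 :=
    B _ _ i2 (loop_conv_integrable OmM sg gO q i2 (smooth_molX r0))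
    (fun t It => (mol_decay r0 ra (aq t It)).1).
  have b2 : `|loop_conv g d1 (molY r) q| <= a^-1 * I1 :=
    B _ _ i1 (loop_conv_integrable OmM sg gO q i1 (smooth_molY r0))
    (fun t It => (mol_decay r0 ra (aq t It)).2).
  rewrite /loop_potential; apply: le_trans (ler_normB _ _) _.
  have -> (x y b : R) : (x + y) / b = b^-1 * y + b^-1 * x by rewrite mulrC mulrDr addrC.
  exact: lerD b1 b2.
apply/eqP; rewrite -normr_eq0 eq_le normr_ge0 andbT.
apply/ler_addgt0Pl => e e0; rewrite addr0.
(* Larger than r, so that the decay estimate applies, and such that (I1 + I2) / a <= e. *)
pose a := r + 1 + (I1 + I2) / e.
have I0 : 0 <= I1 + I2 := addr_ge0 I10 I20.
have Ie : 0 <= (I1 + I2) / e by rewrite divr_ge0// ltW.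
have ra : r < a by rewrite /a -addrA ltrDl ltr_pwDl.
have a0 := lt_trans r0 ra.
have nc : 0 < `|c|.
  rewrite normr_gt0; apply/negP => /eqP c0; move: c1.
  by rewrite c0 /nrm2 /= expr0n /= addr0 ler10.
(* The curve stays in the ball of radius 1, so a point of norm at least 1 + a is at distance at
   least a from it. *)
pose s := (1 + a) / `|c| + 1.
have s1 : 1 <= s by rewrite /s lerDr divr_ge0 ?ltW// addr_gt0.
rewrite -(cst s s1); apply: le_trans (bnd a (s *: c) ra _) _.
  move=> t _; rewrite distrC; apply: le_trans (lerB_dist _ _).
  have gt1 := OmM _ (gO t).
  rewrite normrZ (ger0_norm (le_trans ler01 s1)) /s mulrDl divfK ?gt_eqF// mul1r.
  suff H (u v b : R) : u <= 1 -> 0 < v -> b <= 1 + b + v - u by exact: H.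
  lra.
rewrite ler_pdivrMr// /a mulrDr mulrCA divff ?gt_eqF// mulr1 lerDr mulr_ge0 ?(ltW e0)// addr_ge0// ltW//.
Qed.

End LoopOutside.

(** * Periods and potentials of the holes *)

Section HolePotential.
Context {R : realType} (J : choiceType) (B : J -> set (R * R)).
Hypothesis hB : regular_holes B.
Notation Om := (regular_domain B).
Notation leb := (@lebesgue_measure R).
Notation I01 := (`[0, 1]%classic : set (measurableTypeR R)).
Notation ipO := (ip (area : {measure set (plane R) -> \bar R}) Om).

Lemma regular_domain_disc : Om `<=` unit_disc.
Proof. by move=> p []. Qed.

Lemma regular_domain_norm p : Om p -> `|p| <= 1.
Proof. by move=> /regular_domain_disc; exact: unit_disc_norm. Qed.

(** A small closed ball around a point of the disc is compact and meets finitely many holes, whose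
    union is closed; the other holes do not reach the ball. *)
Lemma regular_domain_open : open Om.
Proof.
rewrite openE => p [Dp Bp].
have oD : open (unit_disc : set (R * R)) := @nrm2_open_lt R 1.
have /nbhs_normP[d /= d0 Hd] := open_nbhs_nbhs (conj oD Dp).
have d20 : 0 < d / 2 by rewrite divr_gt0.
pose K := [set q : R * R | `|p - q| <= d / 2].
have KD : K `<=` unit_disc.
  by move=> q Kq; apply: Hd; apply: le_lt_trans Kq _; rewrite ltr_pdivrMr// ltr_pMr// ltr1n.
have cK : compact K.
  apply: (subclosed_compact _ (@compact_ball R (`|p| + d / 2))).
    rewrite (_ : K = (fun q => `|p - q|) @^-1` [set x | x <= d / 2])//.
    apply: closed_comp => [q _|]; last exact: closed_le.
    by apply: cvg_norm; apply: cvgB; [exact: cvg_cst|exact: cvg_id].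
  move=> q /= Kq; rewrite (_ : q = p - (p - q)); last by rewrite opprB addrC subrK.
  by apply: le_trans (ler_normB _ _) _; rewrite lerD2l.
have fF := holes_locally_finite hB cK KD.
have cU : closed (\bigcup_(j in [set j | B j `&` K !=set0]) B j).
  apply: closed_bigcup => [//|j _]; apply: compact_closed; first exact: norm_hausdorff.
  exact: (holes_compact hB).
have : \forall q \near p, (~` (\bigcup_(j in [set j | B j `&` K !=set0]) B j)) q.
  by apply: open_nbhs_nbhs; split; [exact: closed_openC|case=> j _ Bj; apply: Bp; exists j].
have nK : \forall q \near p, K q.
  by apply/nbhs_normP; exists (d / 2) => // q /= /ltW.
apply: filterS2 nK => q Kq nU; split; first exact: KD.
by case=> j _ Bj; apply: nU; exists j => //; exists q.
Qed.

Lemma outsideP p : ~ Om p -> ~ unit_disc p \/ exists j, B j p.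
Proof.
move=> Op; have [Dp|] := pselect (unit_disc p); [right|by left].
by apply: contrapT => H; apply: Op; split => //; case=> j _ Bj; apply: H; exists j.
Qed.

Lemma cs_form_norm u v : L2p area Om u -> L2p area Om v ->
  `|ipO u v| <= form_norm Om u * form_norm Om v.
Proof.
move=> Lu Lv; have cs := plane_cs regular_domain_open Lu Lv.
by rewrite !form_normE -sqrtrM ?ip_ge0// -sqrtr_sqr ler_wsqrtr.
Qed.

(** Density keeps the filter from being degenerate, so that limits along it are unique. *)
Lemma smooth_near_proper w : L2c Om w -> ProperFilter (smooth_near Om w).
Proof.
move=> Lw; apply: filter_from_proper; last first.
  move=> e e0; have [s [h1 h2 h3]] := smooth_closed_dense regular_domain_open regular_domain_norm Lw e0.
  by exists s; split.
apply: filter_from_filter; first by exists 1; rewrite /= ltr01.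
move=> a b a0 b0; exists (Num.min a b); first by rewrite /= lt_min a0.
by move=> s [h1 h2]; rewrite lt_min => /andP[h3 h4].
Qed.

(** On smooth closed forms the scaled pairing is the line integral, and it is Lipschitz for the L^2
    norm by Cauchy-Schwarz. Hence the limit defining the period exists and is the scaled pairing
    with w itself. *)
Lemma period_pairing (g : R -> R * R) (r rho : R) w : smooth_loop g -> (forall t, Om (g t)) ->
  L2c Om w -> 0 < r -> r < rho ->
  (forall t, I01 t -> forall q, `|g t - q| <= rho -> Om q) ->
  period Om g w = kappa^-1 * ipO w (rotg (loop_potential g r)).
Proof.
move=> sg gO Lw r0 rrho tube; have k0 := @kappa_gt0 R.
have OmM := regular_domain_norm; have oOm := regular_domain_open.
set v := rotg _.
have Lv : L2p area Om v by apply: (rotg_L2 oOm OmM); exact: (smooth_loop_potential OmM sg gO r0).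
have PF := smooth_near_proper Lw.
apply: cvg_lim; first exact: norm_hausdorff.
apply/cvgrPdist_lt => e e0.
have n0 : 0 <= form_norm Om v by exact: sqrtr_ge0.
have C0 : 0 < kappa^-1 * form_norm Om v + 1 by rewrite ltr_wpDl// mulr_ge0// invr_ge0 ltW.
exists (e / (kappa^-1 * form_norm Om v + 1)); first by rewrite /= divr_gt0.
move=> s [Ls ss ws].
have -> : line_integral g s = kappa^-1 * ipO s v.
  by rewrite (loop_line_integral oOm OmM sg gO Ls ss r0 rrho tube) mulKf ?gt_eqF.
have Lw' : L2p area Om w by apply/(L2_formE oOm); case: Lw.
have Ls' : L2p area Om s by apply/(L2_formE oOm); case: Ls.
rewrite distrC -mulrBr -(plane_ipB oOm Ls' Lw' Lv) normrM ger0_norm ?invr_ge0 ?(ltW k0)//.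
have cs := cs_form_norm (Lp_sub oOm Ls' Lw') Lv.
have [z|nz] := eqVneq (form_norm Om v) 0.
  by move: cs; rewrite z mulr0 normr_le0 => /eqP ->; rewrite normr0 mulr0.
have np : 0 < form_norm Om v by rewrite lt_neqAle eq_sym nz.
apply: (@le_lt_trans _ _ (kappa^-1 * form_norm Om v * form_norm Om (s - w))).
  by rewrite -mulrA ler_wpM2l ?invr_ge0 ?(ltW k0)// mulrC.
move: ws; rewrite ltr_pdivlMr// => ws; apply: le_lt_trans ws.
rewrite mulrC ler_wpM2l ?sqrtr_ge0// lerDl ler01//.
Qed.

Lemma rotgZ (a : R) phi : smooth_on setT phi -> rotg (fun q => a * phi q) = a *: rotg phi.
Proof.
move=> s; have := rotg_lin a s (smooth_cst (0 : R) (@openT _)).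
by rewrite rotg0 addr0; under eq_fun do rewrite addr0.
Qed.

(** Dividing the potential by 2 pi gives winding numbers near every point outside the domain: 1 on
    the j-th hole and 0 on the others by the choice of the curve, and 0 beyond the disc by
    [loop_potential_outside]. *)
Lemma hole_potential j (g : R -> R * R) : loop_around B j g -> exists Phi : R * R -> R,
  [/\ smooth_on setT Phi, forall c, B j c -> \forall q \near c, Phi q = 1,
    forall c, ~ Om c -> ~ B j c -> \forall q \near c, Phi q = 0 &
    forall w, L2c Om w -> period Om g w = 2 * pi / kappa * ipO w (rotg Phi)].
Proof.
move=> [sg gO w1 w0]; have OmM := regular_domain_norm; have oOm := regular_domain_open.
near (0 : R)^'+ => rho.
have rho0 : 0 < rho by near: rho; exact: nbhs_right_gt.
have tube : forall t, I01 t -> forall q, `|g t - q| <= rho -> Om q.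
  by near: rho; exact: loop_tube.
have [r r0 rrho] : exists2 r, 0 < r & r < rho.
  by exists (rho / 2); rewrite ?divr_gt0// ltr_pdivrMr// ltr_pMr// ltr1n.
have sG := smooth_loop_potential OmM sg gO r0.
have pi0 : 0 < 2 * pi :> R by rewrite mulr_gt0 ?pi_gt0.
have far c : ~ Om c -> forall t, I01 t -> rho < `|g t - c|.
  by move=> Oc t It; rewrite ltNge; apply/negP => /(tube _ It).
have near_c c : ~ Om c -> \forall q \near c, (2 * pi)^-1 * loop_potential g r q = winding_number g c.
  move=> Oc; apply: filterS (loop_potential_near OmM sg gO r0 rrho (far c Oc)) => q ->.
  by rewrite mulKf ?gt_eqF.
have Bout i c : B i c -> ~ Om c by move=> Bc [_]; apply; exists i.
exists (fun q => (2 * pi)^-1 * loop_potential g r q); split.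
- by apply: smoothZ => //; exact: openT.
- by move=> c Bc; have := near_c c (Bout _ _ Bc); rewrite w1.
- move=> c Oc Bc; have := near_c c Oc; suff -> : winding_number g c = 0 by [].
  have [Dc|[i Bi]] := outsideP Oc; last by apply: (w0 i) => // ij; apply: Bc; rewrite -ij.
  have := loop_potential_winding OmM sg gO r0 (fun t It => lt_trans rrho (far c Oc t It)).
  rewrite (loop_potential_outside regular_domain_disc sg gO r0 _ Dc).
    by move=> /esym/eqP; rewrite mulf_eq0 gt_eqF//= => /eqP.
  by move=> q Oq t It; exact: lt_trans rrho (far q Oq t It).
- move=> w Lw; rewrite (period_pairing sg gO Lw r0 rrho tube) rotgZ//.
  have Lv : L2p area Om (rotg (loop_potential g r)) by exact: (rotg_L2 oOm OmM sG).
  have L0 : L2p area Om (rotg (fun=> 0)) by apply: (rotg_L2 oOm OmM); apply: smooth_cst; exact: openT.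
  have Lw' : L2p area Om w by apply/(L2_formE oOm); case: Lw.
  have := plane_ip_linr oOm (2 * pi)^-1 Lv L0 Lw'.
  have -> : ipO w (rotg (fun=> 0)) = 0.
    by case: Lw => _ /closed_formE; apply; exact: (test0 OmM).
  rewrite rotg0 !addr0 => ->; rewrite [RHS]mulrA; congr (_ * _).
  by rewrite mulrAC divff ?gt_eqF// mul1r.
Unshelve. all: by end_near. Qed.

End HolePotential.

(** * The Bessel inequality *)

Section SqrtCombination.
Context {R : realType} (J : Type) (s : seq J) (b : J -> R) (u : J -> R * R -> R) (d : R).
Hypotheses (b0 : forall j, 0 <= b j) (su : forall j, smooth_on setT (u j)) (d0 : 0 < d).

Lemma sum_cauchy_schwarz (x y : J -> R) :
  (\sum_(j <- s) b j * x j * y j) ^+ 2 <=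
  (\sum_(j <- s) b j * x j ^+ 2) * (\sum_(j <- s) b j * y j ^+ 2).
Proof.
apply: quadratic_ge0 => [|t]; first by apply: sumr_ge0 => j _; rewrite mulr_ge0 ?sqr_ge0.
rewrite (_ : _ + _ = \sum_(j <- s) b j * (x j + t * y j) ^+ 2).
  by apply: sumr_ge0 => j _; rewrite mulr_ge0 ?sqr_ge0.
by rewrite !mulr_sumr -!big_split /=; apply: eq_bigr => j _; ring.
Qed.

(** The term d^2 keeps the argument away from 0, where the root is not smooth. *)
Definition sqrt_sum p : R := Num.sqrt (\sum_(j <- s) b j * (u j p * u j p) + d ^+ 2).

Lemma sqrt_sum_gt0 p : 0 < \sum_(j <- s) b j * (u j p * u j p) + d ^+ 2.
Proof.
rewrite ltr_wpDl ?exprn_gt0//; apply: sumr_ge0 => j _.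
by rewrite -expr2 mulr_ge0 ?sqr_ge0.
Qed.

Lemma smooth_sqrt_sum : smooth_on setT sqrt_sum.
Proof.
have oT : open [set: R * R] := openT; apply: (smooth_sqrt oT) => [p _|].
  exact: sqrt_sum_gt0.
apply: (smoothD oT); last exact: smooth_cst.
apply: (smooth_sum _ oT) => j; apply: (smoothZ _ oT); exact: smoothM.
Qed.

Lemma sqrt_sum_grad p :
  sqrt_sum p * dx sqrt_sum p = \sum_(j <- s) b j * u j p * dx (u j) p /\
  sqrt_sum p * dy sqrt_sum p = \sum_(j <- s) b j * u j p * dy (u j) p.
Proof.
have G := smooth_grad smooth_sqrt_sum (I : setT p); have G2 := grad_atM G G.
have E : (fun q => sqrt_sum q * sqrt_sum q) =
    (fun q => \sum_(j <- s) b j * (u j q * u j q) + d ^+ 2).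
  by apply/funext => q; rewrite -expr2 (sqr_sqrtr (ltW (sqrt_sum_gt0 q))).
have Gj j : grad_at (fun q => b j * (u j q * u j q)) p
    (2 * (b j * u j p * dx (u j) p)) (2 * (b j * u j p * dy (u j) p)).
  have g := smooth_grad (su j) (I : setT p).
  apply: grad_at_eq (grad_atM (grad_at_cst (b j) p) (grad_atM g g)) _ _; ring.
have GQ := grad_atD (grad_at_sum s Gj) (grad_at_cst (d ^+ 2) p).
rewrite E in G2.
have e1 := grad_at_dx G2; have e2 := grad_at_dy G2.
rewrite (grad_at_dx GQ) addr0 -mulr_sumr in e1.
rewrite (grad_at_dy GQ) addr0 -mulr_sumr in e2.
have half (x y : R) : 2 * x = y + y -> y = x by lra.
by split; [exact: half e1|exact: half e2].
Qed.

(** Weighted Cauchy-Schwarz in V dV = sum_j b_j u_j du_j: the factor sum_j b_j u_j^2 is at most V^2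
    and cancels, so no product of gradients with different indices remains. *)
Lemma sqrt_sum_grad_le p :
  dx sqrt_sum p ^+ 2 <= \sum_(j <- s) b j * dx (u j) p ^+ 2 /\
  dy sqrt_sum p ^+ 2 <= \sum_(j <- s) b j * dy (u j) p ^+ 2.
Proof.
have [e1 e2] := sqrt_sum_grad p.
have V0 : 0 < sqrt_sum p by rewrite sqrtr_gt0 sqrt_sum_gt0.
have VQ : \sum_(j <- s) b j * u j p ^+ 2 <= sqrt_sum p ^+ 2.
  rewrite (sqr_sqrtr (ltW (sqrt_sum_gt0 p))); under eq_bigr do rewrite expr2.
  by rewrite lerDl sqr_ge0.
have H (v : J -> R) (x : R) : sqrt_sum p * x = \sum_(j <- s) b j * u j p * v j ->
    x ^+ 2 <= \sum_(j <- s) b j * v j ^+ 2.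
  move=> e; have c0 : 0 <= \sum_(j <- s) b j * v j ^+ 2.
    by apply: sumr_ge0 => j _; rewrite mulr_ge0 ?sqr_ge0.
  rewrite -(@ler_pM2l _ (sqrt_sum p ^+ 2)) ?exprn_gt0// -exprMn e.
  by apply: le_trans (sum_cauchy_schwarz _ _) _; rewrite ler_wpM2r.
by split; apply: H.
Qed.

End SqrtCombination.

Section PairingSums.
Context {R : realType}.
Variables (Om : set (R * R)) (M : R).
Hypotheses (oOm : open Om) (OmM : forall p, Om p -> `|p| <= M).
Notation ipO := (ip (area : {measure set (plane R) -> \bar R}) Om).
Let mOm : @measurable _ (plane R) Om := plane_mOm oOm.

Lemma ip_rotg_sum (J : Type) (s : seq J) (c : J -> R) (phi : J -> R * R -> R) w :
  L2c Om w -> (forall j, smooth_on setT (phi j)) ->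
  ipO w (rotg (fun q => \sum_(j <- s) c j * phi j q)) = \sum_(j <- s) c j * ipO w (rotg (phi j)).
Proof.
move=> [/(L2_formE oOm) Lw cw] sphi.
elim: s => [|j s IH].
  rewrite big_nil; under [X in rotg X]eq_fun do rewrite big_nil.
  by move/closed_formE: cw; apply; exact: (test0 OmM).
rewrite big_cons; under [X in rotg X]eq_fun do rewrite big_cons.
have ss : smooth_on setT (fun q => \sum_(j <- s) c j * phi j q).
  apply: smooth_sum; first exact: openT.
  by move=> i; apply: smoothZ => //; exact: openT.
rewrite rotg_lin// (plane_ip_linr oOm _ (rotg_L2 oOm OmM (sphi j)) (rotg_L2 oOm OmM ss) Lw).
by rewrite IH.
Qed.

Lemma ip_sum_le (J : Type) (s : seq J) (b : J -> R) (v : J -> R * R -> R * R) (f : R * R -> R * R) (K : R) :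
  L2p area Om f -> (forall j, L2p area Om (v j)) -> (forall j, 0 <= b j) ->
  (forall p, (f p).1 ^+ 2 + (f p).2 ^+ 2 <= \sum_(j <- s) b j * ((v j p).1 ^+ 2 + (v j p).2 ^+ 2)) ->
  (forall j, ipO (v j) (v j) <= K) -> ipO f f <= \sum_(j <- s) b j * K.
Proof.
move=> Lf Lv b0 fv vK.
have iv j : area.-integrable Om (EFin \o (fun p : plane R => (v j p).1 ^+ 2 + (v j p).2 ^+ 2)).
  by apply: eq_integrable (ip_integrable mOm (Lv j) (Lv j)) => // p _; rewrite /= !expr2.
have ipE j : \int[area]_(p in Om) ((v j p).1 ^+ 2 + (v j p).2 ^+ 2) = ipO (v j) (v j).
  by apply: eq_Rintegral => p _; rewrite !expr2.
have [is_ Es] : area.-integrable Om (EFin \o (fun p : plane R => \sum_(j <- s) b j * ((v j p).1 ^+ 2 + (v j p).2 ^+ 2))) /\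
    \int[area]_(p in Om) (\sum_(j <- s) b j * ((v j p).1 ^+ 2 + (v j p).2 ^+ 2)) =
    \sum_(j <- s) b j * ipO (v j) (v j).
  elim: s {fv} => [|j s [IH1 IH2]].
    rewrite big_nil; under eq_fun do rewrite big_nil.
    by split; [exact: integrable0|rewrite /Rintegral integral0].
  have i1 := integrable_EFinZ (b j) mOm (iv j).
  rewrite big_cons; under eq_fun do rewrite big_cons.
  split; first exact: integrable_EFinD.
  rewrite (RintegralD mOm i1 IH1) IH2; congr (_ + _).
  by rewrite (RintegralZl _ mOm (iv j)) ipE.
apply: (@le_trans _ _ (\sum_(j <- s) b j * ipO (v j) (v j))); last first.
  by apply: ler_sum => j _; rewrite ler_wpM2l.
rewrite -Es; apply: le_Rintegral => //; first exact: ip_integrable.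
by move=> p _; rewrite -!expr2.
Qed.

Lemma form_norm_sqr v : form_norm Om v ^+ 2 = ipO v v.
Proof. by rewrite form_normE sqr_sqrtr// ip_ge0. Qed.

Lemma form_norm_triangle u v : L2p area Om u -> L2p area Om v ->
  form_norm Om (u + v) <= form_norm Om u + form_norm Om v.
Proof.
move=> Lu Lv; have cs := plane_cs oOm Lv Lu.
rewrite -(@ler_pXn2r _ 2)// ?nnegrE ?addr_ge0 ?sqrtr_ge0//.
rewrite sqrrD !form_norm_sqr -[u in ipO (u + v)]scale1r -[u in ipO _ (u + v)]scale1r.
rewrite (ip_quad (L2p_lin mOm) (ip_lin mOm) (ip_sym _ _)) //.
have H : ipO v u <= form_norm Om u * form_norm Om v.
  apply: le_trans (ler_norm _) _; rewrite -sqrtr_sqr mulrC !form_normE -sqrtrM ?ip_ge0//.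
  by rewrite ler_wsqrtr.
move: (ipO v u) (ipO u u) (ipO v v) (form_norm Om u * form_norm Om v) H => x y z t xt.
rewrite mulr1 expr1n mul1r mulr2n; lra.
Qed.

End PairingSums.

Section BesselBound.
Context {R : realType} (J : choiceType) (Om : set (R * R)) (M : R) (Phi : J -> R * R -> R) (D0 : R).
Hypotheses (oOm : open Om) (OmM : forall p, Om p -> `|p| <= M).
Notation ipO := (ip (area : {measure set (plane R) -> \bar R}) Om).
Let mOm : @measurable _ (plane R) Om := plane_mOm oOm.
Hypothesis sPhi : forall j, smooth_on setT (Phi j).
Hypothesis Phi_out : forall p, ~ Om p ->
  (exists k, forall j, \forall q \near p, Phi j q = (j == k)%:R) \/
  (forall j, \forall q \near p, Phi j q = 0).
Hypothesis D00 : 0 <= D0.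
Hypothesis PhiD : forall j w, L2c Om w -> `|ipO w (rotg (Phi j))| <= D0 * form_norm Om w.

(* The form h minimizing the norm in rotg (Phi j) + {rotg phi} is closed, hence admissible in PhiD. *)
Lemma near_minimizer j e : 0 < e -> exists2 phi, test_function Om phi &
  form_norm Om (rotg (fun q => (-1) * phi q + Phi j q)) <= D0 + e.
Proof.
move=> e0; have e20 : 0 < e / 2 by rewrite divr_gt0.
have Lv : L2p area Om (rotg (Phi j)) := rotg_L2 oOm OmM (sPhi j).
set v := rotg (Phi j) in Lv.
pose S := [set u | exists2 phi, test_function Om phi & u = rotg phi].
have SE : S `<=` L2p area Om by move=> _ [phi [sp _] ->]; exact: (rotg_L2 oOm OmM).
have S0 : S 0 by exists (fun=> 0); [exact: (test0 OmM)|rewrite rotg0].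
have Slin a u u' : S u -> S u' -> S (a *: u + u').
  move=> [phi t ->] [psi t' ->]; exists (fun q => a * phi q + psi q); first exact: (test_lin OmM a t t').
  by rewrite (rotg_lin a (test_smooth t) (test_smooth t')).
have [h [Lh horth happ]] := plane_projection oOm OmM SE S0 Slin Lv.
have Lch : L2c Om h.
  by split; [exact/(L2_formE oOm)|apply/closed_formE => phi t; apply: horth; exists phi].
have e2 : 0 < (e / 2) ^+ 2 by rewrite exprn_gt0.
have [_ [phi t ->] Hs] := happ _ e2; exists phi => //.
have Ls : L2p area Om (rotg phi) := rotg_L2 oOm OmM (test_smooth t).
have Lvs := Lp_sub oOm Lv Ls; have Lx := Lp_sub oOm Lvs Lh.
set x := v - rotg phi - h in Hs Lx.
have Nx : form_norm Om x <= e / 2.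
  by rewrite -(ger0_norm (ltW e20)) -sqrtr_sqr form_normE ler_wsqrtr// ltW.
have -> : rotg (fun q => -1 * phi q + Phi j q) = h + x.
  by rewrite (rotg_lin (-1) (test_smooth t) (sPhi j)) /x [RHS]addrC subrK scaleN1r addrC.
(* As h is orthogonal to [rotg phi], its squared norm is [ipO v h - ipO x h]; the first term is
   bounded by [PhiD] at h itself, the second by Cauchy-Schwarz. *)
have Nh : form_norm Om h <= D0 + e / 2.
  have hx : ipO x h = ipO v h - ipO h h.
    rewrite (plane_ipB oOm Lvs Lh Lh) (plane_ipB oOm Lv Ls Lh).
    rewrite [ipO (rotg phi) h]ip_sym (horth (rotg phi)) ?subr0//.
    by exists phi.
  have vh : ipO v h <= D0 * form_norm Om h.
    by rewrite ip_sym; apply: le_trans (ler_norm _) _; exact: PhiD.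
  have hxn : `|ipO x h| <= form_norm Om x * form_norm Om h.
    have cs := plane_cs oOm Lx Lh.
    by rewrite !form_normE -sqrtrM ?ip_ge0// -sqrtr_sqr ler_wsqrtr.
  have N0 : 0 <= form_norm Om h by exact: sqrtr_ge0.
  rewrite leNgt; apply/negP => Nlt.
  have Np : 0 < form_norm Om h by apply: le_lt_trans Nlt; rewrite addr_ge0// ltW.
  have : ipO h h <= (D0 + e / 2) * form_norm Om h.
    have -> : ipO h h = ipO v h - ipO x h by rewrite hx subKr.
    rewrite mulrDl lerD//; apply: le_trans (ler_norm _) _; rewrite normrN.
    by apply: le_trans hxn _; rewrite ler_wpM2r.
  by rewrite -form_norm_sqr// expr2 ler_pM2r// leNgt Nlt.
apply: le_trans (form_norm_triangle oOm Lh Lx) _.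
by rewrite [e]splitr addrA; exact: lerD.
Qed.

Lemma sum_indicator (s : seq J) (f : J -> R) k : uniq s ->
  \sum_(j <- s) f j * (j == k)%:R = if k \in s then f k else 0.
Proof.
elim: s => [|i s IH] /=; first by rewrite big_nil.
move=> /andP[si us]; rewrite big_cons IH// in_cons; have [E|ik] := eqVneq i k.
  by rewrite -E (negbTE si) /= mulr1 addr0.
by rewrite mulr0 add0r.
Qed.

Lemma near_all (s : seq J) (P : J -> R * R -> Prop) (p : R * R) : (forall j, \forall q \near p, P j q) ->
  \forall q \near p, forall j, j \in s -> P j q.
Proof.
move=> H; elim: s => [|i s IH]; first by apply: (@filterE _ (nbhs p)).
by apply: filterS2 (H i) IH => q h1 h2 j; rewrite in_cons => /orP[/eqP ->|/h2].
Qed.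

Lemma add_small_le (X Y Z : R) : 0 <= Z -> (forall d, 0 < d -> d <= 1 -> X <= Y + d * Z) -> X <= Y.
Proof.
move=> Z0 H; apply/ler_addgt0Pr => e e0.
have Z1 : 0 < Z + 1 by rewrite ltr_wpDl.
have d0 : 0 < Num.min 1 (e / (Z + 1)) by rewrite lt_min ltr01 divr_gt0.
apply: le_trans (H _ d0 _) _; first by rewrite ge_min lexx.
rewrite lerD2l; apply: (@le_trans _ _ (e / (Z + 1) * Z)).
  by rewrite ler_wpM2r// ge_min lexx orbT.
by rewrite mulrAC ler_pdivrMr// ler_wpM2l ?(ltW e0)// lerDl.
Qed.

(* The function sqrt (\sum_j (c_j^2 + 2 d c_j) u_j^2 + d^2) - d, where u_j = Phi j - phi_j,
   is equal to c_k near the k-th hole, like \sum_j c_j Phi j. *)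
Lemma pairing_sum_sqr (s : seq J) (c : J -> R) w : uniq s -> (forall j, 0 <= c j) -> L2c Om w ->
  (\sum_(j <- s) c j * ipO w (rotg (Phi j))) ^+ 2 <=
  form_norm Om w ^+ 2 * D0 ^+ 2 * \sum_(j <- s) c j ^+ 2.
Proof.
move=> us c0 Lcw; have oT : open [set: R * R] := openT.
have Lw : L2p area Om w by apply/(L2_formE oOm); case: Lcw.
set X := _ ^+ 2; set N := form_norm Om w.
pose S2 := \sum_(j <- s) c j ^+ 2; pose S1 := \sum_(j <- s) c j.
have S20 : 0 <= S2 by apply: sumr_ge0 => j _; exact: sqr_ge0.
have S10 : 0 <= S1 by apply: sumr_ge0 => j _; exact: c0.
have N0 : 0 <= N by exact: sqrtr_ge0.
(* Two errors are removed in turn: d, which regularizes the root, with e fixed; then e, the defect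
   of the minimizers. *)
suff H d e : 0 < d -> 0 < e -> X <= N ^+ 2 * (D0 + e) ^+ 2 * (S2 + 2 * d * S1).
  have He e : 0 < e -> X <= N ^+ 2 * (D0 + e) ^+ 2 * S2.
    move=> e0; apply: (@add_small_le _ _ (N ^+ 2 * (D0 + e) ^+ 2 * (2 * S1))).
      exact: (mulr_ge0 (mulr_ge0 (sqr_ge0 _) (sqr_ge0 _)) (mulr_ge0 (ler0n _ 2) S10)).
    move=> d d0 _; apply: le_trans (H d e d0 e0) _; rewrite mulrDr lerD2l.
    by rewrite le_eqVlt; apply/orP; left; apply/eqP; ring.
  apply: (@add_small_le _ _ (N ^+ 2 * S2 * (2 * D0 + 1))).
    exact: (mulr_ge0 (mulr_ge0 (sqr_ge0 _) S20) (addr_ge0 (mulr_ge0 (ler0n _ 2) D00) ler01)).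
  move=> e e0 e1; apply: le_trans (He e e0) _.
  have -> : N ^+ 2 * D0 ^+ 2 * S2 + e * (N ^+ 2 * S2 * (2 * D0 + 1)) =
    N ^+ 2 * (D0 ^+ 2 + e * (2 * D0 + 1)) * S2 by ring.
  rewrite ler_wpM2r// ler_wpM2l ?sqr_ge0//.
  have : e ^+ 2 <= e by rewrite expr2 -[leRHS]mulr1 ler_wpM2l// ltW.
  have -> : (D0 + e) ^+ 2 = D0 ^+ 2 + (e * (2 * D0) + e ^+ 2) by ring.
  by rewrite lerD2l mulrDr mulr1 lerD2l.
move=> d0 e0.
have /choice[phi Hphi] : forall j, exists phi, test_function Om phi /\
    form_norm Om (rotg (fun q => (-1) * phi q + Phi j q)) <= D0 + e.
  by move=> j; have [phi h1 h2] := near_minimizer j e0; exists phi.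
pose u j q := (-1) * phi j q + Phi j q.
have su j : smooth_on setT (u j).
  by apply: (smoothD oT) => //; apply: (smoothZ _ oT); exact: test_smooth (Hphi j).1.
(* This completes the square: [b k + d ^+ 2] is (c k + d)^2. Near the k-th hole, where u_k = 1 and
   the other u_j vanish, the root minus d is exactly c k, since c k >= 0. *)
pose b j := c j ^+ 2 + 2 * d * c j.
have b0 j : 0 <= b j by rewrite addr_ge0 ?sqr_ge0// !mulr_ge0 ?(ltW d0)// c0.
have [V VE [sV gV]] : exists2 V : R * R -> R,
    forall q, V q = Num.sqrt (\sum_(j <- s) b j * (u j q * u j q) + d ^+ 2) &
    smooth_on setT V /\ forall p, dx V p ^+ 2 <= \sum_(j <- s) b j * dx (u j) p ^+ 2 /\
      dy V p ^+ 2 <= \sum_(j <- s) b j * dy (u j) p ^+ 2.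
  exists (sqrt_sum s b u d) => //; split; first exact: smooth_sqrt_sum.
  by move=> p; exact: sqrt_sum_grad_le.
pose W q := \sum_(j <- s) c j * Phi j q.
have sW : smooth_on setT W.
  by apply: (smooth_sum _ oT) => j; exact: (smoothZ _ oT).
(* Agreement near every point outside [Om] makes the difference a test function, so a closed w has
   the same pairing with both. *)
have tVW : test_function Om (fun q => (-1) * W q + (V q - d)).
  apply: (test_of_near OmM).
    apply: (smoothD oT); first exact: (smoothZ _ oT).
    by apply: (smoothB oT) => //; exact: smooth_cst.
  move=> p Op.
  have uP j : \forall q \near p, u j q = Phi j q.
    by apply: filterS (test_near (Hphi j).1 Op) => q e1; rewrite /u e1 mulr0 add0r.
  have [[k Hk]|H0] := Phi_out Op.
    have n1 := near_all s Hk; have n2 := near_all s uP.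
    apply: filterS2 n1 n2 => q h1 h2.
    have -> : W q = if k \in s then c k else 0.
      by rewrite /W -(sum_indicator _ _ us) big_seq [RHS]big_seq; apply: eq_bigr => j js; rewrite h1.
    have -> : V q = Num.sqrt ((if k \in s then b k else 0) + d ^+ 2).
      rewrite VE; congr (Num.sqrt (_ + _)); rewrite -(sum_indicator _ _ us) big_seq [RHS]big_seq.
      by apply: eq_bigr => j js; rewrite h2// h1//; case: (j == k); rewrite ?mulr1 ?mulr0.
    case: ifP => _; last by rewrite add0r sqrtr_sqr ger0_norm ?(ltW d0)//; ring.
    rewrite (_ : b k + d ^+ 2 = (c k + d) ^+ 2); last by rewrite /b; ring.
    by rewrite sqrtr_sqr ger0_norm ?addr_ge0 ?(ltW d0)//; ring.
  have n1 := near_all s H0; have n2 := near_all s uP.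
  apply: filterS2 n1 n2 => q h1 h2.
  have -> : W q = 0 by rewrite /W big_seq big1// => j js; rewrite h1// mulr0.
  have -> : V q = Num.sqrt (0 + d ^+ 2).
    by rewrite VE; congr (Num.sqrt (_ + _)); rewrite big_seq big1// => j js; rewrite h2// h1// !mulr0.
  by rewrite add0r sqrtr_sqr ger0_norm ?(ltW d0)//; ring.
have sVd : smooth_on setT (fun q => V q - d) by apply: (smoothB oT) => //; exact: smooth_cst.
have EV : rotg (fun q => V q - d) = rotg V.
  apply/funext => p; have G := grad_atB (smooth_grad sV (I : setT p)) (grad_at_cst d p).
  by rewrite /rotg (grad_at_dx G) (grad_at_dy G) !subr0.
have LV : L2p area Om (rotg V) := rotg_L2 oOm OmM sV.
have LW : L2p area Om (rotg W) := rotg_L2 oOm OmM sW.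
have EX : \sum_(j <- s) c j * ipO w (rotg (Phi j)) = ipO w (rotg V).
  rewrite -(ip_rotg_sum oOm OmM s c Lcw sPhi) -/W.
  have /closed_formE := Lcw.2; move=> /(_ _ tVW).
  rewrite (rotg_lin (-1) sW sVd) EV (plane_ip_linr oOm (-1) LW LV Lw) mulN1r addrC.
  by move=> /eqP; rewrite subr_eq0 => /eqP ->.
rewrite /X EX; apply: le_trans (plane_cs oOm Lw LV) _.
rewrite /N form_norm_sqr// -mulrA ler_wpM2l ?ip_ge0//.
have Kj j : ipO (rotg (u j)) (rotg (u j)) <= (D0 + e) ^+ 2.
  rewrite -form_norm_sqr// ler_pXn2r// ?nnegrE ?sqrtr_ge0 ?addr_ge0 ?(ltW e0)//.
  exact: (Hphi j).2.
apply: le_trans (ip_sum_le oOm LV (fun j => rotg_L2 oOm OmM (su j)) b0 _ Kj) _.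
  move=> p; have [h1 h2] := gV p.
  rewrite /rotg /= sqrrN addrC; apply: le_trans (lerD h1 h2) _; rewrite -big_split /=.
  by apply: ler_sum => j _; rewrite -mulrDr sqrrN addrC.
rewrite -mulr_suml mulrC ler_wpM2l ?sqr_ge0// /b big_split /= -mulr_sumr.
by [].
Qed.

Lemma pairing_sqr_sum (s : seq J) w : uniq s -> L2c Om w ->
  \sum_(j <- s) ipO w (rotg (Phi j)) ^+ 2 <= 2 * (form_norm Om w ^+ 2 * D0 ^+ 2).
Proof.
move=> us Lw; set K := _ * D0 ^+ 2; pose t j := ipO w (rotg (Phi j)).
(* For the positive part ([sg] = 1) and the negative part ([sg] = -1) the pairing sum is, up to
   sign, the square sum S, so [pairing_sum_sqr] reads S^2 <= K S. *)
have H (c : J -> R) (sg : R) : sg ^+ 2 = 1 -> (forall j, 0 <= c j) -> (forall j, c j * t j = sg * c j ^+ 2) ->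
    \sum_(j <- s) c j ^+ 2 <= K.
  move=> sg1 c0 ct; have := pairing_sum_sqr us c0 Lw.
  rewrite (eq_bigr (fun j => sg * c j ^+ 2)) => [|j _]; last exact: ct.
  rewrite -mulr_sumr exprMn sg1 mul1r.
  have : 0 <= \sum_(j <- s) c j ^+ 2 by apply: sumr_ge0 => j _; exact: sqr_ge0.
  rewrite le_eqVlt => /orP[/eqP <- _|S0]; last by rewrite expr2 ler_pM2r.
  by rewrite mulr_ge0 ?sqr_ge0.
have h1 := H (fun j => Num.max (t j) 0) 1; have h2 := H (fun j => Num.max (- t j) 0) (-1).
have p1 : \sum_(j <- s) Num.max (t j) 0 ^+ 2 <= K.
  apply: h1 => [|j|j]; [by rewrite expr1n|by rewrite le_max lexx orbT|].
  by rewrite mul1r expr2; have [_|_] := leP (t j) 0; rewrite ?mul0r.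
have p2 : \sum_(j <- s) Num.max (- t j) 0 ^+ 2 <= K.
  apply: h2 => [|j|j]; [by rewrite sqrrN expr1n|by rewrite le_max lexx orbT|].
  by rewrite expr2; have [_|_] := leP (- t j) 0; rewrite ?mul0r ?mulr0//; ring.
rewrite mulrDl mul1r; apply: le_trans (lerD p1 p2); rewrite -big_split /=.
apply: ler_sum => j _; rewrite -/(t j).
have [tj|tj] := leP (t j) 0.
  by rewrite max_l ?oppr_ge0// sqrrN expr0n add0r.
by rewrite max_r ?oppr_le0 ?(ltW tj)// expr0n addr0.
Qed.

End BesselBound.

Section Scaling.
Context {R : realType}.
Variables (Om : set (R * R)) (M : R).
Hypotheses (oOm : open Om) (OmM : forall p, Om p -> `|p| <= M).
Notation ipO := (ip (area : {measure set (plane R) -> \bar R}) Om).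
Let mOm : @measurable _ (plane R) Om := plane_mOm oOm.

Lemma ipZ (a : R) u v : L2p area Om u -> L2p area Om v -> ipO (a *: u) v = a * ipO u v.
Proof.
move=> Lu Lv; rewrite -(RintegralZl _ mOm (ip_integrable mOm Lv Lu)).
by apply: eq_Rintegral => p _; rewrite !fctE /= /GRing.scale /=; ring.
Qed.

Lemma L2c_scale (a : R) w : L2c Om w -> L2c Om (a *: w).
Proof.
move=> [/(L2_formE oOm) Lw /closed_formE cw]; split.
  apply/(L2_formE oOm); rewrite -[a](subrK 1) scalerDl scale1r; exact: (L2p_lin mOm).
apply/closed_formE => phi t.
by rewrite (ipZ a Lw (rotg_L2 oOm OmM (test_smooth t))) (cw _ t) mulr0.
Qed.

Lemma form_normZ (a : R) w : 0 <= a -> L2c Om w -> form_norm Om (a *: w) = a * form_norm Om w.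
Proof.
move=> a0 cw; have [/(L2_formE oOm) Lw _] := cw; have [/(L2_formE oOm) Law _] := L2c_scale a cw.
rewrite !form_normE (ipZ a Lw Law) ip_sym (ipZ a Lw Lw) mulrA -expr2 sqrtrM ?sqr_ge0//.
by rewrite sqrtr_sqr ger0_norm.
Qed.

End Scaling.

Lemma ell2_norm_le (R : realType) (J : choiceType) (a : J -> R) (K : R) : 0 <= K ->
  (forall s : seq J, uniq s -> \sum_(j <- s) a j ^+ 2 <= K ^+ 2) -> (ell2_norm a <= K%:E)%E.
Proof.
move=> K0 H; have -> : K%:E = sqrte (K ^+ 2)%:E by rewrite /= sqrtr_sqr ger0_norm.
rewrite lee_sqrt ?lee_fin ?sqr_ge0//; apply: ge_ereal_sup => _ [A [fA _] <-].
by rewrite fsbig_finite// sumEFin lee_fin; apply: H; exact: finmap.fset_uniq.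
Qed.

Unset Implicit Arguments.

Theorem theorem2p16 (R : realType) (J : countType) (B : J -> set (R * R))
    (gamma : J -> R -> R * R) :
  regular_holes B ->
  (forall j, loop_around B j (gamma j)) ->
  let Omega := regular_domain B in
  weak_bessel Omega gamma ->
  bessel Omega gamma /\
  (bessel_const Omega gamma
     <= (Num.sqrt 2)%:E * weak_bessel_const Omega gamma)%E.
Proof.
move=> hB hg Omega wb.
have oOm : open Omega := regular_domain_open hB.
have OmM : forall p, Omega p -> `|p| <= 1 := @regular_domain_norm R J B.
have /choice[Phi HPhi] := fun j => hole_potential hB (hg j).
(* The factor 2 pi / kappa becomes an abstract [lam]: the bound on pairings is divided by it and the
   final bound is multiplied by it. *)
have [lam lam0 per] : exists2 lam : R, 0 < lam & forall j w, L2c Omega w ->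
    Per Omega gamma w j = lam * ip area Omega w (rotg (Phi j)).
  exists (2 * pi / kappa); first by rewrite divr_gt0 ?kappa_gt0// mulr_gt0 ?pi_gt0.
  by move=> j w Lw; have [_ _ _ H] := HPhi j; exact: H.
have C0 : (0 <= weak_bessel_const Omega gamma)%E by apply: ereal_sup_ubound; left.
have Cfin : weak_bessel_const Omega gamma \is a fin_num by rewrite ge0_fin_numE.
have [c c0 CE] : exists2 c : R, 0 <= c & weak_bessel_const Omega gamma = c%:E.
  by exists (fine (weak_bessel_const Omega gamma)); rewrite ?fine_ge0// fineK.
have bound j w : L2c Omega w -> form_norm Omega w <= 1 -> `|Per Omega gamma w j| <= c.
  move=> Lw Nw; rewrite -lee_fin -CE.
  apply: (@le_trans _ _ (operator_norm Omega (fun w => `|Per Omega gamma w j|%:E))).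
    by apply: ereal_sup_ubound; exists w.
  by apply: ereal_sup_ubound; right; exists j.
have sPhi j : smooth_on setT (Phi j) by have [] := HPhi j.
have PhiD j w : L2c Omega w -> `|ip area Omega w (rotg (Phi j))| <= c / lam * form_norm Omega w.
  move=> Lw; have Lv := rotg_L2 oOm OmM (sPhi j).
  have Lw' : L2p area Omega w by apply/(L2_formE oOm); case: Lw.
  have N0 : 0 <= form_norm Omega w by exact: sqrtr_ge0.
  (* A form of norm 0 cannot be normalized; its pairings vanish by Cauchy-Schwarz. *)
  have [z|nz] := eqVneq (form_norm Omega w) 0.
    by have := cs_form_norm hB Lw' Lv; rewrite z mul0r mulr0.
  have Np : 0 < form_norm Omega w by rewrite lt_neqAle eq_sym nz.
  have V0 : 0 <= (form_norm Omega w)^-1 by rewrite invr_ge0.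
  have Ls := L2c_scale oOm OmM (form_norm Omega w)^-1 Lw.
  have := bound j _ Ls; rewrite (form_normZ oOm OmM V0 Lw) mulVf// => /(_ (lexx _)).
  rewrite (per j _ Ls) (ipZ oOm _ Lw' Lv) normrM normrM (gtr0_norm lam0) (ger0_norm V0).
  by rewrite mulrCA ler_pdivrMl// => h; rewrite mulrAC ler_pdivlMr// mulrC [leRHS]mulrC.
(* Disjointness of the holes singles out one index at a point of a hole; beyond the disc there is
   none. *)
have Phi_out p : ~ Omega p -> (exists k, forall j, \forall q \near p, Phi j q = (j == k)%:R) \/
    (forall j, \forall q \near p, Phi j q = 0).
  move=> Op; have [[k Bk]|nB] := pselect (exists k, B k p); [left; exists k => j|right => j].
    have [->|jk] := eqVneq j k; first by have [_ h _ _] := HPhi k; exact: h.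
    have [_ _ h _] := HPhi j; apply: h => // Bj.
    by move/eqP: jk; apply; apply: (holes_disjoint hB) => //; exists p.
  have [_ _ h _] := HPhi j; apply: h => // Bj; apply: nB; by exists j.
have D00 : 0 <= c / lam by rewrite divr_ge0// ltW.
have key w : L2c Omega w -> (ell2_norm (Per Omega gamma w) <= (Num.sqrt 2 * c * form_norm Omega w)%:E)%E.
  move=> Lw; apply: ell2_norm_le; first by rewrite !mulr_ge0 ?sqrtr_ge0.
  move=> s us; have h := pairing_sqr_sum oOm OmM sPhi Phi_out D00 PhiD us Lw.
  rewrite (eq_bigr (fun j => lam ^+ 2 * ip area Omega w (rotg (Phi j)) ^+ 2)); last first.
    by move=> j _; rewrite per// exprMn.
  rewrite -mulr_sumr; apply: le_trans (ler_wpM2l (sqr_ge0 lam) h) _.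
  move: (form_norm Omega w) => N.
  have -> : (Num.sqrt 2 * c * N) ^+ 2 = 2 * c ^+ 2 * N ^+ 2.
    by rewrite [LHS]exprMn [X in X * _]exprMn sqr_sqrtr.
  rewrite le_eqVlt; apply/orP; left; apply/eqP; field.
  by rewrite gt_eqF.
split; first by exists (Num.sqrt 2 * c).
rewrite CE -EFinM; apply: ge_ereal_sup => _ [w [Lw Nw] <-].
apply: le_trans (key w Lw) _; rewrite lee_fin -[leRHS]mulr1 ler_wpM2l//.
by rewrite mulr_ge0 ?sqrtr_ge0.
Qed.
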